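(* The braided Lie algebra $\mathrm{aut}_{\mathcal O(S^4_\theta)}(\mathcal O(S^7_\theta))$ of infinitesimal gauge transformations of the $\mathcal O(SU(2))$-Hopf--Galois extension $\mathcal O(S^4_\theta)\subset\mathcal O(S^7_\theta)$ is generated, as an $\mathcal O(S^4_\theta)$-module, by the elements $$\widetilde K_j:=\mathcal D(K_j),\qquad \widetilde W_{\mathsf r}:=\mathcal D(W_{\mathsf r}),\qquad j=1,2,\ \mathsf r\in\Gamma ,$$ with braided bracket on the generators given by the following list (writing $[\ ,\ ]$ for $[\ ,\ ]_{\mathsf R_{\mathsf F}}$, $q=e^{\pi i\theta}$, $a=e^{\pi i\theta/2}\hat\alpha$, $b=e^{-\pi i\theta/2}\hat\beta$, $a^*=e^{-\pi i\theta/2}\hat\alpha^*$, $b^*=e^{\pi i\theta/2}\hat\beta^*$, all products being the module action $\bullet_\theta$), the remaining brackets of generators being obtained from these by braided antisymmetry and by $[\widetilde X'^*,\widetilde X^*]=([\widetilde X,\widetilde X'])^*$: \begin{align*} &[\widetilde K_1,\widetilde K_2]=\sqrt2\,(a^*\widetilde W_{10}-a\,\widetilde W_{-10}),\\ &[\widetilde K_1,\widetilde W_{01}]=-\sqrt2\,b\,\widetilde K_2+2x\,\widetilde W_{01},\qquad [\widetilde K_1,\widetilde W_{1-1}]=-2x\,\widetilde W_{1-1}+\sqrt2\,q\,b^*\widetilde W_{10},\\ &[\widetilde K_1,\widetilde W_{10}]=\sqrt2\,q^{-1}b\,\widetilde W_{1-1}-\sqrt2\,q\,b^*\widetilde W_{11},\qquad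 [\widetilde K_1,\widetilde W_{11}]=2x\,\widetilde W_{11}-\sqrt2\,q^{-1}b\,\widetilde W_{10},\\ &[\widetilde K_2,\widetilde W_{01}]=\sqrt2\,q^{-1}a^*\widetilde W_{11}+\sqrt2\,q\,a\,\widetilde W_{-11},\qquad [\widetilde K_2,\widetilde W_{1-1}]=2x\,\widetilde W_{1-1}-\sqrt2\,q^{-1}a\,\widetilde W_{0-1},\\ &[\widetilde K_2,\widetilde W_{10}]=2x\,\widetilde W_{10}-\sqrt2\,a\,\widetilde K_1,\qquad [\widetilde K_2,\widetilde W_{11}]=2x\,\widetilde W_{11}+\sqrt2\,q\,a\,\widetilde W_{01},\\ &[\widetilde W_{01},\widetilde W_{1-1}]=\sqrt2\,b\,\widetilde W_{1-1}+\sqrt2\,q\,a(\widetilde K_2-\widetilde K_1),\qquad [\widetilde W_{01},\widetilde W_{10}]=\sqrt2\,b\,\widetilde W_{10}-\sqrt2\,q\,a\,\widetilde W_{01},\\ &[\widetilde W_{01},\widetilde W_{11}]=\sqrt2\,b\,\widetilde W_{11},\qquad [\widetilde W_{1-1},\widetilde W_{10}]=\sqrt2\,a\,\widetilde W_{1-1},\\ &[\widetilde W_{1-1},\widetilde W_{11}]=-\sqrt2\,q^{-1}a\,\widetilde W_{10},\qquad [\widetilde W_{10},\widetilde W_{11}]=\sqrt2\,a\,\widetilde W_{11},\\ &[\widetilde W_{-1-1},\widetilde W_{01}]=\sqrt2\,q^{2}b\,\widetilde W_{-1-1}-\sqrt2\,q\,a^*(\widetilde K_1+\widetilde K_2),\qquad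 [\widetilde W_{-1-1},\widetilde W_{1-1}]=\sqrt2\,q^{-2}b^*\widetilde W_{0-1},\\ &[\widetilde W_{-1-1},\widetilde W_{10}]=\sqrt2\,a\,\widetilde W_{-1-1}+\sqrt2\,q\,b^*(\widetilde K_1+\widetilde K_2),\\ &[\widetilde W_{-1-1},\widetilde W_{11}]=-2x(\widetilde K_1+\widetilde K_2)-\sqrt2\,a\,\widetilde W_{-10}-\sqrt2\,b\,\widetilde W_{0-1},\\ &[\widetilde W_{-10},\widetilde W_{01}]=\sqrt2\,q^{2}b\,\widetilde W_{-10}+\sqrt2\,a^*\widetilde W_{01},\qquad [\widetilde W_{-10},\widetilde W_{1-1}]=-\sqrt2\,a^*\widetilde W_{1-1}+\sqrt2\,q^{-1}b^*(\widetilde K_2-\widetilde K_1),\\ &[\widetilde W_{10},\widetilde W_{-10}]=\sqrt2\,(b^*\widetilde W_{01}+b\,\widetilde W_{0-1}),\qquad [\widetilde W_{-11},\widetilde W_{01}]=\sqrt2\,q^{2}b\,\widetilde W_{-11},\\ &[\widetilde W_{0-1},\widetilde W_{01}]=\sqrt2\,(a^*\widetilde W_{10}-a\,\widetilde W_{-10}),\\ &[\widetilde W_{-11},\widetilde W_{1-1}]=2x(\widetilde K_1-\widetilde K_2)-\sqrt2\,b^*\widetilde W_{01}+\sqrt2\,a\,\widetilde W_{-10}. \end{align*} The braided Lie bracket of generic elements is then given, for $\widetilde X,\widetilde X'\in\mathrm{aut}_{\mathcal O(S^4_\theta)}(\mathcal O(S^7_\theta))$ and $f,f'\in\mathcal O(S^4_\theta)$,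 by $$[f\bullet_\theta\widetilde X,\ f'\bullet_\theta\widetilde X']_{\mathsf R_{\mathsf F}}=f\bullet_\theta(\mathsf R_{\mathsf F\,\alpha}\triangleright f')\bullet_\theta[\mathsf R_{\mathsf F}^{\ \alpha}\triangleright\widetilde X,\widetilde X']_{\mathsf R_{\mathsf F}} .$$
   Context: **Classical bundle.** $\mathcal O(S^7)$ is the commutative complex $*$-algebra generated by $z_a,z_a^*$ ($a=1,\dots,4$) with $\sum_a z_a^*z_a=1$. $H=\mathcal O(SU(2))$ is the commutative $*$-Hopf algebra generated by $w_j,w_j^*$ ($j=1,2$) with $\sum w_j^*w_j=1$ (standard structure from the group $SU(2)$, matrix $\begin{pmatrix}w_1&-w_2^*\\ w_2&w_1^*\end{pmatrix}$). The coaction $\delta:\mathcal O(S^7)\to\mathcal O(S^7)\otimes H$ is the $*$-algebra map with $\delta(z_1)=z_1\otimes w_1-z_2^*\otimes w_2$, $\delta(z_2)=z_2\otimes w_1+z_1^*\otimes w_2$, $\delta(z_3)=z_3\otimes w_1-z_4^*\otimes w_2$, $\delta(z_4)=z_4\otimes w_1+z_3^*\otimes w_2$. Its coinvariant subalgebra $\mathcal O(S^4)$ is generated by $\alpha=2(z_1z_3^*+z_2^*z_4)$, $\beta=2(z_2z_3^*-z_1^*z_4)$, $x=z_1z_1^*+z_2z_2^*-z_3z_3^*-z_4z_4^*$ and $\alpha^*,\beta^*$. Let $\partial_a,\partial_a^*$ be partial derivatives with respect to $z_a,z_a^*$. Define derivations of $\mathcal O(S^7)$: $H_1=\frac12(z_1\partial_1-z_1^*\partial_1^*-z_2\partial_2+z_2^*\partial_2^*-z_3\partial_3+z_3^*\partial_3^*+z_4\partial_4-z_4^*\partial_4^*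 )$, $H_2=\frac12(-z_1\partial_1+z_1^*\partial_1^*+z_2\partial_2-z_2^*\partial_2^*-z_3\partial_3+z_3^*\partial_3^*+z_4\partial_4-z_4^*\partial_4^* )$, $E_{10}=\frac1{\sqrt2}(z_1\partial_3-z_3^*\partial_1^*-z_4\partial_2+z_2^*\partial_4^* )$, $E_{-10}=\frac1{\sqrt2}(z_3\partial_1-z_1^*\partial_3^*-z_2\partial_4+z_4^*\partial_2^* )$, $E_{01}=\frac1{\sqrt2}(z_2\partial_3-z_3^*\partial_2^*+z_4\partial_1-z_1^*\partial_4^* )$, $E_{0-1}=\frac1{\sqrt2}(z_1\partial_4-z_4^*\partial_1^*+z_3\partial_2-z_2^*\partial_3^* )$, $E_{11}=-z_4\partial_3+z_3^*\partial_4^*$, $E_{-1-1}=z_4^*\partial_3^*-z_3\partial_4$, $E_{1-1}=-z_1\partial_2+z_2^*\partial_1^*$, $E_{-11}=-z_2\partial_1+z_1^*\partial_2^*$. Here $\Gamma=\{(\pm1,0),(0,\pm1),(\pm1,\pm1)\}$. Define the derivations $K_1=2xH_2+\sqrt2\beta^*E_{01}+\sqrt2\beta E_{0-1}$, $K_2=2xH_1+\sqrt2\alpha^*E_{10}+\sqrt2\alpha E_{-10}$, $W_{01}=\sqrt2(\beta H_1+\alpha^*E_{11}+\alpha E_{-11})$, $W_{0-1}=\sqrt2(\beta^*H_1+\alpha^*E_{1-1}+\alpha E_{-1-1})$, $W_{10}=\sqrt2(\alpha H_2-\beta^*E_{11}+\beta E_{1-1})$, $W_{-10}=\sqrt2(\alpha^*H_2+\beta^*E_{-11}-\beta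 E_{-1-1})$, $W_{11}=2xE_{11}+\sqrt2\alpha E_{01}-\sqrt2\beta E_{10}$, $W_{-1-1}=2xE_{-1-1}+\sqrt2\alpha^*E_{0-1}-\sqrt2\beta^*E_{-10}$, $W_{1-1}=-2xE_{1-1}+\sqrt2\beta^*E_{10}+\sqrt2\alpha E_{0-1}$, $W_{-11}=-2xE_{-11}+\sqrt2\beta E_{-10}+\sqrt2\alpha^*E_{01}$. **Twist.** $\theta\in\mathbb R$. A weight vector of weight $\mathsf s=(s_1,s_2)$ is $a\in\mathcal O(S^7)$ with $H_ja=s_ja$, respectively a linear map $\psi$ of $\mathcal O(S^7)$ with $[H_j,\psi]=s_j\psi$; $\mathsf r\wedge\mathsf s:=r_1s_2-r_2s_1$. $K$ is the universal enveloping algebra of the abelian Lie algebra spanned by $H_1,H_2$, with twist $\mathsf F=e^{\pi i\theta(H_1\otimes H_2-H_2\otimes H_1)}$ and resulting universal $R$-matrix $\mathsf R_{\mathsf F}=\mathsf F^{-2}=\mathsf R_{\mathsf F}^{\ \alpha}\otimes\mathsf R_{\mathsf F\,\alpha}$ (always applied to weight vectors). Thus for $X$ of weight $\mathsf r$ and $f$ of weight $\mathsf s$, $(\mathsf R_{\mathsf F\,\alpha}\triangleright f)\otimes(\mathsf R_{\mathsf F}^{\ \alpha}\triangleright X)=e^{-2\pi i\theta\,\mathsf r\wedge\mathsf s}f\otimes X$. $\mathcal O(S^7_\theta)$ is the vector space $\mathcal O(S^7)$ with product $a\bullet_\theta a'=e^{-i\pi\theta\,\mathsf s\wedge\mathsf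 m}aa'$ for $a,a'$ of weights $\mathsf s,\mathsf m$, with unchanged $*$ and coaction $\delta$. $\mathcal O(S^4_\theta)$ is its coinvariant subalgebra (the vector space $\mathcal O(S^4)$), generated by $\hat\alpha=2(z_1\bullet_\theta z_3^*+z_2^*\bullet_\theta z_4)=e^{-\pi i\theta/2}\alpha$, $\hat\beta=2(z_2\bullet_\theta z_3^*-z_1^*\bullet_\theta z_4)=e^{\pi i\theta/2}\beta$, $x$ and $\hat\alpha^*,\hat\beta^*$. A braided derivation of $\mathcal O(S^7_\theta)$ is a linear map $\psi$ with $\psi(a\bullet_\theta a')=\psi(a)\bullet_\theta a'+(\mathsf R_{\mathsf F\,\alpha}\triangleright a)\bullet_\theta(\mathsf R_{\mathsf F}^{\ \alpha}\triangleright\psi)(a')$. $\mathrm{aut}_{\mathcal O(S^4_\theta)}(\mathcal O(S^7_\theta))$ is the space of braided derivations $\psi$ with $\delta\circ\psi=(\psi\otimes\mathrm{id})\circ\delta$ and $\psi(f)=0$ for all $f\in\mathcal O(S^4_\theta)$; it is a module via $(f\bullet_\theta\psi)(a)=f\bullet_\theta\psi(a)$ and has bracket $[\psi,\lambda]_{\mathsf R_{\mathsf F}}=\psi\circ\lambda-(\mathsf R_{\mathsf F\,\alpha}\triangleright\lambda)\circ(\mathsf R_{\mathsf F}^{\ \alpha}\triangleright\psi)$, i.e. $\psi\lambda-e^{-2\pi i\theta\,\mathsf r\wedge\mathsf s}\lambda\psi$ for weights $\mathsf r,\mathsf s$ of $\psi,\lambda$. Braided antisymmetry: $[\psi,\lambda]_{\mathsf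 R_{\mathsf F}}=-e^{-2\pi i\theta\,\mathsf r\wedge\mathsf s}[\lambda,\psi]_{\mathsf R_{\mathsf F}}$. For a derivation $X$ of $\mathcal O(S^7)$ of weight $\mathsf r$, $\mathcal D(X)$ is the linear map $\mathcal D(X)(a)=e^{-i\pi\theta\,\mathsf r\wedge\mathsf s}X(a)$ for $a$ of weight $\mathsf s$. $K_j$ has weight $0$ and $W_{\mathsf r}$ has weight $\mathsf r$. The $*$-structure on braided derivations is $\psi^*(a)=-e^{2\pi i\theta\,\mathsf r\wedge\mathsf s}(\psi(a^* ))^*$ for $\psi$ of weight $\mathsf r$ and $a$ of weight $\mathsf s$; it satisfies $\widetilde K_j^*=\widetilde K_j$, $\widetilde W_{\mathsf r}^*=\widetilde W_{-\mathsf r}$ and $(f\bullet_\theta\widetilde X)^*=e^{-2\pi i\theta\,\mathsf r\wedge\mathsf m}f^*\bullet_\theta\widetilde X^*$ for $\widetilde X$ of weight $\mathsf r$ and $f$ of weight $\mathsf m$.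
   Formalization: Five printed brackets are corrected: [W01,W10] has −√2q²aW01; [W1-1,W10]=√2q⁻²aW1-1; [W1-1,W11]=−√2q⁻²aW10; [W-1-1,W10]=√2q⁻²aW-1-1+√2q⁻¹b*(K1+K2); [W0-1,W01]=−√2(a*W10+aW-10). *)

(* Defs.v *)
From HB Require Import structures.
From mathcomp Require Import all_boot all_order all_algebra.
From mathcomp Require Import ring_quotient mpoly.
From mathcomp Require Import complex.
From mathcomp Require Import boolp functions reals trigo.
From mathcomp Require Import zify ring.

Set Implicit Arguments.
Unset Strict Implicit.
Unset Printing Implicit Defensive.

Import Order.TTheory GRing.Theory Num.Theory.
Local Open Scope ring_scope.
Local Open Scope quotient_scope.
Local Open Scope complex_scope.

(* sphere n S is the commutative S-algebra generated by z_i, z_i^*            *)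
(* (i = 0, ..., n) subject to \sum_i z_i^* z_i = 1. Among the n.+1 + n.+1     *)
(* variables, the left ones (lshift) are the z_i and the right ones (rshift)  *)
(* are the z_i^*. It is used for O(S^7) (n = 3, S = C), O(SU(2)) (n = 1,      *)
(* S = C), and O(S^7) (x) O(SU(2)) (n = 1, S = O(S^7), base change).          *)
Section Sphere.
Variables (n : nat) (S : comNzRingType).

Local Notation poly := {mpoly S[n.+1 + n.+1]}.

Definition sphere_rel : poly :=
  \sum_(i < n.+1) 'X_(rshift n.+1 i) * 'X_(lshift n.+1 i) - 1.

Definition sphere_ideal : {pred poly} :=
  [pred p : poly | `[< exists q : poly, p = q * sphere_rel >]].

Lemma sphere_ideal_closed : idealr_closed sphere_ideal.
Proof.
split.
- by rewrite inE; apply/asboolP; exists 0; rewrite mul0r.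
- rewrite inE; apply/asboolP => -[q q1].
  pose pt (i : 'I_(n.+1 + n.+1)) : S :=
    ((i == lshift n.+1 ord0) || (i == rshift n.+1 ord0))%:R.
  have /eqP := congr1 (meval pt) q1.
  rewrite mevalM mevalB !meval1 [meval pt (\sum_(_ < _) _)]raddf_sum /=.
  rewrite big_ord_recl big1 ?addr0 => [|i _].
    rewrite mevalM !mevalXU /pt !eqxx orbT /= mulr1 subrr mulr0.
    by rewrite oner_eq0.
  rewrite mevalM !mevalXU /pt !(eq_lshift, eq_rshift, eq_lrshift, eq_rlshift).
  by rewrite /= !mul0r.
- move=> a u v; rewrite !inE => /asboolP[q ->] /asboolP[r ->].
  by apply/asboolP; exists (a * q + r); rewrite mulrDl mulrA.
Qed.

HB.instance Definition _ := isIdealr.Build poly sphere_ideal sphere_ideal_closed.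

Definition sphere := {ideal_quot sphere_ideal}.

HB.instance Definition _ := GRing.ComNzRing.on sphere.

Definition sphere_class (p : poly) : sphere := \pi_sphere p.
Definition sphere_lift (a : sphere) : poly := repr a.

Lemma sphere_liftK a : sphere_class (sphere_lift a) = a.
Proof. exact: reprK. Qed.

Lemma sphere_classP p q :
  sphere_class p = sphere_class q <-> exists r, p - q = r * sphere_rel.
Proof.
split=> [/eqP|pq].
  by rewrite /sphere_class -Quotient.idealrBE => /asboolP.
by apply/eqP; rewrite /sphere_class -Quotient.idealrBE; apply/asboolP.
Qed.

HB.instance Definition _ := GRing.RMorphism.copy sphere_class \pi_sphere.

Definition sphere_scale (c : S) (a : sphere) : sphere :=
  sphere_class c%:MP * a.

Fact sphere_scaleA c d a :
  sphere_scale c (sphere_scale d a) = sphere_scale (c * d) a.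
Proof. by rewrite /sphere_scale mulrA -!rmorphM. Qed.

Fact sphere_scale1 : left_id 1 sphere_scale.
Proof. by move=> a; rewrite /sphere_scale !rmorph1 mul1r. Qed.

Fact sphere_scaleDr : right_distributive sphere_scale +%R.
Proof. by move=> c a b; rewrite /sphere_scale mulrDr. Qed.

Fact sphere_scaleDl a : {morph sphere_scale^~ a : c d / c + d}.
Proof. by move=> c d; rewrite /sphere_scale !rmorphD mulrDl. Qed.

HB.instance Definition _ := GRing.Zmodule_isLmodule.Build S sphere
  sphere_scaleA sphere_scale1 sphere_scaleDr sphere_scaleDl.

Fact sphere_scaleAl c (a b : sphere) : c *: (a * b) = (c *: a) * b.
Proof. exact: mulrA. Qed.

HB.instance Definition _ := GRing.Lmodule_isLalgebra.Build S sphere sphere_scaleAl.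
HB.instance Definition _ := GRing.Lalgebra_isComAlgebra.Build S sphere.

(* The *-operation extending the involution conj of the scalars and exchanging *)
(* z_i with z_i^*.                                                            *)
Definition sphere_swap (i : 'I_(n.+1 + n.+1)) : 'I_(n.+1 + n.+1) :=
  match fintype.split i with inl j => rshift n.+1 j | inr j => lshift n.+1 j end.

Definition sphere_star (conj : S -> S) (a : sphere) : sphere :=
  sphere_class
    (mmap (fun c => (conj c)%:MP) (fun i => 'X_(sphere_swap i)) (sphere_lift a)).

Lemma sphere_classZ c p : sphere_class (c *: p) = c *: sphere_class p.
Proof. by rewrite -mul_mpolyC rmorphM. Qed.

End Sphere.


Notation OS7 R := (sphere 3 R[i]).
(* O(S^7) (x) O(SU(2)): the elementary tensor a (x) h of a in O(S^7) with a   *)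
(* monomial h in w_j, w_j^* is a *: h.                                        *)
Notation OS7_SU2 R := (sphere 1 (OS7 R)).

Section Bundle.
Variable R : realType.
Implicit Types (a b f : OS7 R) (psi : OS7 R -> OS7 R).

(* Zp, Zps: polynomials representing z_a, z_a^*; dz, dzs: derivatives with    *)
(* respect to them. The index a = 1, ..., 4 of z_a is a.-1 : 'I_4 here.       *)
Local Notation poly := {mpoly R[i][4 + 4]}.

Definition i1 : 'I_4 := @Ordinal 4 0 isT.
Definition i2 : 'I_4 := @Ordinal 4 1 isT.
Definition i3 : 'I_4 := @Ordinal 4 2 isT.
Definition i4 : 'I_4 := @Ordinal 4 3 isT.

Definition Zp (i : 'I_4) : poly := 'X_(lshift 4 i).
Definition Zps (i : 'I_4) : poly := 'X_(rshift 4 i).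
Definition dz (i : 'I_4) (p : poly) : poly := p^`M(lshift 4 i).
Definition dzs (i : 'I_4) (p : poly) : poly := p^`M(rshift 4 i).

Definition z (i : 'I_4) : OS7 R := sphere_class (Zp i).
Definition zs (i : 'I_4) : OS7 R := sphere_class (Zps i).

Definition star : OS7 R -> OS7 R := sphere_star (@conjc R).

Definition sqrt2 : R[i] := (Num.sqrt 2 : R)%:C.

Definition alpha : OS7 R := 2 *: (z i1 * zs i3 + zs i2 * z i4).
Definition beta : OS7 R := 2 *: (z i2 * zs i3 - zs i1 * z i4).
Definition xS4 : OS7 R :=
  z i1 * zs i1 + z i2 * zs i2 - z i3 * zs i3 - z i4 * zs i4.
Definition alphas : OS7 R := star alpha.
Definition betas : OS7 R := star beta.

(* The map induced on O(S^7) by a derivation of the polynomial algebra that   *)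
(* preserves the sphere ideal, as the ones below do.                          *)
Definition descend (D : poly -> poly) (a : OS7 R) : OS7 R :=
  sphere_class (D (sphere_lift a)).

Definition H1 : OS7 R -> OS7 R := descend (fun p => 2^-1 *:
  (Zp i1 * dz i1 p - Zps i1 * dzs i1 p - Zp i2 * dz i2 p + Zps i2 * dzs i2 p
   - Zp i3 * dz i3 p + Zps i3 * dzs i3 p + Zp i4 * dz i4 p - Zps i4 * dzs i4 p)).
Definition H2 : OS7 R -> OS7 R := descend (fun p => 2^-1 *:
  (- (Zp i1 * dz i1 p) + Zps i1 * dzs i1 p + Zp i2 * dz i2 p - Zps i2 * dzs i2 p
   - Zp i3 * dz i3 p + Zps i3 * dzs i3 p + Zp i4 * dz i4 p - Zps i4 * dzs i4 p)).
Definition E10 : OS7 R -> OS7 R := descend (fun p => sqrt2^-1 *: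
  (Zp i1 * dz i3 p - Zps i3 * dzs i1 p - Zp i4 * dz i2 p + Zps i2 * dzs i4 p)).
Definition Em10 : OS7 R -> OS7 R := descend (fun p => sqrt2^-1 *:
  (Zp i3 * dz i1 p - Zps i1 * dzs i3 p - Zp i2 * dz i4 p + Zps i4 * dzs i2 p)).
Definition E01 : OS7 R -> OS7 R := descend (fun p => sqrt2^-1 *:
  (Zp i2 * dz i3 p - Zps i3 * dzs i2 p + Zp i4 * dz i1 p - Zps i1 * dzs i4 p)).
Definition E0m1 : OS7 R -> OS7 R := descend (fun p => sqrt2^-1 *:
  (Zp i1 * dz i4 p - Zps i4 * dzs i1 p + Zp i3 * dz i2 p - Zps i2 * dzs i3 p)).
Definition E11 : OS7 R -> OS7 R := descend (fun p =>
  - (Zp i4 * dz i3 p) + Zps i3 * dzs i4 p).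
Definition Em1m1 : OS7 R -> OS7 R := descend (fun p =>
  Zps i4 * dzs i3 p - Zp i3 * dz i4 p).
Definition E1m1 : OS7 R -> OS7 R := descend (fun p =>
  - (Zp i1 * dz i2 p) + Zps i2 * dzs i1 p).
Definition Em11 : OS7 R -> OS7 R := descend (fun p =>
  - (Zp i2 * dz i1 p) + Zps i1 * dzs i2 p).

(* K1, K2 and W_r for r in Gamma, where m stands for a minus sign.            *)
Inductive gen : Type :=
  K1 | K2 | W10 | Wm10 | W01 | W0m1 | W11 | Wm1m1 | W1m1 | Wm11.

Definition gens : seq gen :=
  [:: K1; K2; W10; Wm10; W01; W0m1; W11; Wm1m1; W1m1; Wm11].

Definition gen_weight (g : gen) : R * R :=
  match g with
  | K1 | K2 => (0, 0)
  | W10 => (1, 0)   | Wm10 => (-1, 0)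
  | W01 => (0, 1)   | W0m1 => (0, -1)
  | W11 => (1, 1)   | Wm1m1 => (-1, -1)
  | W1m1 => (1, -1) | Wm11 => (-1, 1)
  end.

Definition gen_opp (g : gen) : gen :=
  match g with
  | K1 => K1 | K2 => K2
  | W10 => Wm10   | Wm10 => W10
  | W01 => W0m1   | W0m1 => W01
  | W11 => Wm1m1  | Wm1m1 => W11
  | W1m1 => Wm11  | Wm11 => W1m1
  end.

Definition gen_der (g : gen) (a : OS7 R) : OS7 R :=
  match g with
  | K1 => 2 *: (xS4 * H2 a) + sqrt2 *: (betas * E01 a) + sqrt2 *: (beta * E0m1 a)
  | K2 => 2 *: (xS4 * H1 a) + sqrt2 *: (alphas * E10 a) + sqrt2 *: (alpha * Em10 a)
  | W01 => sqrt2 *: (beta * H1 a + alphas * E11 a + alpha * Em11 a)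
  | W0m1 => sqrt2 *: (betas * H1 a + alphas * E1m1 a + alpha * Em1m1 a)
  | W10 => sqrt2 *: (alpha * H2 a - betas * E11 a + beta * E1m1 a)
  | Wm10 => sqrt2 *: (alphas * H2 a + betas * Em11 a - beta * Em1m1 a)
  | W11 => 2 *: (xS4 * E11 a) + sqrt2 *: (alpha * E01 a) - sqrt2 *: (beta * E10 a)
  | Wm1m1 =>
      2 *: (xS4 * Em1m1 a) + sqrt2 *: (alphas * E0m1 a) - sqrt2 *: (betas * Em10 a)
  | W1m1 =>
      - (2 *: (xS4 * E1m1 a)) + sqrt2 *: (betas * E10 a) + sqrt2 *: (alpha * E0m1 a)
  | Wm11 =>
      - (2 *: (xS4 * Em11 a)) + sqrt2 *: (beta * Em10 a) + sqrt2 *: (alphas * E01 a)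
  end.

(* The coaction of O(SU(2)), with w_1, w_2 the generators of O(SU(2)).        *)
Definition w1 : OS7_SU2 R := sphere_class 'X_(lshift 2 (@Ordinal 2 0 isT)).
Definition w2 : OS7_SU2 R := sphere_class 'X_(lshift 2 (@Ordinal 2 1 isT)).

Definition coaction_z (i : 'I_4) : OS7_SU2 R :=
  match val i with
  | 0 => z i1 *: w1 - zs i2 *: w2
  | 1 => z i2 *: w1 + zs i1 *: w2
  | 2 => z i3 *: w1 - zs i4 *: w2
  | _ => z i4 *: w1 + zs i3 *: w2
  end.

Definition coaction_gen (i : 'I_(4 + 4)) : OS7_SU2 R :=
  match fintype.split i with
  | inl j => coaction_z j
  | inr j => sphere_star star (coaction_z j)
  end.

Definition coaction (a : OS7 R) : OS7_SU2 R :=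
  mmap (fun c : R[i] => (c%:A : OS7 R)%:A) coaction_gen (sphere_lift a).

(* psi (x) id for a C-linear psi: psi is applied to the coefficients of the   *)
(* monomials in w_j, w_j^*.                                                   *)
Definition tensor_id psi (t : OS7_SU2 R) : OS7_SU2 R :=
  sphere_class (map_mpoly psi (sphere_lift t)).

Definition OS4 a : Prop := coaction a = a%:A.

Implicit Types r s t : R * R.

Definition weight_vector s a : Prop :=
  H1 a = (s.1)%:C *: a /\ H2 a = (s.2)%:C *: a.

Definition wedge r s : R := r.1 * s.2 - r.2 * s.1.

Definition z_weight (i : 'I_4) : R * R :=
  match val i with
  | 0 => (2^-1, - 2^-1)
  | 1 => (- 2^-1, 2^-1)
  | 2 => (- 2^-1, - 2^-1)
  | _ => (2^-1, 2^-1)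
  end.

Definition var_weight (i : 'I_(4 + 4)) : R * R :=
  match fintype.split i with inl j => z_weight j | inr j => - z_weight j end.

Definition mon_weight (m : 'X_{1..4 + 4}) : R * R := \sum_i var_weight i *+ m i.

(* \sum_s F s a_s, where a = \sum_s a_s is the decomposition of a into weight *)
(* vectors a_s of weight s; F s is additive for every s in all uses below.    *)
(* Every monomial is a weight vector, and the sphere relation has weight 0.   *)
Definition over_weights (F : R * R -> OS7 R -> OS7 R) a : OS7 R :=
  let p := sphere_lift a in
  \sum_(m <- msupp p) F (mon_weight m) (sphere_class (p@_m *: 'X_[m])).

(* \sum_(r, s) F r s (psi_r a_s), where moreover psi = \sum_r psi_r is the    *)
(* decomposition of psi into linear maps psi_r of weight r. The component of  *)
(* weight t of psi a_s is psi_(t - s) a_s.                                    *)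
Definition over_map_weights (F : R * R -> R * R -> OS7 R -> OS7 R) psi a : OS7 R :=
  over_weights (fun s a_s => over_weights (fun t b => F (t - s) s b) (psi a_s)) a.

Section OverWeights.
Local Notation poly := {mpoly R[i][4 + 4]}.

Definition wproj s (p : poly) : poly :=
  \sum_(m <- msupp p | mon_weight m == s) p@_m *: 'X_[m].

Lemma mcoeff_wproj s p m : (wproj s p)@_m = if mon_weight m == s then p@_m else 0.
Proof.
rewrite /wproj raddf_sum /=.
under eq_bigr do rewrite mcoeffZ mcoeffX.
case: ifP => ms; last first.
  rewrite big1 // => k /eqP ks; case: eqP => [km|_]; last by rewrite mulr0.
  by move: ms; rewrite -km ks eqxx.
have [mp|mp] := boolP (m \in msupp p); last first.
  rewrite (memN_msupp_eq0 mp) big1_seq // => k /andP[_ kp].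
  case: eqP => [km|_]; last by rewrite mulr0.
  by rewrite -km kp in mp.
rewrite big_mkcond (bigD1_seq m) ?msupp_uniq //= ms eqxx mulr1.
by rewrite big1 ?addr0 // => k /negPf->; rewrite mulr0 if_same.
Qed.

Fact wproj_is_linear s : linear (wproj s).
Proof.
move=> c p q; apply/mpolyP => m.
rewrite !(mcoeffD, mcoeffZ, mcoeff_wproj); case: ifP => // _.
by rewrite mulr0 addr0.
Qed.
HB.instance Definition _ s :=
  GRing.isLinear.Build R[i] poly poly *:%R (wproj s) (wproj_is_linear s).

Lemma mon_weightD m k : mon_weight (m + k) = mon_weight m + mon_weight k.
Proof.
rewrite /mon_weight -big_split /=; apply: eq_bigr => i _.
by rewrite mnmDE mulrnDr.
Qed.

Lemma mon_weightU i : mon_weight U_(i) = var_weight i.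
Proof.
rewrite /mon_weight (bigD1 i) //= big1 ?addr0 => [|j ji].
  by rewrite mnm1E eqxx mulr1n.
by rewrite mnm1E eq_sym (negPf ji) mulr0n.
Qed.

Lemma wprojX s m : wproj s 'X_[m] = if mon_weight m == s then 'X_[m] else 0.
Proof.
apply/mpolyP => k; rewrite mcoeff_wproj mcoeffX.
case: (m =P k) => [->|mk]; case: ifP => // _; rewrite ?mcoeff0 ?mcoeffX ?eqxx //;
by case: ifP => // _; rewrite ?mcoeff0 ?mcoeffX // (introF eqP mk).
Qed.

Lemma wproj_XM_rel s m :
  wproj s ('X_[m] * sphere_rel 3 R[i]) = wproj s 'X_[m] * sphere_rel 3 R[i].
Proof.
rewrite wprojX /sphere_rel !mulrBr !mulr1 raddfB /= wprojX.
rewrite !mulr_sumr raddf_sum /=.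
have w0 i : mon_weight (m + (U_(rshift 4 i) + U_(lshift 4 i)))%MM = mon_weight m.
  rewrite !mon_weightD !mon_weightU /var_weight.
  by rewrite (unsplitK (inl i)) (unsplitK (inr i)) addNr addr0.
congr (_ - _); apply: eq_bigr => i _.
rewrite -!mpolyXD wprojX w0.
by case: ifP => _; rewrite ?mul0r // mpolyXD.
Qed.

Lemma wproj_rel s q :
  wproj s (q * sphere_rel 3 R[i]) = wproj s q * sphere_rel 3 R[i].
Proof.
rewrite [q]mpolyE mulr_suml !raddf_sum mulr_suml /=; apply: eq_bigr => m _.
by rewrite -scalerAl !linearZ /= wproj_XM_rel scalerAl.
Qed.

Definition over_weights_poly (F : R * R -> OS7 R -> OS7 R) (p : poly) : OS7 R :=
  \sum_(m <- msupp p) F (mon_weight m) (sphere_class (p@_m *: 'X_[m])).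

Variable F : R * R -> {additive OS7 R -> OS7 R}.

Lemma over_weights_polyE (S : seq (R * R)) p :
    uniq S -> {subset [seq mon_weight m | m <- msupp p] <= S} ->
  over_weights_poly F p = \sum_(s <- S) F s (sphere_class (wproj s p)).
Proof.
move=> uS pS; rewrite /over_weights_poly /wproj.
under [RHS]eq_bigr do rewrite !raddf_sum big_mkcond.
rewrite exchange_big /=; apply: eq_big_seq => m mp.
have mS : mon_weight m \in S by apply/pS/map_f.
rewrite (bigD1_seq (mon_weight m)) //= eqxx big1 ?addr0 // => s.
by rewrite eq_sym => /negPf ->.
Qed.

Lemma over_weights_poly_class p q :
  sphere_class p = sphere_class q -> over_weights_poly F p = over_weights_poly F q.
Proof.
move=> /sphere_classP[r pq].
pose S := undup ([seq mon_weight m | m <- msupp p] ++ [seq mon_weight m | m <- msupp q]).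
rewrite !(@over_weights_polyE S) ?undup_uniq // => [|s sq|s sp]; last 2 first.
- by rewrite mem_undup mem_cat sq orbT.
- by rewrite mem_undup mem_cat sp.
apply: eq_bigr => s _; congr (F s _); apply/sphere_classP.
by exists (wproj s r); rewrite -raddfB pq /= wproj_rel.
Qed.

Lemma over_weights_class p : over_weights F (sphere_class p) = over_weights_poly F p.
Proof. by apply: over_weights_poly_class; rewrite sphere_liftK. Qed.

Lemma over_weightsB : zmod_morphism (over_weights F).
Proof.
move=> a b; rewrite -[in LHS](sphere_liftK a) -[in LHS](sphere_liftK b) -raddfB /=.
have cB : sphere_class (sphere_lift a - sphere_lift b) = a - b.
  by rewrite raddfB /= !sphere_liftK.
rewrite over_weights_class.
pose ws (p : poly) := [seq mon_weight m | m <- msupp p].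
pose p := sphere_lift a; pose q := sphere_lift b.
pose S := undup (ws (p - q) ++ ws p ++ ws q).
have SE u : u \in [:: p - q; p; q] ->
    over_weights_poly F u = \sum_(s <- S) F s (sphere_class (wproj s u)).
  rewrite !inE => uP; apply: over_weights_polyE; rewrite ?undup_uniq // => s.
  by rewrite mem_undup !mem_cat; case/or3P: uP => /eqP-> ->; rewrite ?orbT.
have -> : over_weights F a = over_weights_poly F p by [].
have -> : over_weights F b = over_weights_poly F q by [].
rewrite !SE ?inE ?eqxx ?orbT // -sumrB; apply: eq_bigr => s _.
by rewrite !raddfB.
Qed.

Let euler (i : 'I_(4 + 4)) (p : poly) : poly := 'X_i * p^`M(i).

Let mcoeff_euler i p m : (euler i p)@_m = (m i)%:R * p@_m.
Proof.
rewrite /euler [p in LHS]mpolyE !raddf_sum mulr_sumr raddf_sum /=.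
rewrite (eq_bigr (fun k : 'X_{1..4 + 4} => (k i)%:R * p@_k * (k == m)%:R)) => [|k _].
  have [mp|mp] := boolP (m \in msupp p); last first.
    rewrite (memN_msupp_eq0 mp) mulr0 big1_seq // => k /andP[_ kp].
    case: eqP => [km|_]; last by rewrite mulr0.
    by rewrite -km kp in mp.
  rewrite (bigD1_seq m) ?msupp_uniq //= eqxx mulr1 big1 ?addr0 // => k /negPf->.
  by rewrite mulr0.
rewrite mderivZ mderivX -!scalerAr !mcoeffZ -mpolyXD.
rewrite mcoeffX mulrCA mulrA; have [k0|k0] := posnP (k i).
  by rewrite k0 ?(mulr0n, mul0r, mulr0).
have -> : (U_(i) + (k - U_(i)) = k)%MM.
  by apply/mnmP => j; rewrite mnmDE mnmBE mnm1E; case: eqP => [<-|_] /=; lia.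
ring.
Qed.

Let mon_weightE (m : 'X_{1..4 + 4}) (f : R * R -> R) :
    {morph f : x y / x + y} -> {morph f : x / - x} -> f 0 = 0 ->
  f (mon_weight m) =
    f (z_weight i1) * ((m (lshift 4 i1))%:R - (m (rshift 4 i1))%:R)
  + f (z_weight i2) * ((m (lshift 4 i2))%:R - (m (rshift 4 i2))%:R)
  + f (z_weight i3) * ((m (lshift 4 i3))%:R - (m (rshift 4 i3))%:R)
  + f (z_weight i4) * ((m (lshift 4 i4))%:R - (m (rshift 4 i4))%:R).
Proof.
move=> fD fN f0.
have fM x k : f (x *+ k) = f x * k%:R.
  elim: k => [|k IHk]; first by rewrite mulr0 f0.
  by rewrite mulrSr fD IHk mulrS mulrDr mulr1 addrC.
rewrite /mon_weight big_split_ord /= !fD.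
have fsum (h : 'I_4 -> R * R) : f (\sum_i h i) = f (h i1) + f (h i2) + f (h i3) + f (h i4).
  rewrite !big_ord_recl big_ord0 addr0 !fD !addrA.
  by congr (_ + _ + _ + _); congr (f (h _)); apply: val_inj.
rewrite !fsum !fM /var_weight.
rewrite !(unsplitK (inl _)) !(unsplitK (inr _)) !fN.
ring.
Qed.

Let mcoeff_ZpM i p m : (Zp i * dz i p)@_m = (m (lshift 4 i))%:R * p@_m.
Proof. exact: mcoeff_euler. Qed.

Let mcoeff_ZpsM i p m : (Zps i * dzs i p)@_m = (m (rshift 4 i))%:R * p@_m.
Proof. exact: mcoeff_euler. Qed.

Let half_C : (2^-1 : R)%:C = 2^-1 :> R[i].
Proof. by rewrite fmorphV rmorph_nat. Qed.

Let wproj_ker (u : R * R -> R) (s t : R * R) (p q r : poly) :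
    (forall m, q@_m = (u (mon_weight m))%:C * p@_m) ->
    q - (u s)%:C *: p = r * sphere_rel 3 R[i] -> u t != u s ->
  sphere_class (wproj t p) = 0.
Proof.
move=> qE qr uts; have uts0 : (u t - u s)%:C != 0 by rewrite fmorph_eq0 subr_eq0.
apply: (scalerI uts0); rewrite scaler0 -sphere_classZ -(rmorph0 (@sphere_class 3 R[i])).
apply/sphere_classP; exists (wproj t r); rewrite subr0 -wproj_rel -qr.
apply/mpolyP => m; rewrite mcoeffZ !mcoeff_wproj mcoeffB mcoeffZ qE.
case: eqP => [->|_]; last by rewrite mulr0.
by rewrite rmorphB mulrBl.
Qed.

Lemma over_weightsE s a : weight_vector s a -> over_weights F a = F s a.
Proof.
case=> H1a H2a; pose p := sphere_lift a.
pose S := undup (s :: [seq mon_weight m | m <- msupp p]).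
have pS : {subset [seq mon_weight m | m <- msupp p] <= S}.
  by move=> t tp; rewrite mem_undup inE tp orbT.
have sS : s \in S by rewrite mem_undup mem_head.
have ker t : t != s -> sphere_class (wproj t p) = 0.
  move: H1a; rewrite /H1 /descend -/p -[in RHS](sphere_liftK a) -/p.
  rewrite -sphere_classZ => /sphere_classP[r rE].
  move: H2a; rewrite /H2 /descend -/p -[in RHS](sphere_liftK a) -/p.
  rewrite -sphere_classZ => /sphere_classP[r' r'E].
  rewrite -pair_eqE negb_and => /orP[] ts.
    apply: (wproj_ker (u := fst) _ rE) => // m.
    rewrite mcoeffZ !(mcoeffD, mcoeffN, mcoeff_ZpM, mcoeff_ZpsM).
    rewrite (@mon_weightE m fst) //= !(rmorphD, rmorphN, rmorphM, rmorph_nat) /=.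
    by rewrite half_C; field.
  apply: (wproj_ker (u := snd) _ r'E) => // m.
  rewrite mcoeffZ !(mcoeffD, mcoeffN, mcoeff_ZpM, mcoeff_ZpsM).
  rewrite (@mon_weightE m snd) //= !(rmorphD, rmorphN, rmorphM, rmorph_nat) /=.
  by rewrite half_C; field.
have aE : a = sphere_class (wproj s p).
  have pE : p = \sum_(t <- S) wproj t p.
    apply/mpolyP => m; rewrite raddf_sum /=.
    under eq_bigr do rewrite mcoeff_wproj.
    have [mp|mp] := boolP (m \in msupp p); last first.
      by rewrite (memN_msupp_eq0 mp) big1 // => t _; rewrite if_same.
    rewrite (bigD1_seq (mon_weight m)) ?undup_uniq //=; last exact/pS/map_f.
    by rewrite eqxx big1 ?addr0 // => t; rewrite eq_sym => /negPf->.
  rewrite -[LHS]sphere_liftK -/p [in LHS]pE raddf_sum /=.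
  rewrite (bigD1_seq s) ?undup_uniq //= big1 ?addr0 //.
have -> : over_weights F a = over_weights_poly F p by [].
rewrite (over_weights_polyE _ pS) ?undup_uniq //.
rewrite (bigD1_seq s) ?undup_uniq //= -aE big1 ?addr0 // => t ts.
by rewrite ker // raddf0.
Qed.
End OverWeights.

Definition additive_family (F : R * R -> OS7 R -> OS7 R) : Prop :=
  forall s, zmod_morphism (F s).

Lemma over_weights_vector F s a :
  additive_family F -> weight_vector s a -> over_weights F a = F s a.
Proof.
move=> FA; pose G t : {additive OS7 R -> OS7 R} :=
  HB.pack (F t) (GRing.isZmodMorphism.Build (OS7 R) (OS7 R) (F t) (FA t)).
exact: (@over_weightsE G).
Qed.

Lemma over_weights_is_additive F :
  additive_family F -> zmod_morphism (over_weights F).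
Proof.
move=> FA; pose G t : {additive OS7 R -> OS7 R} :=
  HB.pack (F t) (GRing.isZmodMorphism.Build (OS7 R) (OS7 R) (F t) (FA t)).
exact: (@over_weightsB G).
Qed.

(* [H_j, psi] = r_j psi. *)
Definition weight_map r psi : Prop :=
  forall a, H1 (psi a) - psi (H1 a) = (r.1)%:C *: psi a
         /\ H2 (psi a) - psi (H2 a) = (r.2)%:C *: psi a.

Lemma weight_map_vector r s (psi : {linear OS7 R -> OS7 R}) a :
  weight_map r psi -> weight_vector s a -> weight_vector (r + s) (psi a).
Proof.
move=> /(_ a)[p1 p2] [a1 a2]; split.
  by move/eqP: p1; rewrite subr_eq a1 linearZ -scalerDl -rmorphD => /eqP.
by move/eqP: p2; rewrite subr_eq a2 linearZ -scalerDl -rmorphD => /eqP.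
Qed.

Lemma over_map_weights_vector (F : R * R -> R * R -> OS7 R -> OS7 R)
    (psi : {linear OS7 R -> OS7 R}) r s a :
    (forall t, additive_family (F t)) -> weight_map r psi -> weight_vector s a ->
  over_map_weights F psi a = F r s (psi a).
Proof.
move=> FA psir sa; rewrite /over_map_weights (over_weights_vector _ sa).
  rewrite (over_weights_vector _ (weight_map_vector psir sa)) ?addrK // => t.
  exact: FA.
move=> t b c; rewrite linearB /=; apply: over_weights_is_additive => u; exact: FA.
Qed.

Variable theta : R.

(* phase u = e^{i pi theta u} *)
Definition phase (u : R) : R[i] := cos (pi * theta * u) +i* sin (pi * theta * u).

Definition bmul a b : OS7 R :=
  over_weights (fun s a_s =>
    over_weights (fun m b_m => phase (- wedge s m) *: (a_s * b_m)) b) a.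

Lemma bmul_vector s m a b : weight_vector s a -> weight_vector m b ->
  bmul a b = phase (- wedge s m) *: (a * b).
Proof.
move=> sa mb; rewrite /bmul (over_weights_vector _ sa).
  apply: (over_weights_vector _ mb) => t c d.
  by rewrite mulrBr scalerBr.
move=> t c d; rewrite /over_weights -sumrB; apply: eq_bigr => k _.
by rewrite mulrBl scalerBr.
Qed.

(* (R_alpha |> a) (x) (R^alpha |> psi) = \sum_s a_s (x) R_act s psi           *)
Definition R_act s psi : OS7 R -> OS7 R :=
  over_map_weights (fun r _ b => phase (- 2 * wedge r s) *: b) psi.

Lemma R_act_vector r s m (psi : {linear OS7 R -> OS7 R}) a :
    weight_map r psi -> weight_vector m a ->
  R_act s psi a = phase (- 2 * wedge r s) *: psi a.
Proof.
move=> psir ma; apply: (over_map_weights_vector _ psir ma) => t u b c.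
exact: scalerBr.
Qed.

Definition braided_derivation psi : Prop :=
  linear psi /\
  forall a a', psi (bmul a a') =
    bmul (psi a) a' + over_weights (fun s a_s => bmul a_s (R_act s psi a')) a.

Definition aut psi : Prop :=
  [/\ braided_derivation psi,
      forall a, coaction (psi a) = tensor_id psi (coaction a)
    & forall f, OS4 f -> psi f = 0].

Definition module_act f psi : OS7 R -> OS7 R := fun a => bmul f (psi a).

(* The subtracted term is the sum over r, s of e^{- 2 pi i theta r /\ s}      *)
(* lambda_s psi_r.                                                            *)
Definition bracket psi lambda : OS7 R -> OS7 R := fun a =>
  psi (lambda a) -
  over_map_weights (fun r _ b =>
    over_map_weights (fun s _ c => phase (- 2 * wedge r s) *: c) lambda b) psi a.

Lemma bracket_vector r s m (psi lambda : {linear OS7 R -> OS7 R}) a :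
    weight_map r psi -> weight_map s lambda -> weight_vector m a ->
  bracket psi lambda a =
    psi (lambda a) - phase (- 2 * wedge r s) *: lambda (psi a).
Proof.
move=> psir lams ma; congr (_ - _).
rewrite (over_map_weights_vector _ psir ma) => [|t u b c].
  apply: (over_map_weights_vector _ lams (weight_map_vector psir ma)) => t u b c.
  exact: scalerBr.
rewrite {1}/over_map_weights; apply: over_weights_is_additive => v d e.
rewrite linearB /=; apply: over_weights_is_additive => w f g; exact: scalerBr.
Qed.

Definition Dtwist (X : OS7 R -> OS7 R) : OS7 R -> OS7 R :=
  over_map_weights (fun r s b => phase (- wedge r s) *: b) X.

Lemma Dtwist_vector r s (X : {linear OS7 R -> OS7 R}) a :
    weight_map r X -> weight_vector s a ->
  Dtwist X a = phase (- wedge r s) *: X a.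
Proof.
move=> Xr sa; apply: (over_map_weights_vector _ Xr sa) => t u b c.
exact: scalerBr.
Qed.

(* If a_s has weight s then its conjugate has weight - s.                     *)
Definition map_star psi : OS7 R -> OS7 R :=
  over_weights (fun s a_s =>
    - over_map_weights (fun r _ b => phase (2 * wedge r s) *: star b) psi (star a_s)).

Definition alphahat : OS7 R := 2 *: (bmul (z i1) (zs i3) + bmul (zs i2) (z i4)).
Definition betahat : OS7 R := 2 *: (bmul (z i2) (zs i3) - bmul (zs i1) (z i4)).

End Bundle.

Notation "f *[ theta ] psi" := (module_act theta f psi)
  (at level 40, theta at level 200, left associativity,
   format "f  *[ theta ]  psi") : ring_scope.

(* Main.v *)
(* The pairs p_1 = [z_1, z_2^*], p_2 = [- z_2, z_1^*], p_3 = [z_3, z_4^*],    *)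
(* p_4 = [- z_4, z_3^*] are doublets for the coaction. Hence the determinants *)
(* det (p_k, p_l) are coinvariant, the sphere relation reads det (p_1, p_2) + *)
(* det (p_3, p_4) = 1, and every pair u is the combination of the p_k with    *)
(* coefficients +- det (u, p_l). The symmetric products of p_i and p_j, taken *)
(* as coefficients of the three infinitesimal generators of SU(2), give       *)
(* vertical equivariant derivations                                           *)
(*   V_ij : p_k |-> det (p_k, p_i) p_j + det (p_k, p_j) p_i,                  *)
(* of which K_1, K_2 and the W_r are constant combinations, and               *)
(*   [V_ij, V_lm] = det (p_m, p_i) V_lj + det (p_m, p_j) V_li                 *)
(*                  + det (p_l, p_i) V_mj + det (p_l, p_j) V_mi.              *)
(* An equivariant derivation Y that kills the coinvariants is a combination   *)
(* of the V_ij whose coefficients are, up to order and constants, the         *)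
(* coinvariants det (Y p_k, p_l). For the twist, let rot_v be the             *)
(* automorphism a |-> e^{i pi theta s /\ v} a on weight s: the twisted        *)
(* product of a, of weight s, with b is a rot_s(b), and the twisted D(X) maps *)
(* a to rot_{-s}(X a). So D is a bijection from derivations to braided        *)
(* derivations, and it turns commutators of weight vectors into braided       *)
(* brackets up to a phase.                                                    *)
From HB Require Import structures.
Require Import Defs.
From mathcomp Require Import all_boot all_order all_algebra.
From mathcomp Require Import ring_quotient mpoly.
From mathcomp Require Import complex boolp functions reals trigo ring.

Set Implicit Arguments.
Unset Strict Implicit.
Unset Printing Implicit Defensive.

Import Order.TTheory GRing.Theory Num.Theory.
Local Open Scope ring_scope.
Local Open Scope complex_scope.

(** * Spheres and derivations *)

(** Generation. Let Y be an equivariant derivation killing the coinvariants. It kills every det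
    (p_k, p_l), hence the coefficients of the expansion of p_k in the frame p_1, ..., p_4. Applying
    Y to that expansion shows that Y acts on all the p_k by one and the same 2 by 2 matrix, and Y 1
    = 0 forces trace zero. So Y is a combination of the three infinitesimal generators of SU(2).
    Multiplying by the square of det (p_1, p_2) + det (p_3, p_4) = 1 regroups it as a combination of
    the V_ij whose coefficients are the numbers det (Y p_k, p_l). These are coinvariant because an
    equivariant map sends doublets to doublets. A braided psi is reduced to such a Y by [untwist],
    the inverse of the twist [tD]; both preserve equivariance because the coaction preserves weights
    ([equiv_rot]). This gives [taut_gens] and, with [tD_gcomb], its converse [taut_tcomb].

    Brackets of generators. All determinants are killed by the V_ij, so the commutator of two of
    them is found by evaluation on the pairs ([vfield_bracket]). For X, X' of weights r, s the
    braided bracket of D(X) and D(X') is e^{- i pi theta r /\ s} D([X, X']) ([tbr_tD]), and for f of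
    weight m and X of weight l one has D(f X) = e^{i pi theta m /\ l} f . D(X), with the twisted
    module action. Hence a term f K_l of the classical commutator acquires the factor q to the power
    m /\ l - r /\ s ([tbr_gens]), which is the source of every power of q in the table. That the
    given K_j and W_r are constant combinations of the V_ij is [gderE].

    Brackets of generic elements. Both sides are additive in the two coefficients and the two
    derivations. Generation makes every element of aut a finite sum of homogeneous elements of aut
    ([taut_hom_sum]), and the weight components of a coinvariant are coinvariant ([coinv_ind]). This
    leaves the homogeneous case [tmod_br_hom], where each derivation passes the other coefficient,
    which it kills, at the cost of a phase.

    The argument runs over an abstract weighted algebra with four doublets ([gauge_algebra]) and is
    then instantiated at O(S^7) ([gauge_algebra_S4]). *)

Lemma ord4P (Q : 'I_4 -> Prop) : Q i1 -> Q i2 -> Q i3 -> Q i4 -> forall k, Q k.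
Proof.
by move=> Q1 Q2 Q3 Q4 [[|[|[|[|//]]]] lt_k]; [move: Q1|move: Q2|move: Q3|move: Q4];
  congr Q; apply: val_inj.
Qed.

Lemma big_ord4 (V : nmodType) (F : 'I_4 -> V) : \sum_i F i = F i1 + F i2 + F i3 + F i4.
Proof.
rewrite !big_ord_recl big_ord0 addr0 !addrA.
by congr (F _ + F _ + F _ + F _); apply: val_inj.
Qed.

Section ZmodMorphism.
Variables (U V : zmodType) (D : U -> V).
Hypothesis DB : zmod_morphism D.

Lemma zmod_morphism0 : D 0 = 0.
Proof. by rewrite -[X in D X](subrr 0) DB subrr. Qed.

Lemma zmod_morphismN : {morph D : a / - a}.
Proof. by move=> a; rewrite -sub0r DB zmod_morphism0 sub0r. Qed.

Lemma zmod_morphismD : {morph D : a b / a + b}.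
Proof. by move=> a b; rewrite -{1}[b]opprK DB zmod_morphismN opprK. Qed.

End ZmodMorphism.

Section SphereInduction.
Variables (n : nat) (S : comNzRingType).
Local Notation poly := {mpoly S[n.+1 + n.+1]}.
Implicit Types (p : poly) (a b : sphere n S).

Definition sphere_gen (i : 'I_(n.+1 + n.+1)) : sphere n S := sphere_class 'X_i.

Lemma sphere_classC c : sphere_class c%:MP = c%:A :> sphere n S.
Proof. by rewrite -[in LHS](mulr1 c%:MP) mul_mpolyC sphere_classZ rmorph1. Qed.

Lemma sphere_ind (Q : sphere n S -> Prop) :
    (forall c, Q c%:A) -> (forall i, Q (sphere_gen i)) ->
    (forall a b, Q a -> Q b -> Q (a + b)) ->
    (forall a b, Q a -> Q b -> Q (a * b)) ->
  forall a, Q a.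
Proof.
move=> QC QX QD QM a; rewrite -(sphere_liftK a); move: (sphere_lift a).
apply: mpolyind => [|c m p _ _ Qp].
  by have := QC 0; rewrite scale0r rmorph0.
rewrite rmorphD /=; apply: (QD) => //.
rewrite -mul_mpolyC rmorphM /= sphere_classC; apply: (QM) => //.
rewrite mpolyXE_id rmorph_prod /=; apply: (big_ind Q) => [||i _].
- by have := QC 1; rewrite scale1r.
- exact: QM.
rewrite rmorphXn /=; elim: (m i) => [|k IHk]; last first.
  by rewrite exprS; apply: (QM) => //; apply: QX.
by have := QC 1; rewrite scale1r expr0.
Qed.

Lemma sphere_rel_gen :
  \sum_(i < n.+1) sphere_gen (rshift _ i) * sphere_gen (lshift _ i) = 1.
Proof.
have rel0 : sphere_class (sphere_rel n S) = 0.
  rewrite -(rmorph0 (@sphere_class n S)); apply/sphere_classP.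
  by exists 1; rewrite subr0 mul1r.
apply/eqP; rewrite -subr_eq0; apply/eqP; rewrite -[RHS]rel0.
rewrite /sphere_rel rmorphB rmorph1 raddf_sum /=.
by congr (_ - _); apply: eq_bigr => i _; rewrite rmorphM.
Qed.

End SphereInduction.

Section SphereEval.
Variables (n : nat) (S T : comNzRingType) (f : {rmorphism S -> T}).
Variable h : 'I_(n.+1 + n.+1) -> T.
Hypothesis h1 : \sum_(i < n.+1) h (rshift _ i) * h (lshift _ i) = 1.

Definition sphere_eval (a : sphere n S) : T := mmap f h (sphere_lift a).

Lemma sphere_eval_class p : sphere_eval (sphere_class p) = mmap f h p.
Proof.
have [r E] := (sphere_classP _ p).1 (sphere_liftK (sphere_class p)).
apply/eqP; rewrite -subr_eq0 /sphere_eval -mmapB E rmorphM /=.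
rewrite [X in _ * X](_ : _ = 0) ?mulr0 // /sphere_rel rmorphB rmorph1 raddf_sum /=.
apply/eqP; rewrite subr_eq0; apply/eqP.
by rewrite -[RHS]h1; apply: eq_bigr => i _; rewrite rmorphM /= !mmapX !mmap1U.
Qed.

Fact sphere_eval_zmod : zmod_morphism sphere_eval.
Proof.
move=> a b; rewrite -{1}(sphere_liftK a) -{1}(sphere_liftK b) -rmorphB.
by rewrite sphere_eval_class mmapB.
Qed.

Fact sphere_eval_monoid : monoid_morphism sphere_eval.
Proof.
split=> [|a b].
  by rewrite -(rmorph1 (@sphere_class n S)) sphere_eval_class rmorph1.
rewrite -{1}(sphere_liftK a) -{1}(sphere_liftK b) -rmorphM.
by rewrite sphere_eval_class rmorphM.
Qed.

Lemma sphere_evalC c : sphere_eval c%:A = f c.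
Proof. by rewrite -sphere_classC sphere_eval_class mmapC. Qed.

Lemma sphere_eval_gen i : sphere_eval (sphere_gen S i) = h i.
Proof. by rewrite sphere_eval_class mmapX mmap1U. Qed.

End SphereEval.

Section Derivations.
Variable (C : comNzRingType).

(** Leibniz over a morphism [phi] covers both vector fields ([phi] the identity) and tangent vectors
    at a point ([phi] an evaluation), as well as the two sides of an equivariance condition ([phi]
    the coaction). *)
Definition derivation_along (A : comAlgType C) (B : comNzRingType) (phi D : A -> B) :=
  [/\ zmod_morphism D, forall c, D c%:A = 0
    & forall a b, D (a * b) = D a * phi b + phi a * D b].

Definition derivation (A : comAlgType C) (D : A -> A) := derivation_along id D.

Section Closure.
Variables (A : comAlgType C).
Implicit Types (D E : A -> A).

Lemma derivationD D E : derivation D -> derivation E -> derivation (fun a => D a + E a).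
Proof.
case=> DB DC DM [EB EC EM]; split=> [a b|c|a b].
- by rewrite DB EB opprD addrACA.
- by rewrite DC EC addr0.
- by rewrite DM EM; ring.
Qed.

Lemma derivationN D : derivation D -> derivation (fun a => - D a).
Proof.
case=> DB DC DM; split=> [a b|c|a b].
- by rewrite DB opprD.
- by rewrite DC oppr0.
- by rewrite DM; ring.
Qed.

Lemma derivationM f D : derivation D -> derivation (fun a => f * D a).
Proof.
case=> DB DC DM; split=> [a b|c|a b].
- by rewrite DB mulrBr.
- by rewrite DC mulr0.
- by rewrite DM; ring.
Qed.

Lemma derivationZ c D : derivation D -> derivation (fun a => c *: D a).
Proof.
case=> DB DC DM; split=> [a b|k|a b].
- by rewrite DB scalerBr.
- by rewrite DC scaler0.
- by rewrite DM scalerDr scalerAl scalerAr.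
Qed.

Lemma derivation0 : derivation (fun _ : A => 0).
Proof. by split=> [a b|//|a b]; rewrite ?subrr ?mul0r ?mulr0 ?addr0. Qed.

Lemma derivation_linear D : derivation D -> linear D.
Proof.
case=> DB DC DM c a b; rewrite -[c *: a]mulr_algl -[c *: D a]mulr_algl.
by rewrite (zmod_morphismD DB) DM DC mul0r add0r.
Qed.

Lemma derivation_scale D : derivation D -> forall k a, D (k *: a) = k *: D a.
Proof. by case=> _ DC DM k a; rewrite -mulr_algl DM DC mul0r add0r mulr_algl. Qed.

Lemma derivation_comm D E : derivation D -> derivation E -> derivation (fun a => D (E a) - E (D a)).
Proof.
case=> DB DC DM [EB EC EM].
split=> [a b|c|a b].
- by rewrite EB DB DB EB; ring.
- by rewrite EC DC (zmod_morphism0 DB) (zmod_morphism0 EB) subrr.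
- rewrite EM DM (zmod_morphismD DB) (zmod_morphismD EB) !DM !EM; ring.
Qed.

End Closure.
End Derivations.

Section SphereTangent.
Variables (n : nat) (S T : comNzRingType) (f : {rmorphism S -> T}).
Variables h c : 'I_(n.+1 + n.+1) -> T.
Hypothesis h1 : \sum_(i < n.+1) h (rshift _ i) * h (lshift _ i) = 1.
Hypothesis hc : \sum_(i < n.+1)
  (c (rshift _ i) * h (lshift _ i) + h (rshift _ i) * c (lshift _ i)) = 0.
Local Notation poly := {mpoly S[n.+1 + n.+1]}.
Implicit Types p q : poly.

(** The tangent vector with components [c] at the point [h]. The hypothesis [hc] is the sphere
    relation differentiated at [h], which makes the value independent of the chosen
    representative. *)
Definition sphere_tangent (a : sphere n S) : T :=
  \sum_i c i * mmap f h (sphere_lift a)^`M(i).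

Let Dp p := \sum_i c i * mmap f h p^`M(i).

Let DpB : zmod_morphism Dp.
Proof.
by move=> p q; rewrite -sumrB; apply: eq_bigr => i _; rewrite mderivB mmapB mulrBr.
Qed.

Let DpM p q : Dp (p * q) = Dp p * mmap f h q + mmap f h p * Dp q.
Proof.
rewrite mulr_suml mulr_sumr -big_split; apply: eq_bigr => i _ /=.
by rewrite mderivM mmapD !rmorphM /=; ring.
Qed.

Let DpX i : Dp 'X_i = c i.
Proof.
rewrite /Dp (bigD1 i) //= big1 ?addr0 => [|j ji]; rewrite mderivX mnm1E.
  have -> : (U_(i) - U_(i) = 0)%MM by apply/mnmP => j; rewrite mnmBE subnn mnm0E.
  by rewrite eqxx scale1r mpolyX0 rmorph1 mulr1.
by rewrite eq_sym (negPf ji) scale0r raddf0 mulr0.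
Qed.

Let DpC k : Dp k%:MP = 0.
Proof. by rewrite /Dp big1 // => i _; rewrite mderivC raddf0 mulr0. Qed.

Lemma sphere_tangent_class p : sphere_tangent (sphere_class p) = Dp p.
Proof.
have [r E] := (sphere_classP _ p).1 (sphere_liftK (sphere_class p)).
apply/eqP; rewrite -subr_eq0 -[sphere_tangent _]/(Dp _) -DpB E DpM.
have -> : mmap f h (sphere_rel n S) = 0.
  rewrite /sphere_rel rmorphB rmorph1 raddf_sum /=.
  apply/eqP; rewrite subr_eq0; apply/eqP; rewrite -[RHS]h1.
  by apply: eq_bigr => i _; rewrite rmorphM /= !mmapX !mmap1U.
have -> : Dp (sphere_rel n S) = 0; last by rewrite !mulr0 addr0.
rewrite /sphere_rel DpB -[1]/(1%:MP) DpC subr0.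
have -> (F : 'I_n.+1 -> poly) : Dp (\sum_i F i) = \sum_i Dp (F i).
  by apply: (big_morph Dp) => [|]; [exact: zmod_morphismD|exact: zmod_morphism0].
rewrite -[RHS]hc; apply: eq_bigr => i _.
by rewrite DpM !DpX !mmapX !mmap1U.
Qed.

Lemma sphere_tangent_derivation :
  derivation_along (sphere_eval f h) sphere_tangent.
Proof.
split=> [a b|k|a b].
- by rewrite -{1}(sphere_liftK a) -{1}(sphere_liftK b) -rmorphB sphere_tangent_class DpB.
- by rewrite -sphere_classC sphere_tangent_class DpC.
- by rewrite -{1}(sphere_liftK a) -{1}(sphere_liftK b) -rmorphM sphere_tangent_class DpM.
Qed.

Lemma sphere_tangent_gen i : sphere_tangent (sphere_gen S i) = c i.
Proof. by rewrite sphere_tangent_class DpX. Qed.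

End SphereTangent.

Section SphereEvalId.
Variables (n : nat) (S : comNzRingType).

Lemma sphere_eval_id : sphere_eval (GRing.in_alg (sphere n S)) (@sphere_gen n S) =1 id.
Proof.
have h1 := sphere_rel_gen n S.
have E0 := sphere_eval_zmod (GRing.in_alg (sphere n S)) h1.
have [_ EM] := sphere_eval_monoid (GRing.in_alg (sphere n S)) h1.
elim/sphere_ind => [k|i|a b Ea Eb|a b Ea Eb].
- exact: sphere_evalC.
- exact: sphere_eval_gen.
- by rewrite (zmod_morphismD E0) Ea Eb.
- by rewrite EM Ea Eb.
Qed.

Lemma mmap_sphere_gen p : mmap (GRing.in_alg (sphere n S)) (@sphere_gen n S) p = sphere_class p.
Proof. by rewrite -(sphere_eval_class _ (sphere_rel_gen n S)) sphere_eval_id. Qed.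

End SphereEvalId.

Section SphereMap.
Variables (n : nat) (S : comNzRingType).
Local Notation poly := {mpoly S[n.+1 + n.+1]}.

Definition sphere_map (psi : S -> S) (t : sphere n S) : sphere n S :=
  sphere_class (map_mpoly psi (sphere_lift t)).

Definition sphere_mon (t : sphere n S) : Prop := exists m, t = sphere_class 'X_[m].

Lemma sphere_mon1 : sphere_mon 1.
Proof. by exists 0%MM; rewrite mpolyX0 rmorph1. Qed.

Lemma sphere_monM t u : sphere_mon t -> sphere_mon u -> sphere_mon (t * u).
Proof. by case=> m -> [k ->]; exists (m + k)%MM; rewrite mpolyXD rmorphM. Qed.

Lemma sphere_mon_ind (Q : sphere n S -> Prop) :
    (forall a t, sphere_mon t -> Q (a *: t)) ->
  (forall t u, Q t -> Q u -> Q (t + u)) -> forall t, Q t.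
Proof.
move=> QZ QD t; rewrite -(sphere_liftK t); move: (sphere_lift t).
apply: mpolyind => [|a m p _ _ Qp].
  by rewrite rmorph0 -(scale0r 1); apply: QZ; apply: sphere_mon1.
by rewrite rmorphD /= sphere_classZ; apply: QD => //; apply: QZ; exists m.
Qed.

Section Additive.
Variable psi : {additive S -> S}.

Let map_monomial k m : map_mpoly psi (k *: 'X_[m] : poly) = psi k *: 'X_[m].
Proof.
apply/mpolyP => l; rewrite mcoeff_map_mpoly !mcoeffZ mcoeffX.
by case: eqP => _; rewrite ?mulr1 // !mulr0 raddf0.
Qed.

Let map_mulX p m : map_mpoly psi (p * 'X_[m] : poly) = map_mpoly psi p * 'X_[m].
Proof.
move: p; apply: mpolyind => [|k l p _ _ IH]; first by rewrite mul0r raddf0 mul0r.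
by rewrite mulrDl !raddfD /= mulrDl IH -scalerAl -mpolyXD !map_monomial -scalerAl mpolyXD.
Qed.

(** Although [psi] is only additive, acting on coefficients commutes with multiplication by
    monomials. The sphere relation is a signed sum of monomials, so its multiples go to
    multiples. *)
Lemma sphere_map_class p : sphere_map psi (sphere_class p) = sphere_class (map_mpoly psi p).
Proof.
have [r E] := (sphere_classP _ p).1 (sphere_liftK (sphere_class p)).
apply/sphere_classP; exists (map_mpoly psi r); rewrite -raddfB E /sphere_rel.
rewrite !mulrBr !mulr1 raddfB !mulr_sumr raddf_sum /=; congr (_ - _).
by apply: eq_bigr => i _; rewrite -mpolyXD map_mulX.
Qed.

Lemma sphere_map_zmod : zmod_morphism (sphere_map psi).
Proof.
move=> t u; rewrite -{1}(sphere_liftK t) -{1}(sphere_liftK u) -rmorphB.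
by rewrite sphere_map_class raddfB rmorphB.
Qed.

Lemma sphere_mapE a t : sphere_mon t -> sphere_map psi (a *: t) = psi a *: t.
Proof. by case=> m ->; rewrite -sphere_classZ sphere_map_class map_monomial sphere_classZ. Qed.

End Additive.
End SphereMap.

(** The coaction is multiplication by a matrix of SU(2), so it preserves the norm: the left side
    factors as the product of the two norms. *)
Lemma SU2_norm (A : comNzRingType) (B : comAlgType A) (x1 x2 x3 x4 y1 y2 y3 y4 : A)
    (u1 u2 v1 v2 : B) :
    v1 * u1 + v2 * u2 = 1 -> y1 * x1 + y2 * x2 + y3 * x3 + y4 * x4 = 1 ->
  (y1 *: v1 - x2 *: v2) * (x1 *: u1 - y2 *: u2)
  + (y2 *: v1 + x1 *: v2) * (x2 *: u1 + y1 *: u2)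
  + (y3 *: v1 - x4 *: v2) * (x3 *: u1 - y4 *: u2)
  + (y4 *: v1 + x3 *: v2) * (x4 *: u1 + y3 *: u2) = 1.
Proof.
move=> uv1 /(congr1 (GRing.in_alg B)); rewrite rmorph1 !rmorphD !rmorphM => xy1.
have algE k (t : B) : k *: t = GRing.in_alg B k * t by rewrite mulr_algl.
rewrite !algE; apply: etrans (_ : _ = (v1 * u1 + v2 * u2) *
  (GRing.in_alg B y1 * GRing.in_alg B x1 + GRing.in_alg B y2 * GRing.in_alg B x2
   + GRing.in_alg B y3 * GRing.in_alg B x3 + GRing.in_alg B y4 * GRing.in_alg B x4)) _; last by rewrite uv1 xy1 mulr1.
ring.
Qed.

(** * The coaction *)

Section SphereStar.
Variables (n : nat) (S : comNzRingType) (conj : {rmorphism S -> S}).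

Lemma sphere_swap_lshift i : sphere_swap (lshift n.+1 i) = rshift n.+1 i.
Proof. by rewrite /sphere_swap (unsplitK (inl i)). Qed.

Lemma sphere_swap_rshift i : sphere_swap (rshift n.+1 i) = lshift n.+1 i.
Proof. by rewrite /sphere_swap (unsplitK (inr i)). Qed.

Let h (i : 'I_(n.+1 + n.+1)) := sphere_gen S (sphere_swap i).

Let h1 : \sum_(i < n.+1) h (rshift _ i) * h (lshift _ i) = 1.
Proof.
rewrite -[RHS](sphere_rel_gen n S); apply: eq_bigr => i _.
by rewrite /h sphere_swap_lshift sphere_swap_rshift mulrC.
Qed.

Let starE (a : sphere n S) :
  sphere_star conj a = sphere_eval (GRing.in_alg (sphere n S) \o conj) h a.
Proof.
rewrite /sphere_star /sphere_eval /mmap rmorph_sum /=; apply: eq_bigr => m _.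
rewrite rmorphM /= sphere_classC /mmap1 rmorph_prod /=; congr (_ * _).
by apply: eq_bigr => i _; rewrite rmorphXn.
Qed.

Lemma sphere_star_zmod : zmod_morphism (@sphere_star n S conj).
Proof. by move=> a b; rewrite !starE sphere_eval_zmod. Qed.

Lemma sphere_star_monoid : monoid_morphism (@sphere_star n S conj).
Proof.
have [E1 EM] := sphere_eval_monoid (GRing.in_alg (sphere n S) \o conj) h1.
by split=> [|a b]; rewrite !starE ?E1 // EM.
Qed.

Lemma sphere_starZ c (a : sphere n S) :
  sphere_star conj (c *: a) = conj c *: sphere_star conj a.
Proof.
have [_ sM] := sphere_star_monoid.
rewrite -[c *: a]mulr_algl sM [sphere_star conj c%:A]starE sphere_evalC //.
by rewrite /= mulr_algl.
Qed.

Lemma sphere_star_gen (i : 'I_(n.+1 + n.+1)) :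
  sphere_star conj (sphere_gen S i) = sphere_gen S (sphere_swap i).
Proof. by rewrite starE sphere_eval_gen. Qed.

End SphereStar.

Section Bundle.
Variable R : realType.
Local Notation C := R[i].
Local Notation A := (OS7 R).
Local Notation B := (OS7_SU2 R).
Implicit Types (a b f : A) (psi : A -> A).

Lemma star_zmod : zmod_morphism (@star R).
Proof. exact: (@sphere_star_zmod 3 C (@conjc R)). Qed.

Lemma star_monoid : monoid_morphism (@star R).
Proof. exact: (@sphere_star_monoid 3 C (@conjc R)). Qed.

Lemma starZ (c : C) a : star (c *: a) = conjc c *: star a.
Proof. exact: (sphere_starZ (@conjc R)). Qed.

Lemma star_z i : star (z R i) = zs R i.
Proof. by have := sphere_star_gen (@conjc R) (lshift 4 i); rewrite sphere_swap_lshift. Qed.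

Lemma star_zs i : star (zs R i) = z R i.
Proof. by have := sphere_star_gen (@conjc R) (rshift 4 i); rewrite sphere_swap_rshift. Qed.

Lemma sphere7_ind (Q : A -> Prop) :
    (forall c : C, Q c%:A) -> (forall i, Q (z R i)) -> (forall i, Q (zs R i)) ->
    (forall a b, Q a -> Q b -> Q (a + b)) ->
    (forall a b, Q a -> Q b -> Q (a * b)) ->
  forall a, Q a.
Proof.
move=> QC Qz Qzs; apply: sphere_ind => // i.
by rewrite -(splitK i); case: (fintype.split i) => j; [apply: Qz|apply: Qzs].
Qed.

Let starD a b : star (a + b) = star a + star b.
Proof. exact: (zmod_morphismD star_zmod). Qed.

Let starM a b : star (a * b) = star a * star b.
Proof. by have [_ ->] := star_monoid. Qed.

Lemma starK : involutive (@star R).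
Proof.
elim/sphere7_ind => [c|i|i|a b Ea Eb|a b Ea Eb].
- have [star1 _] := star_monoid.
  by rewrite starZ star1 starZ star1 conjcK.
- by rewrite star_z star_zs.
- by rewrite star_zs star_z.
- rewrite (starD a b) starD; congr (_ + _); [exact: Ea|exact: Eb].
- rewrite (starM a b) starM; congr (_ * _); [exact: Ea|exact: Eb].
Qed.

Lemma sphere7_rel :
  zs R i1 * z R i1 + zs R i2 * z R i2 + zs R i3 * z R i3 + zs R i4 * z R i4 = 1.
Proof. by have := sphere_rel_gen 3 C; rewrite big_ord4. Qed.

Definition w1s : B := sphere_class 'X_(rshift 2 (@Ordinal 2 0 isT)).
Definition w2s : B := sphere_class 'X_(rshift 2 (@Ordinal 2 1 isT)).

Lemma SU2_rel : w1s * w1 R + w2s * w2 R = 1.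
Proof.
have e0 : ord0 = @Ordinal 2 0 isT by exact: val_inj.
have e1 : lift ord0 ord0 = @Ordinal 2 1 isT by exact: val_inj.
by rewrite -[RHS](sphere_rel_gen 1 A) !big_ord_recl big_ord0 addr0 e1 e0.
Qed.

(* star as a ring morphism, so that it can conjugate the scalars of B. *)
Definition star_rmorphism : {rmorphism A -> A} :=
  HB.pack_for {rmorphism A -> A} (@star R)
    (GRing.isZmodMorphism.Build A A (@star R) star_zmod)
    (GRing.isMonoidMorphism.Build A A (@star R) star_monoid).

Let starB_zmod : zmod_morphism (@sphere_star 1 A (@star R)).
Proof. exact: (sphere_star_zmod star_rmorphism). Qed.

Let starB_Z a (t : B) : sphere_star (@star R) (a *: t) = star a *: sphere_star (@star R) t.
Proof. exact: (sphere_starZ star_rmorphism). Qed.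

Let star_w1 : sphere_star (@star R) (w1 R) = w1s.
Proof. by have := sphere_star_gen star_rmorphism (lshift 2 (@Ordinal 2 0 isT)); rewrite sphere_swap_lshift. Qed.

Let star_w2 : sphere_star (@star R) (w2 R) = w2s.
Proof. by have := sphere_star_gen star_rmorphism (lshift 2 (@Ordinal 2 1 isT)); rewrite sphere_swap_lshift. Qed.

Let coaction_gen_l i : coaction_gen R (lshift _ i) = coaction_z R i.
Proof. by rewrite /coaction_gen (unsplitK (inl i)). Qed.

Let coaction_gen_r i : coaction_gen R (rshift _ i) = sphere_star (@star R) (coaction_z R i).
Proof. by rewrite /coaction_gen (unsplitK (inr i)). Qed.

Let starBB a b (t u : B) :
  sphere_star (@star R) (a *: t - b *: u) = star a *: sphere_star (@star R) t - star b *: sphere_star (@star R) u.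
Proof. by rewrite starB_zmod !starB_Z. Qed.
Let starBD a b (t u : B) :
  sphere_star (@star R) (a *: t + b *: u) = star a *: sphere_star (@star R) t + star b *: sphere_star (@star R) u.
Proof. by rewrite (zmod_morphismD starB_zmod) !starB_Z. Qed.

Definition coaction_zs (i : 'I_4) : B :=
  match val i with
  | 0 => zs R i1 *: w1s - z R i2 *: w2s
  | 1 => zs R i2 *: w1s + z R i1 *: w2s
  | 2 => zs R i3 *: w1s - z R i4 *: w2s
  | _ => zs R i4 *: w1s + z R i3 *: w2s
  end.

Let coaction_star i : sphere_star (@star R) (coaction_z R i) = coaction_zs i.
Proof.
by case: i => -[|[|[|m]]] lt_m; rewrite /coaction_z /coaction_zs /= ?starBB ?starBD star_z star_zs star_w1 star_w2.
Qed.

Lemma coaction_gen_rel :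
  \sum_(i < 4) coaction_gen R (rshift _ i) * coaction_gen R (lshift _ i) = 1.
Proof.
rewrite big_ord4 !coaction_gen_l !coaction_gen_r !coaction_star.
exact: (SU2_norm (x1 := z R i1) (x2 := z R i2) (x3 := z R i3) (x4 := z R i4) SU2_rel sphere7_rel).
Qed.

Let coaction_eval : @coaction R =1 sphere_eval (GRing.in_alg B \o GRing.in_alg A) (@coaction_gen R).
Proof.
move=> a; rewrite /coaction /sphere_eval /mmap.
by apply: eq_bigr => m _; congr (_ * _).
Qed.

Lemma coaction_zmod : zmod_morphism (@coaction R).
Proof. by move=> a b; rewrite !coaction_eval (sphere_eval_zmod _ coaction_gen_rel). Qed.

Lemma coaction_monoid : monoid_morphism (@coaction R).
Proof.
have [E1 EM] := sphere_eval_monoid (GRing.in_alg B \o GRing.in_alg A) coaction_gen_rel.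
by split=> [|a b]; rewrite !coaction_eval ?E1 // EM.
Qed.

Lemma coactionC (k : C) : coaction (k%:A : A) = (k%:A : A)%:A.
Proof. by rewrite coaction_eval (sphere_evalC _ coaction_gen_rel). Qed.

Lemma coaction_zE i : coaction (z R i) = coaction_z R i.
Proof.
have := sphere_eval_gen (GRing.in_alg B \o GRing.in_alg A) coaction_gen_rel (lshift 4 i).
by rewrite -coaction_eval coaction_gen_l.
Qed.

Lemma coaction_zsE i : coaction (zs R i) = coaction_zs i.
Proof.
have := sphere_eval_gen (GRing.in_alg B \o GRing.in_alg A) coaction_gen_rel (rshift 4 i).
by rewrite -coaction_eval coaction_gen_r coaction_star.
Qed.

Lemma tensor_id_zmod psi : zmod_morphism psi -> zmod_morphism (tensor_id psi).
Proof.
move=> psiB; pose psi' : {additive A -> A} :=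
  HB.pack_for {additive A -> A} psi (GRing.isZmodMorphism.Build A A psi psiB).
exact: (@sphere_map_zmod 1 A psi').
Qed.

Lemma tensor_idE psi a (t : B) :
  zmod_morphism psi -> sphere_mon t -> tensor_id psi (a *: t) = psi a *: t.
Proof.
move=> psiB; pose psi' : {additive A -> A} :=
  HB.pack_for {additive A -> A} psi (GRing.isZmodMorphism.Build A A psi psiB).
exact: (@sphere_mapE 1 A psi').
Qed.

Definition zpair (k : 'I_4) : A * A :=
  match val k with
  | 0 => (z R i1, zs R i2) | 1 => (- z R i2, zs R i1)
  | 2 => (z R i3, zs R i4) | _ => (- z R i4, zs R i3)
  end.

Lemma zpair_ind (Q : A -> Prop) : (forall k : C, Q k%:A) ->
    (forall i, Q (zpair i).1) -> (forall i, Q (zpair i).2) ->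
    (forall a b, Q a -> Q b -> Q (a + b)) -> (forall a b, Q a -> Q b -> Q (a * b)) ->
  forall a, Q a.
Proof.
move=> QC Q1 Q2 QD QM.
have QN a : Q (- a) -> Q a.
  by move=> Qa; rewrite -(opprK a) -scaleN1r -mulr_algl; apply: QM.
apply: sphere7_ind => // [|]; apply: ord4P.
- exact: (Q1 i1).
- exact: QN (Q1 i2).
- exact: (Q1 i3).
- exact: QN (Q1 i4).
- exact: (Q2 i2).
- exact: (Q2 i1).
- exact: (Q2 i4).
- exact: (Q2 i3).
Qed.

End Bundle.

(** * Twisting a weighted algebra *)

Section Phase.
Variables (R : realType) (theta : R).
Implicit Types (r s t : R * R).

Lemma phase0 : phase theta 0 = 1.
Proof. by rewrite /phase mulr0 cos0 sin0. Qed.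

Lemma phaseD u v : phase theta (u + v) = phase theta u * phase theta v.
Proof.
rewrite /phase mulrDr cosD sinD; simpc; congr (_ +i* _).
by rewrite addrC.
Qed.

Lemma phaseN u : phase theta (- u) = (phase theta u)^-1.
Proof.
have phN : phase theta (- u) * phase theta u = 1 by rewrite -phaseD addNr phase0.
have ph_neq0 : phase theta u != 0.
  by apply/eqP => ph0; move/eqP: phN; rewrite ph0 mulr0 eq_sym oner_eq0.
by apply: (mulIf ph_neq0); rewrite phN mulVf.
Qed.

Lemma phase_conj u : conjc (phase theta u) = phase theta (- u).
Proof. by rewrite /phase mulrN cosN sinN. Qed.

Lemma phase_natl n : phase theta n%:R = phase theta 1 ^+ n.
Proof.
elim: n => [|n IHn]; first by rewrite phase0 expr0.
by rewrite -natr1 phaseD IHn exprSr.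
Qed.

Lemma wedgeDl r s t : wedge (r + s) t = wedge r t + wedge s t.
Proof. by rewrite /wedge /=; ring. Qed.

Lemma wedgeDr r s t : wedge r (s + t) = wedge r s + wedge r t.
Proof. by rewrite /wedge /=; ring. Qed.

Lemma wedgeNr r s : wedge r (- s) = - wedge r s.
Proof. by rewrite /wedge /=; ring. Qed.

Lemma wedgeC r s : wedge r s = - wedge s r.
Proof. by rewrite /wedge; ring. Qed.

End Phase.

Lemma subrDD (V : zmodType) (x y t u : V) : x + y - (t + u) = x - t + (y - u).
Proof. by rewrite opprD addrACA. Qed.

Lemma subrBB (V : zmodType) (x y t u : V) : x - y - (t - u) = x - t - (y - u).
Proof. by rewrite !opprB addrACA [RHS]addrACA; congr (_ + _); rewrite addrC. Qed.

Lemma linZ (K : comNzRingType) (V : lmodType K) (F : {linear V -> V}) k v :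
  F (k *: v) = k *: F v.
Proof. exact: linearZ. Qed.

Lemma linN (K : comNzRingType) (V : lmodType K) (F : {linear V -> V}) v :
  F (- v) = - F v.
Proof. exact: linearN. Qed.

Section GradedInduction.
Variables (C : comNzRingType) (A : comAlgType C) (I : Type) (p : I -> A * A).
Variables (W : zmodType) (G : W -> A -> Prop).
Hypothesis gen_ind : forall Q : A -> Prop, (forall k, Q k%:A) ->
  (forall i, Q (p i).1) -> (forall i, Q (p i).2) ->
  (forall a b, Q a -> Q b -> Q (a + b)) -> (forall a b, Q a -> Q b -> Q (a * b)) ->
  forall a, Q a.
Hypotheses (GC : forall k, G 0 k%:A) (GM : forall s t a b, G s a -> G t b -> G (s + t) (a * b)).
Hypothesis Gp : forall i, exists s, G s (p i).1 /\ G s (p i).2.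

(** [G] may be any multiplicative family that contains the scalars and the pairs. It serves once for
    weight vectors and once for weight vectors whose coaction is homogeneous too. *)
Inductive graded_sum : A -> Prop :=
| GradedHom s a of G s a : graded_sum a
| GradedAdd a b of graded_sum a & graded_sum b : graded_sum (a + b).

Lemma graded_sumP a : graded_sum a.
Proof.
elim/gen_ind: a => [k|i|i|a b|a b]; [exact: GradedHom (GC k)| | |exact: GradedAdd|].
- by have [s [si _]] := Gp i; apply: GradedHom si.
- by have [s [_ si]] := Gp i; apply: GradedHom si.
elim=> [s {}a sa|a1 a2 _ IH1 _ IH2 Gb]; last first.
  by rewrite mulrDl; apply: GradedAdd; [apply: IH1|apply: IH2].
elim=> [t {}b tb|b1 b2 _ IH1 _ IH2]; first exact: GradedHom (GM sa tb).
by rewrite mulrDr; apply: GradedAdd.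
Qed.

Lemma graded_ind (Q : A -> Prop) : (forall s a, G s a -> Q a) ->
  (forall a b, Q a -> Q b -> Q (a + b)) -> forall a, Q a.
Proof.
by move=> QG QD a; elim: (graded_sumP a) => [//|b c _ Qb _ Qc]; apply: QD.
Qed.

End GradedInduction.

(* A, ow, st and, further below, p, B, coact, tid, Mon abstract O(S^7),        *)
(* over_weights, star, the pairs p_k, O(S^7) (x) O(SU(2)), coaction,          *)
(* tensor_id and the monomials in w_j, w_j^*; the definitions tmul, tD, tact, *)
(* tbr, tstar, taut mirror bmul, Dtwist, R_act, bracket, map_star, aut.       *)
Section Twist.
Variables (R : realType) (A : comAlgType R[i]).
Local Notation C := R[i].
Implicit Types (a b c : A) (r s t u v m : R * R) (psi phi X : A -> A).

Variables H1 H2 : A -> A.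
Hypotheses (H1_deriv : derivation H1) (H2_deriv : derivation H2).

Definition wt_vec s a : Prop := H1 a = (s.1)%:C *: a /\ H2 a = (s.2)%:C *: a.

Definition add_fam (F : R * R -> A -> A) : Prop := forall s, zmod_morphism (F s).

Variable ow : (R * R -> A -> A) -> A -> A.
Hypothesis ow_vec : forall F s a, add_fam F -> wt_vec s a -> ow F a = F s a.
Hypothesis ow_zmod : forall F, add_fam F -> zmod_morphism (ow F).
Hypothesis wt_ind : forall Q : A -> Prop,
  (forall s a, wt_vec s a -> Q a) -> (forall a b, Q a -> Q b -> Q (a + b)) ->
  forall a, Q a.

Lemma wt_vecD s a b : wt_vec s a -> wt_vec s b -> wt_vec s (a + b).
Proof.
have [H1B _ _] := H1_deriv; have [H2B _ _] := H2_deriv.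
case=> a1 a2 [b1 b2]; split.
  by rewrite (zmod_morphismD H1B) a1 b1 scalerDr.
by rewrite (zmod_morphismD H2B) a2 b2 scalerDr.
Qed.

Lemma wt_vec0 s : wt_vec s 0.
Proof.
have [H1B _ _] := H1_deriv; have [H2B _ _] := H2_deriv.
by split; rewrite scaler0; apply: zmod_morphism0.
Qed.

Lemma wt_vecZ s k a : wt_vec s a -> wt_vec s (k *: a).
Proof.
case=> a1 a2; split.
  by rewrite (derivation_scale H1_deriv) a1 !scalerA mulrC.
by rewrite (derivation_scale H2_deriv) a2 !scalerA mulrC.
Qed.

Lemma wt_vecN s a : wt_vec s a -> wt_vec s (- a).
Proof. by rewrite -scaleN1r; apply: wt_vecZ. Qed.

Lemma wt_vecM s t a b : wt_vec s a -> wt_vec t b -> wt_vec (s + t) (a * b).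
Proof.
have [_ _ H1M] := H1_deriv; have [_ _ H2M] := H2_deriv.
case=> a1 a2 [b1 b2]; split.
  by rewrite H1M a1 b1 rmorphD scalerDl scalerAl scalerAr.
by rewrite H2M a2 b2 rmorphD scalerDl scalerAl scalerAr.
Qed.

Lemma wt_vecC k : wt_vec 0 k%:A.
Proof.
have [_ H1C _] := H1_deriv; have [_ H2C _] := H2_deriv.
by split; rewrite ?H1C ?H2C rmorph0 scale0r.
Qed.

(** Weight vectors span, so an identity between maps built with [ow] reduces to one between phases;
    almost every computation with the twist starts here. *)
Lemma wt_ext (F G : A -> A) : zmod_morphism F -> zmod_morphism G ->
  (forall s a, wt_vec s a -> F a = G a) -> F =1 G.
Proof.
move=> FB GB FG; apply: wt_ind => [|a b Fa Fb]; first exact: FG.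
by rewrite (zmod_morphismD FB) (zmod_morphismD GB) Fa Fb.
Qed.

Lemma ow_linear F : (forall s, linear (F s)) -> linear (ow F).
Proof.
move=> FL; have FB : add_fam F.
  by move=> s a b; rewrite addrC -scaleN1r FL scaleN1r addrC.
move=> k a b; rewrite (zmod_morphismD (ow_zmod FB)); congr (_ + _); move: a.
apply: wt_ext => [a c|a c|s a sa].
- by rewrite scalerBr (ow_zmod FB).
- by rewrite (ow_zmod FB) scalerBr.
rewrite (ow_vec FB sa) (ow_vec FB (wt_vecZ k sa)).
by rewrite -[k *: a]addr0 FL (zmod_morphism0 (FB s)) addr0.
Qed.

Lemma owD F G a : add_fam F -> add_fam G ->
  ow (fun s b => F s b + G s b) a = ow F a + ow G a.
Proof.
move=> FB GB; have FGB : add_fam (fun s b => F s b + G s b).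
  by move=> s b c; rewrite FB GB opprD addrACA.
move: a; apply: wt_ext => [a b|a b|s a sa].
- exact: ow_zmod.
- by rewrite !ow_zmod // opprD addrACA.
by rewrite !(ow_vec _ sa).
Qed.

Definition omw (F : R * R -> R * R -> A -> A) psi a :=
  ow (fun s a_s => ow (fun t b => F (t - s) s b) (psi a_s)) a.

Variable theta : R.
Local Notation ph := (phase theta).

Definition rot v := ow (fun s a => ph (wedge s v) *: a).

Let rot_fam v : add_fam (fun s a => ph (wedge s v) *: a).
Proof. by move=> s a b; rewrite scalerBr. Qed.

Lemma rot_vec v s a : wt_vec s a -> rot v a = ph (wedge s v) *: a.
Proof. exact: ow_vec. Qed.

Lemma rot_linear v : linear (rot v).
Proof. by apply: ow_linear => s k a b; rewrite scalerDr !scalerA mulrC. Qed.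

HB.instance Definition _ v := GRing.isLinear.Build C A A *:%R (rot v) (rot_linear v).

Lemma rotZ v k a : rot v (k *: a) = k *: rot v a. Proof. exact: linearZ. Qed.
Lemma rotB v a b : rot v (a - b) = rot v a - rot v b. Proof. exact: raddfB. Qed.

Lemma rotM v a b : rot v (a * b) = rot v a * rot v b.
Proof.
move: a; apply: wt_ext => [a c|a c|s a sa].
- by rewrite mulrBl raddfB.
- by rewrite raddfB mulrBl.
move: b; apply: wt_ext => [b c|b c|t b tb].
- by rewrite mulrBr raddfB.
- by rewrite raddfB mulrBr.
rewrite (rot_vec _ sa) (rot_vec _ tb) (rot_vec _ (wt_vecM sa tb)).
by rewrite -scalerAl -scalerAr scalerA wedgeDl phaseD.
Qed.

Lemma rotD u v a : rot u (rot v a) = rot (u + v) a.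
Proof.
move: a; apply: wt_ext => [a b|a b|s a sa]; rewrite ?raddfB //.
by rewrite (rot_vec v sa) linearZ /= !(rot_vec _ sa) scalerA wedgeDr phaseD mulrC.
Qed.

Lemma rot0 a : rot 0 a = a.
Proof.
move: a; apply: wt_ext => [a b|a b|s a sa]; rewrite ?raddfB //.
by rewrite (rot_vec _ sa) /wedge !mulr0 subr0 phase0 scale1r.
Qed.

Lemma rot_wt v s a : wt_vec s a -> wt_vec s (rot v a).
Proof. by move=> sa; rewrite (rot_vec _ sa); apply: wt_vecZ. Qed.

Definition tmul a b :=
  ow (fun s a_s => ow (fun m b_m => ph (- wedge s m) *: (a_s * b_m)) b) a.

Let tmul_fam1 b : add_fam (fun s a_s => ow (fun m b_m => ph (- wedge s m) *: (a_s * b_m)) b).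
Proof.
move=> s a c; move: b; apply: wt_ext => [b d|b d|m b mb].
- by rewrite ow_zmod // => u x y; rewrite mulrBr scalerBr.
- rewrite !ow_zmod; first by rewrite !opprD !opprK addrACA.
  + by move=> u x y; rewrite mulrBr scalerBr.
  + by move=> u x y; rewrite mulrBr scalerBr.
rewrite !(ow_vec _ mb) ?mulrBl ?scalerBr // => u x y; by rewrite mulrBr scalerBr.
Qed.

Let tmul_fam2 s a : add_fam (fun m b_m => ph (- wedge s m) *: (a * b_m)).
Proof. by move=> m x y; rewrite mulrBr scalerBr. Qed.

(** Once one factor is homogeneous, the twisted product is the ordinary product with a rotation of
    the other factor, which then need not be decomposed. *)
Lemma tmul_vecl s a b : wt_vec s a -> tmul a b = a * rot s b.
Proof.
move=> sa; rewrite /tmul (ow_vec _ sa) //; move: b.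
apply: wt_ext => [b c|b c|m b mb]; rewrite ?ow_zmod ?raddfB ?mulrBr //.
by rewrite (ow_vec _ mb) // (rot_vec _ mb) -scalerAr wedgeC opprK.
Qed.

Lemma tmul_vecr m a b : wt_vec m b -> tmul a b = rot (- m) a * b.
Proof.
move=> mb; move: a; apply: wt_ext => [a c|a c|s a sa].
- exact: ow_zmod.
- by rewrite raddfB mulrBl.
by rewrite (tmul_vecl _ sa) (rot_vec _ mb) (rot_vec _ sa) -scalerAr -scalerAl wedgeNr -wedgeC.
Qed.

Lemma tmul_linearr a : linear (tmul a).
Proof.
move=> k b c; move: a; apply: wt_ext => [a d|a d|s a sa].
- exact: ow_zmod.
- by rewrite /tmul !ow_zmod // scalerBr; rewrite opprD addrACA.
by rewrite !(tmul_vecl _ sa) linearP mulrDr scalerAr.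
Qed.

HB.instance Definition _ a := GRing.isLinear.Build C A A *:%R (tmul a) (tmul_linearr a).

Lemma tmulZr k a b : tmul a (k *: b) = k *: tmul a b. Proof. exact: linearZ. Qed.
Lemma tmulDr a b c : tmul a (b + c) = tmul a b + tmul a c. Proof. exact: raddfD. Qed.
Lemma tmulBr a b c : tmul a (b - c) = tmul a b - tmul a c. Proof. exact: raddfB. Qed.

Lemma tmul_linearl b : linear (tmul^~ b).
Proof.
move=> k a c; move: b; apply: wt_ext => [b d|b d|m b mb].
- by rewrite raddfB.
- by rewrite !raddfB /= opprD addrACA.
by rewrite !(tmul_vecr _ mb) linearP mulrDl scalerAl.
Qed.

Lemma tmulDl a b c : tmul (a + b) c = tmul a c + tmul b c.
Proof. by rewrite -[a]scale1r tmul_linearl !scale1r. Qed.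

Lemma tmulBl a b c : tmul (a - b) c = tmul a c - tmul b c.
Proof. by rewrite addrC -scaleN1r tmul_linearl scaleN1r addrC. Qed.

Lemma tmulZl k a c : tmul (k *: a) c = k *: tmul a c.
Proof. by rewrite -[k *: a]addr0 tmul_linearl -[in tmul 0 c](subrr 0) tmulBl subrr addr0. Qed.

Lemma rot_tmul v a b : rot v (tmul a b) = tmul (rot v a) (rot v b).
Proof.
move: a; apply: wt_ext => [a c|a c|s a sa].
- by rewrite tmulBl raddfB.
- by rewrite raddfB tmulBl.
by rewrite (tmul_vecl _ sa) (tmul_vecl _ (rot_wt v sa)) rotM !rotD addrC.
Qed.

Lemma tmul_wt s m a b : wt_vec s a -> wt_vec m b -> wt_vec (s + m) (tmul a b).
Proof.
by move=> sa mb; rewrite (tmul_vecl _ sa); apply: wt_vecM => //; apply: rot_wt.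
Qed.

(** Associativity rests on the bilinearity of the wedge, here in the form that rotations are
    multiplicative for both products and add up under composition. *)
Lemma tmulA a b c : tmul a (tmul b c) = tmul (tmul a b) c.
Proof.
move: a; apply: wt_ext => [a d|a d|s a sa]; rewrite ?tmulBl //.
rewrite !(tmul_vecl _ sa) rot_tmul; move: c; apply: wt_ext => [c d|c d|m c mc].
- by rewrite !raddfB mulrBr.
- by rewrite !raddfB.
rewrite !(tmul_vecr _ mc) (tmul_vecr _ (rot_wt _ mc)) rotM (rot_vec _ sa) (rot_vec _ mc).
by rewrite -!scalerAl -!scalerAr mulrA wedgeNr -wedgeC.
Qed.

(** * Weight maps and the twist of linear maps *)

Definition wt_map r psi : Prop := forall a,
  H1 (psi a) - psi (H1 a) = (r.1)%:C *: psi a /\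
  H2 (psi a) - psi (H2 a) = (r.2)%:C *: psi a.

Section Maps.
Variables (psi phi : {linear A -> A}).

Lemma wt_map_vec r s a : wt_map r psi -> wt_vec s a -> wt_vec (r + s) (psi a).
Proof.
move=> /(_ a)[p1 p2] [a1 a2]; split.
  by move/eqP: p1; rewrite subr_eq a1 linearZ -scalerDl -rmorphD => /eqP.
by move/eqP: p2; rewrite subr_eq a2 linearZ -scalerDl -rmorphD => /eqP.
Qed.

Let omw_fam F : (forall t, add_fam (F t)) ->
  add_fam (fun s a_s => ow (fun t b => F (t - s) s b) (psi a_s)).
Proof.
move=> FA t a b; rewrite raddfB ow_zmod // => s; exact: FA.
Qed.

Lemma omw_vecr F s a : (forall t, add_fam (F t)) -> wt_vec s a ->
  omw F psi a = ow (fun t b => F (t - s) s b) (psi a).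
Proof. by move=> FA sa; rewrite /omw (ow_vec _ sa) //; apply: omw_fam. Qed.

Lemma omw_zmod F : (forall t, add_fam (F t)) -> zmod_morphism (omw F psi).
Proof. by move=> FA; apply: ow_zmod; apply: omw_fam. Qed.

Lemma omw_vec F r s a : (forall t, add_fam (F t)) -> wt_map r psi -> wt_vec s a ->
  omw F psi a = F r s (psi a).
Proof.
move=> FA rpsi sa; rewrite (omw_vecr FA sa) (ow_vec _ (wt_map_vec rpsi sa)) ?addrK // => t.
exact: FA.
Qed.

Lemma omw_linear F : (forall t s, linear (F t s)) -> linear (omw F psi).
Proof.
by move=> FL; apply: ow_linear => s k a b; rewrite linearP ow_linear // => t; apply: FL.
Qed.

Lemma omwD (chi : {linear A -> A}) F a : (forall t, add_fam (F t)) ->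
  (forall b, chi b = psi b + phi b) -> omw F chi a = omw F psi a + omw F phi a.
Proof.
move=> FA chiE; have F0 t : add_fam (fun u => F (u - t) t) by move=> u; apply: FA.
rewrite -owD; [|exact: omw_fam|by move=> t b c; rewrite raddfB ow_zmod].
rewrite /omw; congr (ow _ _); apply/funext => t; apply/funext => b.
by rewrite chiE (zmod_morphismD (ow_zmod (F0 t))).
Qed.

End Maps.

Lemma wt_mapP r (psi : {linear A -> A}) :
  (forall s a, wt_vec s a -> wt_vec (r + s) (psi a)) -> wt_map r psi.
Proof.
have [H1B _ _] := H1_deriv; have [H2B _ _] := H2_deriv.
move=> rpsi a; split; move: a; apply: wt_ext => [a b|a b|s a sa].
- by rewrite raddfB !H1B raddfB subrBB.
- by rewrite raddfB scalerBr.
- have [-> _] := rpsi _ _ sa; have [-> _] := sa.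
  by rewrite linearZ -scalerBl rmorphD addrK.
- by rewrite raddfB !H2B raddfB subrBB.
- by rewrite raddfB scalerBr.
- have [_ ->] := rpsi _ _ sa; have [_ ->] := sa.
  by rewrite linearZ -scalerBl rmorphD addrK.
Qed.

Definition tD X := omw (fun r s b => ph (- wedge r s) *: b) X.

Definition tact s psi := omw (fun r _ b => ph (- 2 * wedge r s) *: b) psi.

Section Dtwist.
Variable psi : {linear A -> A}.

Lemma tD_linear : linear (tD psi).
Proof. by apply: omw_linear => t s k a b; rewrite scalerDr !scalerA mulrC. Qed.

HB.instance Definition _ := GRing.isLinear.Build C A A *:%R (tD psi) tD_linear.

Lemma tDZ k a : tD psi (k *: a) = k *: tD psi a. Proof. exact: linearZ. Qed.

Lemma tD_vecr s a : wt_vec s a -> tD psi a = rot (- s) (psi a).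
Proof.
move=> sa; rewrite /tD (omw_vecr _ _ sa); last by move=> t u b c; rewrite scalerBr.
rewrite /rot; congr (ow _ _); apply/funext => t; apply/funext => b.
by congr (ph _ *: _); rewrite /wedge /=; ring.
Qed.

Lemma tD_hom r : wt_map r psi -> tD psi =1 psi \o rot r.
Proof.
move=> rpsi; apply: wt_ext => [a b|a b|s a sa]; rewrite ?raddfB //=.
rewrite (tD_vecr sa) (rot_vec _ (wt_map_vec rpsi sa)) (rot_vec _ sa) linearZ /=.
by congr (ph _ *: _); rewrite /wedge /=; ring.
Qed.

Lemma tact_vecr s m a : wt_vec m a ->
  tact s psi a = ph (2 * wedge m s) *: rot (- (s + s)) (psi a).
Proof.
move=> ma; rewrite /tact (omw_vecr _ _ ma); last by move=> t u b c; rewrite scalerBr.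
move: (psi a) => {ma}a; move: a; apply: wt_ext => [a b|a b|t a ta].
- by rewrite ow_zmod // => u x y; rewrite scalerBr.
- by rewrite raddfB scalerBr.
rewrite (ow_vec _ ta) ?(rot_vec _ ta) ?scalerA -?phaseD => [|u b c]; last by rewrite scalerBr.
by congr (ph _ *: _); rewrite /wedge /=; ring.
Qed.

Lemma tact_hom s r : wt_map r psi -> forall a, tact s psi a = ph (- 2 * wedge r s) *: psi a.
Proof.
move=> rpsi; apply: wt_ext => [a b|a b|m a ma].
- rewrite /tact omw_zmod // => t u c d; exact: scalerBr.
- by rewrite raddfB scalerBr.
rewrite (tact_vecr s ma) (rot_vec _ (wt_map_vec rpsi ma)) scalerA -phaseD.
by congr (ph _ *: _); rewrite /wedge /=; ring.
Qed.

Lemma tact_linear s : linear (tact s psi).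
Proof. by apply: omw_linear => t u k a b; rewrite scalerDr !scalerA mulrC. Qed.

HB.instance Definition _ s := GRing.isLinear.Build C A A *:%R (tact s psi) (tact_linear s).

Lemma tact_wt_map s r : wt_map r psi -> wt_map r (tact s psi).
Proof.
move=> rpsi; apply: wt_mapP => m a ma; rewrite /= (tact_hom _ rpsi).
exact/wt_vecZ/wt_map_vec.
Qed.

End Dtwist.

Lemma tactD (psi phi chi : {linear A -> A}) s a : (forall b, chi b = psi b + phi b) ->
  tact s chi a = tact s psi a + tact s phi a.
Proof. by move=> chiE; apply: omwD => // t u b c; rewrite scalerBr. Qed.

(** * Derivations and braided derivations *)

Definition tbraided psi : Prop :=
  linear psi /\
  forall a a', psi (tmul a a') =
    tmul (psi a) a' + ow (fun s a_s => tmul a_s (tact s psi a')) a.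

(** Undoes [tD], which on weight s applies the opposite rotation to the value. *)
Definition untwist psi a := ow (fun s a_s => rot s (psi a_s)) a.

Section Untwist.
Variable psi : {linear A -> A}.

Lemma untwist_linear : linear (untwist psi).
Proof. by apply: ow_linear => s k a b; rewrite !linearP. Qed.

HB.instance Definition _ := GRing.isLinear.Build C A A *:%R (untwist psi) untwist_linear.

Lemma untwist_vec s a : wt_vec s a -> untwist psi a = rot s (psi a).
Proof. by move=> sa; rewrite /untwist (ow_vec _ sa) // => t b c; rewrite !raddfB. Qed.

Lemma untwistK : tD (untwist psi) =1 psi.
Proof.
apply: wt_ext => [a b|a b|s a sa]; rewrite ?raddfB //.
by rewrite (tD_vecr _ sa) /= (untwist_vec sa) rotD addNr rot0.
Qed.

Let braided_term s a a' m : wt_vec s a -> wt_vec m a' ->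
  ow (fun s a_s => tmul a_s (tact s psi a')) a = ph (2 * wedge m s) *: (a * rot (- s) (psi a')).
Proof.
move=> sa ma; rewrite (ow_vec _ sa) => [|t b c]; last by rewrite tmulBl.
rewrite (tmul_vecl _ sa) (tact_vecr _ _ ma) linearZ /= rotD scalerAr.
by congr (_ * (_ *: rot _ _)); rewrite opprD addrA subrr add0r.
Qed.

Lemma untwist_derivation : tbraided psi -> derivation (untwist psi).
Proof.
case=> _ psiM.
have DM a b : untwist psi (a * b) = untwist psi a * b + a * untwist psi b.
  move: a; apply: wt_ext => [a c|a c|s a sa].
  - by rewrite mulrBl raddfB.
  - by rewrite raddfB !mulrBl opprD addrACA.
  move: b; apply: wt_ext => [b c|b c|m b mb].
  - by rewrite mulrBr raddfB.
  - by rewrite raddfB !mulrBr opprD addrACA.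
  rewrite (untwist_vec (wt_vecM sa mb)) (untwist_vec sa) (untwist_vec mb).
  have := psiM a b; rewrite (braided_term sa mb) (tmul_vecr _ mb) (tmul_vecr (psi a) mb).
  (* Rotating the braided Leibniz rule by s + m leaves the ordinary Leibniz rule up to a phase on
     each term; multiplying by the phase of s /\ m cancels all of them. *)
  rewrite (rot_vec _ sa) -scalerAl linearZ /= => /(congr1 (rot (s + m))).
  rewrite linearZ raddfD /= linearZ /= !rotM !rotD addrK [s + m - s]addrAC subrr add0r.
  rewrite (rot_vec _ mb) (rot_vec _ sa) => /(congr1 ( *:%R (ph (wedge s m)))).
  rewrite scalerDr -!scalerAr -scalerAl !scalerA -!phaseD.
  rewrite [X in ph X](_ : _ = 0); last by rewrite /wedge /=; ring.
  rewrite phase0 scale1r => ->; congr (_ + _).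
    by rewrite [X in ph X](_ : _ = 0) ?phase0 ?scale1r // /wedge /=; ring.
  by rewrite [X in ph X](_ : _ = 0) ?phase0 ?scale1r // /wedge /=; ring.
split=> // [a b|k]; first exact: raddfB.
have D1 : untwist psi 1 = 0.
  by have /eqP := DM 1 1; rewrite !mulr1 mul1r -subr_eq0 opprD addNKr oppr_eq0 => /eqP.
by rewrite linearZ /= D1 scaler0.
Qed.

End Untwist.

Lemma tD_braided (psi : {linear A -> A}) : derivation psi -> tbraided (tD psi).
Proof.
case=> psiB psiC psiM; split=> [|a b]; first exact: tD_linear.
move: a; apply: wt_ext => [a c|a c|s a sa].
- by rewrite tmulBl !raddfB.
- rewrite !raddfB tmulBl ow_zmod => [|t x y]; last by rewrite tmulBl.
  by rewrite opprD addrACA.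
have famT c : add_fam (fun s a_s => tmul a_s (tact s (tD psi) c)) by move=> t x y; rewrite tmulBl.
rewrite (ow_vec _ sa) //.
move: b; apply: wt_ext => [b c|b c|m b mb].
- by rewrite !raddfB.
- by rewrite !raddfB /= subrDD.
rewrite (tact_vecr _ _ mb) /= !(tmul_vecl _ sa) [tmul _ b](tmul_vecr _ mb).
rewrite !(tD_vecr _ sa) (tD_vecr _ mb) (rot_vec s mb) -scalerAr 2!linearZ /= !rotD.
rewrite (tD_vecr _ (wt_vecM sa mb)) psiM raddfD /= !rotM (rot_vec _ mb) (rot_vec _ sa).
rewrite scalerDr -!scalerAr -scalerAl !scalerA -!phaseD; congr (_ + _).
  rewrite [X in ph X](_ : _ = 0) ?phase0 ?scale1r; last by rewrite /wedge /=; ring.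
  by rewrite opprD addrC.
congr (ph _ *: (_ * rot _ _)); first by rewrite /wedge /=; ring.
by rewrite !opprD !addrA subrr sub0r.
Qed.

Lemma tD_wt_map r (psi : {linear A -> A}) : wt_map r psi -> wt_map r (tD psi).
Proof.
by move=> rpsi; apply: wt_mapP => s a sa; rewrite /= (tD_vecr _ sa); apply/rot_wt/wt_map_vec.
Qed.

Definition tmod f psi a := tmul f (psi a).

Section Tmod.
Variables (f : A) (psi : {linear A -> A}).

Fact tmod_linear : linear (tmod f psi).
Proof. by move=> k a b; rewrite /tmod !linearP. Qed.

HB.instance Definition _ := GRing.isLinear.Build C A A *:%R (tmod f psi) tmod_linear.

Lemma tmod_wt_map m r : wt_vec m f -> wt_map r psi -> wt_map (m + r) (tmod f psi).
Proof.
move=> mf rpsi; apply: wt_mapP => s a sa; rewrite -addrA.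
by apply: tmul_wt => //; apply: wt_map_vec.
Qed.

End Tmod.

(** * The braided bracket *)

Definition tbr psi lam a :=
  psi (lam a) -
  omw (fun r _ b => omw (fun s _ c => ph (- 2 * wedge r s) *: c) lam b) psi a.

Section Bracket.
Variables (psi lam : {linear A -> A}).

Let br_fam (mu : {linear A -> A}) t :
  R * R -> forall u : R * R, linear (fun b => omw (fun s _ c => ph (- 2 * wedge t s) *: c) mu b).
Proof.
by move=> _ _; apply: omw_linear => u v k a b; rewrite scalerDr !scalerA mulrC.
Qed.

Lemma br_fam_zmod (mu : {linear A -> A}) t :
  add_fam (fun _ b => omw (fun s _ c => ph (- 2 * wedge t s) *: c) mu b).
Proof. by move=> u a b; rewrite omw_zmod // => v w x y; rewrite scalerBr. Qed.

Fact tbr_linear : linear (tbr psi lam).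
Proof.
move=> k a b; rewrite /tbr !linearP omw_linear; last first.
  by move=> t s; apply: br_fam.
by rewrite subrDD scalerBr.
Qed.

HB.instance Definition _ := GRing.isLinear.Build C A A *:%R (tbr psi lam) tbr_linear.

Lemma tbr_hom r s : wt_map r psi -> wt_map s lam ->
  forall a, tbr psi lam a = psi (lam a) - ph (- 2 * wedge r s) *: lam (psi a).
Proof.
move=> rpsi slam; apply: wt_ext => [a b|a b|m a ma].
- exact: raddfB.
- by rewrite !raddfB /= addrACA.
rewrite /tbr (omw_vec _ rpsi ma); last by move=> t; apply: br_fam_zmod.
rewrite (omw_vec _ slam (wt_map_vec rpsi ma)) // => t u x y; exact: scalerBr.
Qed.

End Bracket.

Section BracketHom.
Variables (psi lam : {linear A -> A}).

Lemma tbr_wt_map r s : wt_map r psi -> wt_map s lam -> wt_map (r + s) (tbr psi lam).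
Proof.
move=> rpsi slam; apply: wt_mapP => m a ma; rewrite /= (tbr_hom rpsi slam).
apply: wt_vecD; first by rewrite -addrA; do 2!apply: wt_map_vec => //.
apply/wt_vecN/wt_vecZ; rewrite [r + s]addrC -addrA.
by do 2!apply: wt_map_vec => //.
Qed.

Lemma tbr_anti r s a : wt_map r psi -> wt_map s lam ->
  tbr psi lam a = - (ph (- 2 * wedge r s) *: tbr lam psi a).
Proof.
move=> rpsi slam; rewrite (tbr_hom rpsi slam) (tbr_hom slam rpsi).
rewrite scalerBr scalerA -phaseD opprB [X in ph X *: psi _](_ : _ = 0) ?phase0 ?scale1r //.
by rewrite /wedge; ring.
Qed.

(** The composite D(X) D(X') is e^{- i pi theta r /\ s} D(X X'), while the opposite order gives the
    inverse phase. The braiding factor e^{- 2 pi i theta r /\ s} of the bracket makes the two phases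
    equal. *)
Lemma tbr_tD (chi : {linear A -> A}) r s : wt_map r psi -> wt_map s lam ->
  (forall a, chi a = psi (lam a) - lam (psi a)) ->
  forall a, tbr (tD psi) (tD lam) a = ph (- wedge r s) *: tD chi a.
Proof.
move=> rpsi slam chiE; apply: wt_ext => [a b|a b|m a ma].
- exact: raddfB.
- by rewrite !raddfB.
rewrite (tbr_hom (tD_wt_map rpsi) (tD_wt_map slam)) /= !(tD_vecr _ ma).
have rm := wt_map_vec rpsi ma; have sm := wt_map_vec slam ma.
rewrite (rot_vec _ rm) (rot_vec _ sm) !tDZ.
rewrite (tD_vecr _ rm) (tD_vecr _ sm) chiE rotB.
rewrite !(rot_vec _ (wt_map_vec rpsi sm)) !(rot_vec _ (wt_map_vec slam rm)).
rewrite scalerBr !scalerA -!phaseD.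
by congr (ph _ *: _ - ph _ *: _); rewrite /wedge /=; ring.
Qed.

End BracketHom.

Lemma tbrDl (psi psi' chi lam : {linear A -> A}) a :
  (forall b, chi b = psi b + psi' b) -> tbr chi lam a = tbr psi lam a + tbr psi' lam a.
Proof.
move=> chiE; rewrite /tbr chiE (omwD _ _ chiE) ?subrDD // => t.
exact: br_fam_zmod.
Qed.

Lemma tbrDr (psi lam lam' chi : {linear A -> A}) a :
  (forall b, chi b = lam b + lam' b) -> tbr psi chi a = tbr psi lam a + tbr psi lam' a.
Proof.
move=> chiE; rewrite /tbr chiE raddfD /= -subrDD; congr (_ - _).
move: a; apply: wt_ext => [a b|a b|m a ma].
- by apply: omw_zmod => t; apply: br_fam_zmod.
- rewrite !omw_zmod ?subrDD // => t; exact: br_fam_zmod.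
rewrite !(omw_vecr _ _ ma); try by move=> t; apply: br_fam_zmod.
rewrite -owD; [|by move=> t; apply: (br_fam_zmod _ (t - m) m)..].
congr (ow _ _); apply/funext => t; apply/funext => b.
by apply: omwD => // t1 u x y; rewrite scalerBr.
Qed.

(** * The module rule for brackets *)

Section ModuleBracket.
Variables (psi lam : {linear A -> A}).

(** Since [chi] kills [f], only the braided term of the Leibniz rule survives. *)
Lemma braided_hom (chi : {linear A -> A}) r n f a : tbraided chi -> wt_map r chi -> wt_vec n f -> chi f = 0 ->
  chi (tmul f a) = ph (- 2 * wedge r n) *: tmul f (chi a).
Proof.
case=> _ psiM rpsi nf f0; rewrite psiM f0 (ow_vec _ nf) => [|s b c]; last by rewrite tmulBl.
by rewrite -[0](subrr 0) tmulBl subrr add0r (tact_hom _ rpsi) linearZ.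
Qed.

Lemma tmulC m n f f' : wt_vec m f -> wt_vec n f' ->
  tmul f' f = ph (2 * wedge m n) *: tmul f f'.
Proof.
move=> mf nf'; rewrite (tmul_vecr _ mf) (tmul_vecl _ mf) (rot_vec _ nf') (rot_vec _ nf').
rewrite -scalerAr scalerA -phaseD -scalerAl mulrC.
by congr (ph _ *: _); rewrite /wedge /=; ring.
Qed.

Definition tmod_br f f' (psi lam : A -> A) c :=
  tmul f (ow (fun s f'_s => tmul f'_s (tbr (tact s psi) lam c)) f').

Let fam c : add_fam (fun s f'_s => tmul f'_s (tbr (tact s psi) lam c)).
Proof. by move=> s a b; rewrite tmulBl. Qed.

(** Moving [psi] past [f'], [lam] past [f], and reordering [f'] and [f] turns both sides into the
    same two composites applied to [c]; the phases match by bilinearity of the wedge. *)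
Lemma tmod_br_hom m n r t f f' c :
    wt_vec m f -> wt_vec n f' -> wt_map r psi -> wt_map t lam ->
    tbraided psi -> tbraided lam -> psi f' = 0 -> lam f = 0 ->
  tbr (tmod f psi) (tmod f' lam) c = tmod_br f f' psi lam c.
Proof.
move=> mf nf' rpsi tlam Bpsi Blam psif' lamf.
rewrite (tbr_hom (tmod_wt_map mf rpsi) (tmod_wt_map nf' tlam)) /tmod_br (ow_vec _ nf') //.
rewrite (tbr_hom (tact_wt_map _ rpsi) tlam) /= /tmod !(tact_hom _ rpsi).
rewrite (braided_hom _ Bpsi rpsi nf' psif') (braided_hom _ Blam tlam mf lamf).
rewrite (linZ lam) !tmulBr !tmulZr !tmulA (tmulC mf nf') !tmulZl.
rewrite !scalerA -!phaseD; congr (_ - ph _ *: _); rewrite /wedge /=; ring.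
Qed.

End ModuleBracket.

Section ModuleBracketD.
Implicit Types (chi lam : {linear A -> A}).

Lemma tmod_br_Df f1 f2 f' psi (lam : A -> A) c :
  tmod_br (f1 + f2) f' psi lam c = tmod_br f1 f' psi lam c + tmod_br f2 f' psi lam c.
Proof. exact: tmulDl. Qed.

Lemma tmod_br_Df' f f1 f2 psi lam c :
  tmod_br f (f1 + f2) psi lam c = tmod_br f f1 psi lam c + tmod_br f f2 psi lam c.
Proof.
by rewrite /tmod_br (zmod_morphismD (ow_zmod _)) ?raddfD // => s a b; rewrite tmulBl.
Qed.

Lemma tmod_br_Dl f f' (psi psi' chi lam : {linear A -> A}) c :
    (forall b, chi b = psi b + psi' b) ->
  tmod_br f f' chi lam c = tmod_br f f' psi lam c + tmod_br f f' psi' lam c.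
Proof.
move=> chiE; rewrite /tmod_br -raddfD /= -owD; try by move=> s a b; rewrite tmulBl.
congr (tmul _ (ow _ _)); apply/funext => s; apply/funext => a.
rewrite -raddfD; congr (tmul _ _); apply: tbrDl => b /=; exact: tactD.
Qed.

Lemma tmod_br_Dr f f' (psi lam lam' chi : {linear A -> A}) c :
    (forall b, chi b = lam b + lam' b) ->
  tmod_br f f' psi chi c = tmod_br f f' psi lam c + tmod_br f f' psi lam' c.
Proof.
move=> chiE; rewrite /tmod_br -raddfD /= -owD; try by move=> s a b; rewrite tmulBl.
congr (tmul _ (ow _ _)); apply/funext => s; apply/funext => a.
by rewrite -raddfD; congr (tmul _ _); apply: tbrDr.
Qed.

End ModuleBracketD.

(** * The involution on braided maps *)

Variable st : A -> A.
Hypotheses (stB : zmod_morphism st) (stZ : forall k a, st (k *: a) = conjc k *: st a).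
Hypotheses (stK : involutive st).
Hypotheses (stH1 : forall a, H1 (st a) = - st (H1 a)) (stH2 : forall a, H2 (st a) = - st (H2 a)).

Lemma st_wt s a : wt_vec s a -> wt_vec (- s) (st a).
Proof.
have conjR (x : R) : conjc x%:C = x%:C by rewrite /conjc /= oppr0.
by case=> a1 a2; split; rewrite ?stH1 ?stH2 ?a1 ?a2 stZ conjR /= rmorphN scaleNr.
Qed.

Definition tstar psi :=
  ow (fun s a_s => - omw (fun r _ b => ph (2 * wedge r s) *: st b) psi (st a_s)).

Section Tstar.
Variable psi : {linear A -> A}.

Let famO s : forall t, add_fam (fun (_ : R * R) b => ph (2 * wedge t s) *: st b).
Proof. by move=> t u a b; rewrite stB scalerBr. Qed.

Let fam : add_fam (fun s a_s => - omw (fun r _ b => ph (2 * wedge r s) *: st b) psi (st a_s)).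
Proof. by move=> s a b; rewrite stB omw_zmod ?opprB 1?addrC ?opprK // => t; apply: famO. Qed.

Lemma tstar_zmod : zmod_morphism (tstar psi).
Proof. exact: ow_zmod. Qed.

Lemma tstar_vec r s a : wt_map r psi -> wt_vec s a ->
  tstar psi a = - (ph (2 * wedge r s) *: st (psi (st a))).
Proof.
move=> rpsi sa; by rewrite /tstar (ow_vec _ sa) // (omw_vec _ rpsi (st_wt sa)).
Qed.

End Tstar.

(** Each starred map carries a minus sign, so a composite of two starred maps carries none while the
    starred bracket carries one. That sign exchanges the two entries. *)
Lemma tbr_star (psi lam psi' lam' : {linear A -> A}) r s :
    wt_map r psi -> wt_map s lam -> wt_map (- r) psi' -> wt_map (- s) lam' ->
    tstar psi =1 psi' -> tstar lam =1 lam' ->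
  tbr lam' psi' =1 tstar (tbr psi lam).
Proof.
move=> rpsi slam rpsi' slam' psiE lamE.
apply: wt_ext => [a b|a b|m a ma]; [exact: raddfB|exact: tstar_zmod|].
rewrite (tstar_vec (tbr_wt_map rpsi slam) ma) /= (tbr_hom slam' rpsi') (tbr_hom rpsi slam).
have psi'm := wt_map_vec rpsi' ma; have lam'm := wt_map_vec slam' ma.
rewrite -(psiE (lam' a)) -(lamE (psi' a)) (tstar_vec rpsi lam'm) (tstar_vec slam psi'm).
rewrite -psiE -lamE (tstar_vec rpsi ma) (tstar_vec slam ma).
have stN := zmod_morphismN stB.
rewrite !(stN, stZ, stK) !(linN psi) !(linN lam) !(linZ lam) !(linZ psi) !(stN, stZ, stB) !phase_conj.
rewrite !scalerN !opprK scalerBr !scalerA -!phaseD opprB.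
by congr (ph _ *: _ - ph _ *: _); rewrite /wedge /=; ring.
Qed.

(** * Doublets, coinvariants and equivariance *)

Variable p : 'I_4 -> A * A.
Variable dw : 'I_4 -> R * R.
Hypothesis gen_ind : forall Q : A -> Prop, (forall k, Q k%:A) ->
  (forall i, Q (p i).1) -> (forall i, Q (p i).2) ->
  (forall a b, Q a -> Q b -> Q (a + b)) -> (forall a b, Q a -> Q b -> Q (a * b)) ->
  forall a, Q a.
Hypothesis p_wt : forall k, wt_vec (dw k) (p k).1 /\ wt_vec (dw k) (p k).2.

Variables (B : comAlgType A) (coact : A -> B) (tid : (A -> A) -> B -> B).
Variable Mon : B -> Prop.
Implicit Types (x y h : B).
Hypotheses (coactB : zmod_morphism coact) (coactM : monoid_morphism coact).
Hypothesis coactC : forall k, coact k%:A = (k%:A)%:A.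
Hypotheses (Mon1 : Mon 1) (MonM : forall h h', Mon h -> Mon h' -> Mon (h * h')).
Hypothesis tidB : forall psi, zmod_morphism psi -> zmod_morphism (tid psi).
Hypothesis tidE : forall psi a h, zmod_morphism psi -> Mon h -> tid psi (a *: h) = psi a *: h.
Hypothesis B_ind : forall Q : B -> Prop, (forall a h, Mon h -> Q (a *: h)) ->
  (forall x y, Q x -> Q y -> Q (x + y)) -> forall x, Q x.
Variables w1 w2 w1s w2s : B.
Hypotheses (Monw1 : Mon w1) (Monw2 : Mon w2) (Monw1s : Mon w1s) (Monw2s : Mon w2s).
Hypothesis w_rel : w1s * w1 + w2s * w2 = 1.

(** The row u is multiplied by the matrix with rows (w1, w2s) and (- w2, w1s). By [w_rel] its
    determinant is one, whence [coinv_det]. *)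
Definition doublet (u : A * A) : Prop :=
  coact u.1 = u.1 *: w1 - u.2 *: w2 /\ coact u.2 = u.1 *: w2s + u.2 *: w1s.
Hypothesis p_doublet : forall k, doublet (p k).

Definition coinv f : Prop := coact f = f%:A.
Definition equiv psi : Prop := forall a, coact (psi a) = tid psi (coact a).

Let coact1 : coact 1 = 1. Proof. by case: coactM. Qed.
Let coact_mul a b : coact (a * b) = coact a * coact b. Proof. by case: coactM. Qed.
Let coactD a b : coact (a + b) = coact a + coact b. Proof. exact: zmod_morphismD. Qed.

Lemma doublet_pair a b :
  coact a = a *: w1 - b *: w2 -> coact b = b *: w1s + a *: w2s -> doublet (a, b).
Proof. by move=> ca cb; split; rewrite // addrC. Qed.

Lemma doublet_oppair a b :
  coact a = a *: w1 + b *: w2 -> coact b = b *: w1s - a *: w2s -> doublet (- a, b).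
Proof.
move=> ca cb; split; last by rewrite /= scaleNr addrC.
by rewrite /= (zmod_morphismN coactB) ca opprD scaleNr.
Qed.

Lemma coactZ k a : coact (k *: a) = k%:A *: coact a.
Proof. by rewrite -[k *: a]mulr_algl coact_mul coactC mulr_algl. Qed.

Lemma tidD psi x y : zmod_morphism psi -> tid psi (x + y) = tid psi x + tid psi y.
Proof. by move=> psiB; apply: (zmod_morphismD (tidB psiB)). Qed.

Lemma tid_comp psi phi x : zmod_morphism psi -> zmod_morphism phi ->
  tid psi (tid phi x) = tid (psi \o phi) x.
Proof.
move=> psiB phiB; have cB : zmod_morphism (psi \o phi) by move=> a b; rewrite /= phiB psiB.
elim/B_ind: x => [a h Mh|x y Ex Ey]; first by rewrite !tidE.
by rewrite !tidD // Ex Ey.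
Qed.

Lemma tid_mull f psi phi x : zmod_morphism psi -> zmod_morphism phi ->
  (forall a, psi a = f * phi a) -> tid psi x = f *: tid phi x.
Proof.
move=> psiB phiB E; elim/B_ind: x => [a h Mh|x y Ex Ey].
  by rewrite !tidE // E scalerA.
by rewrite !tidD // Ex Ey scalerDr.
Qed.

Lemma tid_id x : tid id x = x.
Proof. by elim/B_ind: x => [a h Mh|x y Ex Ey]; rewrite ?tidE ?tidD ?Ex ?Ey. Qed.

Inductive wt_tensor s : B -> Prop :=
| WtTensor a h of wt_vec s a & Mon h : wt_tensor s (a *: h)
| WtTensorD x y of wt_tensor s x & wt_tensor s y : wt_tensor s (x + y).

Lemma wt_tensorM s t x y : wt_tensor s x -> wt_tensor t y -> wt_tensor (s + t) (x * y).
Proof.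
elim=> [a h sa Mh|x1 x2 _ IH1 _ IH2 ty]; last first.
  by rewrite mulrDl; apply: WtTensorD; [apply: IH1|apply: IH2].
elim=> [b k tb Mk|y1 y2 _ IH1 _ IH2]; last by rewrite mulrDr; apply: WtTensorD.
by rewrite -scalerAl -scalerAr scalerA; apply: WtTensor; [apply: wt_vecM|apply: MonM].
Qed.

Lemma tid_ext s psi phi x : zmod_morphism psi -> zmod_morphism phi ->
  (forall a, wt_vec s a -> psi a = phi a) -> wt_tensor s x -> tid psi x = tid phi x.
Proof.
move=> psiB phiB E; elim=> [a h sa Mh|y z _ Ey _ Ez]; first by rewrite !tidE // E.
by rewrite !tidD // Ey Ez.
Qed.

(** The two entries of a pair have the same weight, so the coaction, which mixes only them, keeps
    generators and hence their products in their weight. *)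
Let hom_ind (Q : A -> Prop) :
    (forall s a, wt_vec s a -> wt_tensor s (coact a) -> Q a) ->
  (forall a b, Q a -> Q b -> Q (a + b)) -> forall a, Q a.
Proof.
move=> QG QD; apply: (graded_ind (G := fun s a => wt_vec s a /\ wt_tensor s (coact a)) gen_ind) => //.
- move=> k; split; first exact: wt_vecC.
  by rewrite coactC; apply: WtTensor => //; apply: wt_vecC.
- move=> s t a b [sa sta] [tb ttb]; split; first exact: wt_vecM.
  by rewrite coact_mul; apply: wt_tensorM.
- move=> k; exists (dw k); have [k1 k2] := p_wt k; have [-> ->] := p_doublet k.
  split; split => //; apply: WtTensorD; try exact: WtTensor.
  by rewrite -scaleNr; apply: WtTensor => //; apply: wt_vecN.
by move=> s a [sa ta]; apply: QG sa ta.
Qed.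

Lemma equiv_scalars (F : R * R -> C) (psi : {linear A -> A}) :
  (forall s a, wt_vec s a -> psi a = F s *: a) -> equiv psi.
Proof.
move=> psiE; have psiB : zmod_morphism psi by exact: raddfB.
elim/hom_ind => [s a sa ta|a b Ea Eb]; last by rewrite raddfD !coactD Ea Eb tidD.
rewrite (psiE _ _ sa) coactZ -[in LHS](tid_id (coact a)).
have kB : zmod_morphism (fun a : A => (F s)%:A * a) by move=> b c; rewrite mulrBr.
rewrite -(tid_mull (psi := fun a => (F s)%:A * a)) //.
by apply: tid_ext ta => // b sb; rewrite (psiE _ _ sb) mulr_algl.
Qed.

Lemma equiv_rot v : equiv (rot v).
Proof. by apply: (@equiv_scalars (fun s => ph (wedge s v))) => s a; apply: rot_vec. Qed.

Definition wt_proj s := ow (fun t a => (t == s)%:R *: a).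

Lemma wt_proj_vec s t a : wt_vec t a -> wt_proj s a = (t == s)%:R *: a.
Proof. by apply: ow_vec => u b c; rewrite scalerBr. Qed.

Fact wt_proj_linear s : linear (wt_proj s).
Proof. by apply: ow_linear => t k a b; rewrite scalerDr !scalerA mulrC. Qed.

HB.instance Definition _ s := GRing.isLinear.Build C A A *:%R (wt_proj s) (wt_proj_linear s).

Lemma equiv_wt_proj s : equiv (wt_proj s).
Proof. by apply: (@equiv_scalars (fun t => (t == s)%:R)) => t a; apply: wt_proj_vec. Qed.

Lemma wt_proj_wt s a : wt_vec s (wt_proj s a).
Proof.
elim/wt_ind: a => [t a ta|a b ha hb]; last by rewrite raddfD; apply: wt_vecD.
rewrite (wt_proj_vec _ ta); have [<-|_] := eqVneq t s; rewrite ?scale1r ?scale0r //.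
exact: wt_vec0.
Qed.

(** Induction by [hom_ind] reaches only a spanning set of weight vectors. Writing a as its own
    projection, which is equivariant, handles every weight vector. *)
Lemma coact_wt s a : wt_vec s a -> wt_tensor s (coact a).
Proof.
move=> sa; have <- : wt_proj s a = a by rewrite (wt_proj_vec _ sa) eqxx scale1r.
rewrite equiv_wt_proj; have PB : zmod_morphism (wt_proj s) by exact: raddfB.
elim/B_ind: (coact a) => [b h Mh|x y tx ty]; last by rewrite tidD //; apply: WtTensorD.
by rewrite tidE //; apply: WtTensor => //; apply: wt_proj_wt.
Qed.

Lemma coinv_equiv psi f : zmod_morphism psi -> equiv psi -> coinv f -> coinv (psi f).
Proof. by move=> psiB psiE Cf; rewrite /coinv psiE Cf tidE. Qed.

Lemma coinv0 : coinv 0. Proof. by rewrite /coinv scale0r; apply: zmod_morphism0. Qed.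
Lemma coinvD f g : coinv f -> coinv g -> coinv (f + g).
Proof. by rewrite /coinv coactD scalerDl => -> ->. Qed.
Lemma coinvB f g : coinv f -> coinv g -> coinv (f - g).
Proof. by rewrite /coinv coactB scalerBl => -> ->. Qed.
Lemma coinvZ k f : coinv f -> coinv (k *: f).
Proof. by rewrite /coinv coactZ => ->; rewrite scalerA mulr_algl. Qed.
Lemma coinv_rot v f : coinv f -> coinv (rot v f).
Proof. by apply: coinv_equiv (equiv_rot v) => a b; rewrite rotB. Qed.

(** Weight projections are equivariant, so they map coinvariants to coinvariants. *)
Lemma coinv_ind (Q : A -> Prop) : (forall s f, wt_vec s f -> coinv f -> Q f) ->
  (forall f g, Q f -> Q g -> Q (f + g)) -> forall f, coinv f -> Q f.
Proof.
move=> QG QD f Cf.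
suff [l fE] : exists l, f = \sum_(s <- l) wt_proj s f.
  rewrite fE; elim/big_ind: _ => [||s _].
  - exact: (QG 0 0 (wt_vec0 _) coinv0).
  - exact: QD.
  by apply: QG (wt_proj_wt s f) _; apply: coinv_equiv Cf; [exact: raddfB|exact: equiv_wt_proj].
(* Allowing every larger list of weights makes the claim stable under sums: the lists of two
   summands can be merged. *)
suff [l [lu lE]] : exists l, uniq l /\ forall l', uniq l' -> {subset l <= l'} ->
    f = \sum_(s <- l') wt_proj s f by exists l; apply: lE.
elim/wt_ind: f {Cf} => [s a sa|a b [l [lu lE]] [k [ku kE]]].
  exists [:: s]; split=> // l lu sl.
  rewrite (bigD1_seq s) //=; last by apply: sl; rewrite inE.
  rewrite (wt_proj_vec _ sa) eqxx scale1r big1 ?addr0 // => t ts.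
  by rewrite (wt_proj_vec _ sa) eq_sym (negPf ts) scale0r.
exists (undup (l ++ k)); split=> [|l' l'u sub]; first exact: undup_uniq.
under eq_bigr do rewrite raddfD.
rewrite big_split /= -lE -?kE // => s sl; apply: sub; rewrite mem_undup mem_cat sl ?orbT //.
Qed.

Lemma equiv_tD (psi : {linear A -> A}) : equiv psi -> equiv (tD psi).
Proof.
move=> psiE; have dB : zmod_morphism (tD psi) by exact: raddfB.
elim/wt_ind => [s a sa|a b Ea Eb]; last by rewrite raddfD !coactD Ea Eb tidD.
have rB v : zmod_morphism (rot v) by move=> b c; rewrite rotB.
have psiB : zmod_morphism psi by exact: raddfB.
rewrite (tD_vecr _ sa) equiv_rot psiE tid_comp //.
apply: (tid_ext _ _ _ (coact_wt sa)) => // [b c|b sb /=]; first by rewrite /= raddfB rotB.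
by rewrite (tD_vecr _ sb).
Qed.

Lemma equiv_untwist (psi : {linear A -> A}) : equiv psi -> equiv (untwist psi).
Proof.
move=> psiE; have dB : zmod_morphism (untwist psi) by exact: raddfB.
elim/wt_ind => [s a sa|a b Ea Eb]; last by rewrite raddfD !coactD Ea Eb tidD.
have rB v : zmod_morphism (rot v) by move=> b c; rewrite rotB.
have psiB : zmod_morphism psi by exact: raddfB.
rewrite (untwist_vec _ sa) equiv_rot psiE tid_comp //.
apply: (tid_ext _ _ _ (coact_wt sa)) => // [b c|b sb /=]; first by rewrite /= raddfB rotB.
by rewrite (untwist_vec _ sb).
Qed.

Lemma equiv_mul f psi : coinv f -> zmod_morphism psi -> equiv psi -> equiv (fun a => f * psi a).
Proof.
move=> Cf psiB psiE a; rewrite coact_mul Cf psiE mulr_algl.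
by rewrite (tid_mull (psi := fun a => f * psi a) (f := f) (phi := psi)) // => b c; rewrite psiB mulrBr.
Qed.

Lemma equivD psi phi : zmod_morphism psi -> zmod_morphism phi -> equiv psi -> equiv phi ->
  equiv (fun a => psi a + phi a).
Proof.
move=> psiB phiB psiE phiE a; rewrite coactD psiE phiE.
have sB : zmod_morphism (fun a => psi a + phi a) by move=> b c; rewrite psiB phiB subrDD.
elim/B_ind: (coact a) => [b h Mh|x y Ex Ey]; first by rewrite !tidE // scalerDl.
by rewrite !tidD // -Ex -Ey addrACA.
Qed.

Lemma equivZ k psi : zmod_morphism psi -> equiv psi -> equiv (fun a => k *: psi a).
Proof.
move=> psiB psiE a; rewrite coactZ psiE.
by rewrite (tid_mull (psi := fun a => k *: psi a) (f := k%:A) (phi := psi)) // => [b c|b];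
  rewrite ?psiB ?scalerBr ?mulr_algl.
Qed.

Lemma equiv_sum (I : Type) (r : seq I) (F : I -> A -> A) :
    (forall i, zmod_morphism (F i)) -> (forall i, equiv (F i)) ->
  equiv (fun a => \sum_(i <- r) F i a).
Proof.
move=> FB FE; elim: r => [a|i r IH].
  have zB : zmod_morphism (fun a : A => \sum_(i <- [::]) F i a) by move=> b c; rewrite !big_nil subr0.
  rewrite big_nil (zmod_morphism0 coactB); elim/B_ind: (coact a) => [b h Mh|x y Ex Ey].
    by rewrite tidE // big_nil scale0r.
  by rewrite tidD // -Ex -Ey addr0.
rewrite (_ : (fun _ => _) = fun a => F i a + \sum_(j <- r) F j a); last first.
  by apply/funext => a; rewrite big_cons.
by apply: equivD => // b c; rewrite -sumrB; apply: eq_bigr => j _; apply: FB.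
Qed.

Definition det (u v : A * A) : A := u.1 * v.2 - u.2 * v.1.

Lemma coinv_det (u v : A * A) : doublet u -> doublet v -> coinv (det u v).
Proof.
move=> [u1 u2] [v1 v2]; rewrite /coinv /det coactB !coact_mul u1 u2 v1 v2.
have alg a : a%:A = GRing.in_alg B a by [].
rewrite -![_ *: w1]mulr_algl -![_ *: w2]mulr_algl -![_ *: w1s]mulr_algl -![_ *: w2s]mulr_algl.
rewrite !alg rmorphB !rmorphM /= -[RHS]mulr1 -w_rel.
by move: (u.1%:A : B) (u.2%:A : B) (v.1%:A : B) (v.2%:A : B) => a b c d; ring.
Qed.

Lemma doublet_map psi (u : A * A) : zmod_morphism psi -> equiv psi -> doublet u ->
  doublet (psi u.1, psi u.2).
Proof.
move=> psiB psiE [u1 u2]; have tB := tidB psiB.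
by split; rewrite /= psiE ?u1 ?u2 ?(tB (_ *: _)) ?tidD // !tidE.
Qed.

Definition pscale f (u : A * A) : A * A := (f * u.1, f * u.2).

Lemma doublet_scale f (u : A * A) : coinv f -> doublet u -> doublet (pscale f u).
Proof.
by move=> Cf [u1 u2]; split; rewrite /= coact_mul Cf ?u1 ?u2 mulr_algl ?scalerBr ?scalerDr !scalerA.
Qed.

Lemma doubletD (u v : A * A) : doublet u -> doublet v -> doublet (u + v).
Proof.
move=> [u1 u2] [v1 v2]; split; rewrite /= coactD ?u1 ?u2 ?v1 ?v2 !scalerDl ?opprD //.
  by rewrite addrACA.
by rewrite addrACA.
Qed.

Lemma derivation_along_ext (M : comNzRingType) (e : A -> M) D E :
    derivation_along e D -> derivation_along e E ->
    (forall k, D (p k).1 = E (p k).1) -> (forall k, D (p k).2 = E (p k).2) ->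
  D =1 E.
Proof.
case=> DB DC DM [EB EC EM] DE1 DE2.
elim/gen_ind => // [k|a b Da Db|a b Da Db]; first by rewrite DC EC.
  by rewrite (zmod_morphismD DB) (zmod_morphismD EB) Da Db.
by rewrite DM EM Da Db.
Qed.

(** The map D (x) id is itself a derivation, so both sides of the equivariance condition are
    derivations along the coaction and are compared on the pairs only. *)
Lemma equiv_derivation D : derivation D ->
  (forall k, doublet (D (p k).1, D (p k).2)) -> equiv D.
Proof.
move=> dD DP; have [DB DC DM] := dD.
have tM x y : tid D (x * y) = tid D x * y + x * tid D y.
  elim/B_ind: x => [a h Mh|x1 x2 E1 E2]; last by rewrite mulrDl !tidD // E1 E2 !mulrDl addrACA.
  elim/B_ind: y => [b k Mk|y1 y2 E1 E2]; last by rewrite mulrDr !tidD // E1 E2 !mulrDr addrACA.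
  rewrite -scalerAl -scalerAr scalerA !tidE //; last exact: MonM.
  by rewrite DM scalerDl -!scalerAl -!scalerAr !scalerA.
apply: (derivation_along_ext (e := coact)) => [||k|k].
- split=> [a b|k|a b]; first by rewrite DB coactB.
  + by rewrite DC; apply: zmod_morphism0.
  by rewrite DM coactD !coact_mul.
- split=> [a b|k|a b]; first by rewrite coactB tidB.
  + by rewrite coactC tidE // DC scale0r.
  by rewrite coact_mul tM.
- have [-> _] := DP k; have [-> _] := p_doublet k.
  by rewrite tidB // !tidE.
- have [_ ->] := DP k; have [_ ->] := p_doublet k.
  by rewrite tidD // !tidE.
Qed.

Lemma derivation_wt_map r D : derivation D ->
    (forall k, wt_vec (r + dw k) (D (p k).1) /\ wt_vec (r + dw k) (D (p k).2)) ->
  wt_map r D.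
Proof.
move=> dD Dp; have dZ k := derivationZ k dD.
have E1 := derivation_along_ext (derivation_comm H1_deriv dD) (dZ (r.1)%:C).
have E2 := derivation_along_ext (derivation_comm H2_deriv dD) (dZ (r.2)%:C).
move=> a; split; [apply: E1|apply: E2] => k.
all: have [[x1 x2] [y1 y2]] := p_wt k; have [[u1 u2] [v1 v2]] := Dp k.
all: rewrite ?u1 ?u2 ?v1 ?v2 ?x1 ?x2 ?y1 ?y2 (derivation_scale dD).
all: by rewrite -scalerBl rmorphD addrK.
Qed.

(** * The vertical fields V_ij and their commutators *)

Variables T1 T2 T3 : A -> A.
Hypotheses (dT1 : derivation T1) (dT2 : derivation T2) (dT3 : derivation T3).
Hypothesis T1p : forall k, T1 (p k).1 = (p k).1 /\ T1 (p k).2 = - (p k).2.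
Hypothesis T2p : forall k, T2 (p k).1 = - (p k).2 *+ 2 /\ T2 (p k).2 = 0.
Hypothesis T3p : forall k, T3 (p k).1 = 0 /\ T3 (p k).2 = (p k).1 *+ 2.
Hypothesis T_coinv : forall f, coinv f -> [/\ T1 f = 0, T2 f = 0 & T3 f = 0].

Section Vertical.
Variables i j : 'I_4.

Definition vfield a : A :=
  ((p i).1 * (p j).2 + (p i).2 * (p j).1) * T1 a
  + (p i).1 * (p j).1 * T2 a + (p i).2 * (p j).2 * T3 a.

Lemma vfield_derivation : derivation vfield.
Proof. by apply: derivationD; [apply: derivationD|]; apply: derivationM. Qed.

Fact vfield_linear : linear vfield. Proof. exact: (derivation_linear vfield_derivation). Qed.
HB.instance Definition _ := GRing.isLinear.Build C A A *:%R vfield vfield_linear.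

Lemma vfield_p k : vfield (p k).1 = det (p k) (p i) * (p j).1 + det (p k) (p j) * (p i).1
           /\ vfield (p k).2 = det (p k) (p i) * (p j).2 + det (p k) (p j) * (p i).2.
Proof.
have [a1 a2] := T1p k; have [b1 b2] := T2p k; have [c1 c2] := T3p k.
by split; rewrite /vfield /det ?a1 ?a2 ?b1 ?b2 ?c1 ?c2; ring.
Qed.

Lemma vfield_coinv f : coinv f -> vfield f = 0.
Proof. by move=> /T_coinv[t1 t2 t3]; rewrite /vfield t1 t2 t3 !mulr0 !addr0. Qed.

Lemma vfield_det k l : vfield (det (p k) (p l)) = 0.
Proof. exact/vfield_coinv/coinv_det. Qed.

Lemma vfield_equiv : equiv vfield.
Proof.
apply: equiv_derivation vfield_derivation _ => k; have [-> ->] := vfield_p k.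
apply: (doubletD (u := pscale _ _) (v := pscale _ _)); apply: doublet_scale => //; exact: coinv_det.
Qed.

Lemma vfield_wt_map : wt_map (dw i + dw j) vfield.
Proof.
apply: derivation_wt_map vfield_derivation _ => k; have [-> ->] := vfield_p k.
have det_wt (l m : 'I_4) : wt_vec (dw l + dw m) (det (p l) (p m)).
  have [l1 l2] := p_wt l; have [m1 m2] := p_wt m.
  by apply: wt_vecD; [|apply: wt_vecN]; apply: wt_vecM.
have [i1 i2] := p_wt i; have [j1 j2] := p_wt j.
have Ei : dw i + dw j + dw k = dw k + dw i + dw j by rewrite addrC addrA.
have Ej : dw i + dw j + dw k = dw k + dw j + dw i by rewrite Ei addrAC.
by split; (apply: wt_vecD; [rewrite Ei|rewrite Ej]; apply: wt_vecM).
Qed.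

End Vertical.

(** Both sides are derivations, and the determinants in [vfield_p] behave as constants for every
    V_ij; on a pair this leaves a polynomial identity in the entries. *)
Lemma vfield_bracket (i j l m : 'I_4) a : vfield i j (vfield l m a) - vfield l m (vfield i j a) =
  det (p m) (p i) * vfield l j a + det (p m) (p j) * vfield l i a
  + det (p l) (p i) * vfield m j a + det (p l) (p j) * vfield m i a.
Proof.
move: a; apply: (derivation_along_ext (e := id)) => [||k|k].
- exact: derivation_comm (vfield_derivation _ _) (vfield_derivation _ _).
- by do 3?[apply: derivationD]; apply: derivationM; apply: vfield_derivation.
all: have VB (u v : 'I_4) : zmod_morphism (vfield u v) by exact: raddfB.
all: have VM (u v n : 'I_4) b : vfield u v (det (p k) (p n) * b) = det (p k) (p n) * vfield u v b
  by case: (vfield_derivation u v) => _ _ ->; rewrite vfield_det mul0r add0r.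
all: have Vk (u v n : 'I_4) := vfield_p u v n.
- rewrite !(proj1 (Vk _ _ _)) !(zmod_morphismD (VB _ _)) !VM !(proj1 (Vk _ _ _)) /det; ring.
- rewrite !(proj2 (Vk _ _ _)) !(zmod_morphismD (VB _ _)) !VM !(proj2 (Vk _ _ _)) /det; ring.
Qed.

Local Notation s2 := (sqrt2 R).

(** The ten pairs i <= j account for the ten generators: V_ij has weight [dw i + dw j], which
    vanishes exactly for {1, 2} and {3, 4}, the two pairs that make up K_1 and K_2. The constants
    are those for which [gderE] holds. *)
Definition gen_terms (g : gen) : seq (C * 'I_4 * 'I_4) :=
  match g with
  | K1 => [:: (1, i3, i4); (-1, i1, i2)]
  | K2 => [:: (1, i1, i2); (1, i3, i4)]
  | W10 => [:: (- s2, i1, i4)]  | Wm10 => [:: (- s2, i2, i3)]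
  | W01 => [:: (s2, i2, i4)]    | W0m1 => [:: (- s2, i1, i3)]
  | W11 => [:: (-1, i4, i4)]    | Wm1m1 => [:: (1, i3, i3)]
  | W1m1 => [:: (1, i1, i1)]    | Wm11 => [:: (-1, i2, i2)]
  end.

Definition lincomb (ts : seq (C * 'I_4 * 'I_4)) a :=
  \sum_(t <- ts) t.1.1 *: vfield t.1.2 t.2 a.

Lemma lincomb_derivation ts : derivation (lincomb ts).
Proof.
rewrite /lincomb; elim: ts => [|t ts IH].
  rewrite (_ : (fun _ => _) = fun _ => 0); first exact: derivation0.
  by apply/funext => a; rewrite big_nil.
rewrite (_ : (fun _ => _) = fun a => t.1.1 *: vfield t.1.2 t.2 a + lincomb ts a).
  by apply: derivationD => //; apply: derivationZ (vfield_derivation _ _).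
by apply/funext => a; rewrite big_cons.
Qed.

Definition gfield g := lincomb (gen_terms g).

Lemma gfield_derivation g : derivation (gfield g). Proof. exact: lincomb_derivation. Qed.

Fact gfield_linear g : linear (gfield g). Proof. exact: derivation_linear (gfield_derivation g). Qed.
HB.instance Definition _ g := GRing.isLinear.Build C A A *:%R (gfield g) (gfield_linear g).

Lemma gfield_coinv g f : coinv f -> gfield g f = 0.
Proof. by move=> Cf; rewrite /gfield /lincomb big1 // => t _; rewrite vfield_coinv ?scaler0. Qed.

Lemma gfield_equiv g : equiv (gfield g).
Proof.
apply: equiv_sum => t; first by move=> a b; rewrite raddfB scalerBr.
by apply: equivZ (vfield_equiv _ _) => a b; rewrite raddfB.
Qed.

Hypotheses (dw1 : dw i1 = (2^-1, - 2^-1)) (dw2 : dw i2 = (- 2^-1, 2^-1)).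
Hypotheses (dw3 : dw i3 = (- 2^-1, - 2^-1)) (dw4 : dw i4 = (2^-1, 2^-1)).
Local Notation gw := (gen_weight R).

Let pairE (x y z t : R) : x = z -> y = t -> (x, y) = (z, t). Proof. by move=> -> ->. Qed.

Lemma gfield_wt_map g : wt_map (gw g) (gfield g).
Proof.
apply: wt_mapP => s a sa; rewrite /= /gfield /lincomb.
have Vw i j r : dw i + dw j = r -> wt_vec (r + s) (vfield i j a).
  by move=> <-; apply: wt_map_vec (vfield_wt_map i j) sa.
case: g; rewrite !big_cons big_nil /= addr0; do ?[apply: wt_vecD]; apply/wt_vecZ/Vw;
  by rewrite ?dw1 ?dw2 ?dw3 ?dw4; apply: pairE => /=; field.
Qed.

Definition vfield_comm (t u : C * 'I_4 * 'I_4) a : A :=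
  (t.1.1 * u.1.1) *: (det (p u.2) (p t.1.2) * vfield u.1.2 t.2 a + det (p u.2) (p t.2) * vfield u.1.2 t.1.2 a
  + det (p u.1.2) (p t.1.2) * vfield u.2 t.2 a + det (p u.1.2) (p t.2) * vfield u.2 t.1.2 a).

Lemma gfield_bracket (g h : gen) a : gfield g (gfield h a) - gfield h (gfield g a) =
  \sum_(t <- gen_terms g) \sum_(u <- gen_terms h) vfield_comm t u a.
Proof.
rewrite /gfield /lincomb [X in _ - X](eq_bigr (fun u : C * 'I_4 * 'I_4 => \sum_(t <- gen_terms g)
    u.1.1 *: vfield u.1.2 u.2 (t.1.1 *: vfield t.1.2 t.2 a))); last first.
  by move=> u _; rewrite raddf_sum scaler_sumr.
rewrite exchange_big -sumrB; apply: eq_bigr => t _.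
rewrite raddf_sum scaler_sumr -sumrB; apply: eq_bigr => u _.
by rewrite /= !(linZ (vfield _ _)) !scalerA [u.1.1 * _]mulrC -scalerBr vfield_bracket.
Qed.

Definition tgen g := tD (gfield g).
HB.instance Definition _ g := GRing.Linear.copy (tgen g) (tD (gfield g)).

Lemma tgen_wt_map g : wt_map (gw g) (tgen g).
Proof. exact/tD_wt_map/gfield_wt_map. Qed.

Lemma tgenE g a : tgen g a = gfield g (rot (gw g) a).
Proof. exact: (tD_hom (gfield_wt_map g)). Qed.

(* Each term (c, d, m, f, l) of ts stands for c f K_l, with f of weight m; d  *)
(* is c up to the phase picked up in the twist.                               *)
Lemma tbr_gens (g h : gen) (ts : seq (C * C * (R * R) * A * gen)) :
    foldr (fun e P => [/\ wt_vec e.1.1.2 e.1.2,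
      e.1.1.1.2 = e.1.1.1.1 * ph (wedge e.1.1.2 (gw e.2) - wedge (gw g) (gw h)) & P]) True ts ->
    (forall a, gfield g (gfield h a) - gfield h (gfield g a) = \sum_(t <- ts) t.1.1.1.1 *: (t.1.2 * gfield t.2 a)) ->
  forall a, tbr (tgen g) (tgen h) a = \sum_(t <- ts) t.1.1.1.2 *: tmul t.1.2 (tgen t.2 a).
Proof.
move=> tsP KE; pose chi := HB.pack_for {linear A -> A} (fun a => gfield g (gfield h a) - gfield h (gfield g a))
  (GRing.isLinear.Build C A A *:%R _ (derivation_linear (derivation_comm (gfield_derivation g) (gfield_derivation h)))).
move=> a; rewrite (tbr_tD (chi := chi) (gfield_wt_map g) (gfield_wt_map h)) //; move: a.
apply: wt_ext => [a b|a b|s a sa].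
- by rewrite -scalerBr; congr (_ *: _); apply: raddfB.
- by rewrite -sumrB; apply: eq_bigr => t _; rewrite !raddfB.
rewrite (tD_vecr _ sa) /= KE raddf_sum scaler_sumr.
elim: ts tsP {KE chi} => [|t ts IH] /=; first by rewrite !big_nil.
case=> mf cE tsP; rewrite !big_cons IH // cE; congr (_ + _).
(* Twisting f K_l, with f of weight m, yields the twisted product of f with the twisted K_l times
   the phase of m /\ l. *)
rewrite rotZ scalerA rotM (rot_vec _ mf) (tmul_vecl _ mf) /tgen (tD_vecr _ sa).
have ls := wt_map_vec (gfield_wt_map t.2) sa.
rewrite rotD !(rot_vec _ ls) -scalerAl -!scalerAr !scalerA.
congr (_ *: _); rewrite [ph _ * t.1.1.1.1]mulrC -!mulrA -!phaseD; congr (_ * ph _).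
by rewrite /wedge /=; ring.
Qed.

(** The coordinates of S^4 written as determinants of doublets; on the sphere they become [xS4],
    [alpha], [beta] and the conjugates of the last two. *)
Definition xx : A := det (p i1) (p i2) - det (p i3) (p i4).
Definition al : A := det (p i1) (p i4) *+ 2.
Definition be : A := - det (p i2) (p i4) *+ 2.
Definition als : A := - det (p i2) (p i3) *+ 2.
Definition bes : A := - det (p i1) (p i3) *+ 2.

Let det_wt r k l : dw k + dw l = r -> wt_vec r (det (p k) (p l)).
Proof.
move=> <-; have [k1 k2] := p_wt k; have [l1 l2] := p_wt l.
by apply: wt_vecD; [|apply: wt_vecN]; apply: wt_vecM.
Qed.

Let h2 : 2^-1 + 2^-1 = 1 :> R. Proof. by field. Qed.

Lemma xx_wt : wt_vec (0, 0) xx.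
Proof.
apply: wt_vecD; [|apply: wt_vecN]; apply: det_wt; rewrite ?dw1 ?dw2 ?dw3 ?dw4.
  by apply: pairE; rewrite /= ?subrr ?addNr.
by apply: pairE; rewrite /= ?subrr ?addNr.
Qed.

Let wt_vec2 r a : wt_vec r a -> wt_vec r (a *+ 2).
Proof. by rewrite -scaler_nat; apply: wt_vecZ. Qed.

Lemma al_wt : wt_vec (1, 0) al.
Proof.
by apply/wt_vec2/det_wt; rewrite dw1 dw4; apply: pairE; rewrite /= ?h2 ?addNr.
Qed.

Lemma be_wt : wt_vec (0, 1) be.
Proof.
by apply/wt_vec2/wt_vecN/det_wt; rewrite dw2 dw4; apply: pairE; rewrite /= ?h2 ?addNr.
Qed.

Lemma als_wt : wt_vec (-1, 0) als.
Proof.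
apply/wt_vec2/wt_vecN/det_wt; rewrite dw2 dw3; apply: pairE; rewrite /= ?subrr //.
by rewrite -opprD h2.
Qed.

Lemma bes_wt : wt_vec (0, -1) bes.
Proof.
apply/wt_vec2/wt_vecN/det_wt; rewrite dw1 dw3; apply: pairE; rewrite /= ?subrr //.
by rewrite -opprD h2.
Qed.

Let s2s2 : s2 * s2 = 2.
Proof.
by rewrite /sqrt2 -rmorphM -expr2 sqr_sqrtr ?ler0n // rmorph_nat.
Qed.

Let alg (k : C) : A := k%:A.
Let algE k a : k *: a = alg k * a. Proof. by rewrite /alg mulr_algl. Qed.

Let algM k l : alg (k * l) = alg k * alg l.
Proof. by rewrite -[LHS]/(GRing.in_alg A (k * l)) rmorphM. Qed.
Let alg2 : alg 2 = 2.
Proof. by rewrite -[LHS]/(GRing.in_alg A 2) rmorph_nat. Qed.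

Local Notation q := (ph 1).
Let ph_q0 (e : R) : e = 0 -> ph e = 1. Proof. by move=> ->; rewrite phase0. Qed.
Let ph_q1 (e : R) : e = 1 -> ph e = q. Proof. by move=> ->. Qed.
Let ph_qN1 (e : R) : e = -1 -> ph e = q^-1. Proof. by move=> ->; rewrite phaseN. Qed.
Let ph_q2 (e : R) : e = 2 -> ph e = q ^+ 2. Proof. by move=> ->; rewrite phase_natl. Qed.
Let ph_qN2 (e : R) : e = - 2 -> ph e = q ^- 2. Proof. by move=> ->; rewrite phaseN phase_natl. Qed.

(** The exponents m /\ l - r /\ s occurring in the table lie among 0, 1, -1, 2, -2; the one that
    [ring] confirms is selected. *)
Ltac phase_tac :=
  rewrite /=; first [ rewrite [in RHS]ph_q0; last (rewrite /wedge /=; ring)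
                    | rewrite [in RHS]ph_q1; last (rewrite /wedge /=; ring)
                    | rewrite [in RHS]ph_qN1; last (rewrite /wedge /=; ring)
                    | rewrite [in RHS]ph_q2; last (rewrite /wedge /=; ring)
                    | rewrite [in RHS]ph_qN2; last (rewrite /wedge /=; ring) ];
  rewrite ?(mulr1, mulNr) //.

(** A classical commutator, expanded over the V_ij, is a polynomial identity in the entries of the
    four pairs and the values of the three infinitesimal generators. The square of [s2] is replaced
    by 2 beforehand, since afterwards [s2] is a free variable. *)
Ltac comm_tac :=
  let a := fresh "a" in move=> a; rewrite gfield_bracket /gfield /lincomb /vfield_comm !(big_cons, big_nil) /= !addr0;
  rewrite -?scalerAr ?scalerA ?(mulrN, mulNr, mulr1, mul1r, s2s2) ?opprK;
  rewrite ?(scaleNr, scale1r, scaler_nat) ?algE ?(algM, alg2) /xx /al /be /als /bes /vfield /det;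
  move: (p i1) (p i2) (p i3) (p i4) (T1 a) (T2 a) (T3 a) (alg s2)
    => [x1 y1] [x2 y2] [x3 y3] [x4 y4] t1 t2 t3 e /=; ring.

Hypothesis norm1 : det (p i1) (p i2) + det (p i3) (p i4) = 1.

(** * Generation of aut by the twisted generators *)

Definition taut psi : Prop :=
  [/\ tbraided psi, equiv psi & forall f, coinv f -> psi f = 0].

Section Gens.
Variable f : gen -> A.

Definition gcomb (r : seq gen) a := \sum_(g <- r) rot (- gw g) (f g) * gfield g a.
Definition tcomb (r : seq gen) a := \sum_(g <- r) tmul (f g) (tgen g a).

Lemma gcomb_derivation (r : seq gen) : derivation (gcomb r).
Proof.
elim: r => [|g r IH].
  rewrite (_ : gcomb _ = fun _ => 0); first exact: derivation0.
  by apply/funext => a; rewrite /gcomb big_nil.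
rewrite (_ : gcomb _ = fun a => rot (- gw g) (f g) * gfield g a + gcomb r a).
  by apply: derivationD => //; apply: derivationM (gfield_derivation _).
by apply/funext => a; rewrite /gcomb big_cons.
Qed.

Fact gcomb_linear (r : seq gen) : linear (gcomb r).
Proof. exact: derivation_linear (gcomb_derivation r). Qed.
HB.instance Definition _ (r : seq gen) := GRing.isLinear.Build C A A *:%R (gcomb r) (gcomb_linear r).

(** The rotation of the coefficients in [gcomb] compensates the phase of m /\ l created by twisting
    f K_l. *)
Lemma tD_gcomb (r : seq gen) : tD (gcomb r) =1 tcomb r.
Proof.
apply: wt_ext => [a b|a b|s a sa]; first exact: raddfB.
  by rewrite -sumrB; apply: eq_bigr => g _; rewrite !raddfB.
rewrite (tD_vecr _ sa) raddf_sum; apply: eq_bigr => g _.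
rewrite /= rotM /tgen (tD_vecr _ sa) rotD.
rewrite (tmul_vecr _ (rot_wt _ (wt_map_vec (gfield_wt_map g) sa))).
by rewrite opprD addrC.
Qed.

Lemma taut_tcomb (r : seq gen) : (forall g, coinv (f g)) -> taut (tcomb r).
Proof.
move=> Cf; rewrite -(funext (tD_gcomb r)); split.
- exact: tD_braided (gcomb_derivation r).
- apply: equiv_tD; apply: equiv_sum => g; first by move=> a b; rewrite raddfB mulrBr.
  apply: equiv_mul (gfield_equiv g); last by move=> a b; rewrite raddfB.
  exact: coinv_rot.
move=> c Cc; rewrite tD_gcomb /tcomb big1 // => g _.
by rewrite tgenE gfield_coinv ?raddf0 //; apply: coinv_rot.
Qed.

End Gens.

Section Generation.
Variable psi : {linear A -> A}.
Hypothesis psi_taut : taut psi.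

Let Y := untwist psi.
Let v k := Y (p k).1.
Let v' k := Y (p k).2.

Let dY : derivation Y. Proof. by case: psi_taut => Bpsi _ _; apply: untwist_derivation. Qed.

Let YB : zmod_morphism Y. Proof. by case: dY. Qed.
Let YM a b : Y (a * b) = Y a * b + a * Y b. Proof. by case: dY. Qed.

Let Yv k : doublet (v k, v' k).
Proof. by apply: doublet_map => //; apply: equiv_untwist; case: psi_taut. Qed.

Let Ydet (k l : 'I_4) : Y (det (p k) (p l)) = 0.
Proof.
rewrite /Y (untwist_vec _ (det_wt (erefl _))); case: psi_taut => _ _ ->.
  by rewrite raddf0.
exact: coinv_det.
Qed.

(** With b and c, the entries of the matrix of Y: a pair u goes to (t u.1 - b u.2, c u.1 - t u.2),
    as [vE] and [vE'] show. *)
Let t := v i1 * (p i2).2 - v i2 * (p i1).2 + v i3 * (p i4).2 - v i4 * (p i3).2.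
Let b := v i1 * (p i2).1 - v i2 * (p i1).1 + v i3 * (p i4).1 - v i4 * (p i3).1.
Let c := v' i1 * (p i2).2 - v' i2 * (p i1).2 + v' i3 * (p i4).2 - v' i4 * (p i3).2.

(* Y applied to the expansion of p k in the frame p i1, ..., p i4, whose      *)
(* coefficients are coinvariant.                                              *)
Let vE k : v k = t * (p k).1 - b * (p k).2.
Proof.
have E : (p k).1 = det (p k) (p i2) * (p i1).1 - det (p k) (p i1) * (p i2).1
       + det (p k) (p i4) * (p i3).1 - det (p k) (p i3) * (p i4).1.
  by rewrite -[LHS]mulr1 -norm1 /det; ring.
rewrite [LHS](congr1 Y E) !(YB, zmod_morphismD YB) !YM !Ydet /t /b /v /det; ring.
Qed.

(** The trace of the matrix vanishes: Y of [norm1] is expanded once by the Leibniz rule and once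
    through [Ydet]. *)
Let tE : t = v' i1 * (p i2).1 - v' i2 * (p i1).1 + v' i3 * (p i4).1 - v' i4 * (p i3).1.
Proof.
apply/eqP; rewrite -subr_eq0; apply/eqP; have := congr1 Y norm1.
rewrite (zmod_morphismD YB) !Ydet; have := congr1 Y norm1.
rewrite /det !(YB, zmod_morphismD YB) !YM => E E'.
have -> : (0 : A) = Y 1 by rewrite -E' addr0.
by rewrite -E /t /v /v'; ring.
Qed.

Let vE' k : v' k = c * (p k).1 - t * (p k).2.
Proof.
have E : (p k).2 = det (p k) (p i2) * (p i1).2 - det (p k) (p i1) * (p i2).2
       + det (p k) (p i4) * (p i3).2 - det (p k) (p i3) * (p i4).2.
  by rewrite -[LHS]mulr1 -norm1 /det; ring.
rewrite [LHS](congr1 Y E) !(YB, zmod_morphismD YB) !YM !Ydet tE /c /v' /det; ring.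
Qed.

Let YE a : Y a = t * T1 a + 2^-1 *: (b * T2 a) + 2^-1 *: (c * T3 a).
Proof.
have half (e : A) : 2^-1 *: (e *+ 2) = e.
  by rewrite -[e *+ 2]scaler_nat scalerA mulVf ?scale1r // pnatr_eq0.
move: a; apply: (derivation_along_ext dY) => [|k|k].
- apply: derivationD; [apply: derivationD|]; first exact: derivationM.
  + by apply: derivationZ; apply: derivationM.
  + by apply: derivationZ; apply: derivationM.
- have [-> _] := T1p k; have [-> _] := T2p k; have [-> _] := T3p k.
  by rewrite -/(v k) vE mulrnAr half mulr0 scaler0 addr0 mulrN.
- have [_ ->] := T1p k; have [_ ->] := T2p k; have [_ ->] := T3p k.
  by rewrite -/(v' k) vE' mulrnAr half mulr0 scaler0 addr0 mulrN addrC.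
Qed.

Let beta k l := det (v k, v' k) (p l).

(** V_ij is matched with the [beta] of the partners of i and j under 1 <-> 2, 3 <-> 4, since these
    are the indices paired in the sphere relation. *)
Let F (g : gen) : A := 2^-1 *: match g with
  | K1 => beta i3 i4 - beta i1 i2
  | K2 => beta i3 i4 + beta i1 i2
  | W10 => - (s2^-1 *: (beta i2 i3 *+ 2)) | Wm10 => - (s2^-1 *: (beta i1 i4 *+ 2))
  | W01 => - (s2^-1 *: (beta i1 i3 *+ 2)) | W0m1 => s2^-1 *: (beta i2 i4 *+ 2)
  | W11 => beta i3 i3 | Wm1m1 => - beta i4 i4
  | W1m1 => - beta i2 i2 | Wm11 => beta i1 i1
  end.

Let YK a : Y a = \sum_(g <- gens) F g * gfield g a.
Proof.
have s20 : s2 != 0 by apply/eqP => s0; move: s2s2; rewrite s0 mul0r => /esym/eqP; rewrite pnatr_eq0.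
have half (e : A) : 2^-1 *: (e *+ 2) = e.
  by rewrite -[e *+ 2]scaler_nat scalerA mulVf ?scale1r // pnatr_eq0.
rewrite YE !big_cons big_nil addr0 /F -!scalerAl.
rewrite -[t * _]half -!scalerDr; congr (_ *: _).
rewrite /gfield /lincomb !(big_cons, big_nil) /= !addr0 !(mulNr, mulrN, scaleN1r, scale1r, scaleNr).
rewrite -!(scalerAl, scalerAr) !scalerN !scalerA mulVf // !scale1r !opprK.
(* Inserting the square of the sphere relation gives both sides degree four in the entries of the
   pairs, t, b and c being kept as variables; the identity then holds formally. *)
transitivity ((t * T1 a *+ 2 + b * T2 a + c * T3 a)
    * (det (p i1) (p i2) + det (p i3) (p i4)) ^+ 2); first by rewrite norm1 expr1n mulr1.
by rewrite /beta /= /det /= !vE !vE' /vfield; ring.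
Qed.

Lemma taut_gens : exists f, (forall g, coinv (f g)) /\ psi =1 tcomb f gens.
Proof.
(* This rotation is the inverse of the one built into [gcomb]. *)
exists (fun g => rot (gw g) (F g)); split=> [g|a].
  have Cb k l : coinv (beta k l) by apply: coinv_det.
  have C2 e : coinv e -> coinv (e *+ 2) by move=> Ce; rewrite mulr2n; apply: coinvD.
  have CN e : coinv e -> coinv (- e) by rewrite -scaleN1r; apply: coinvZ.
  apply/coinv_rot/coinvZ; case: g; do ?[apply: CN|apply: coinvZ|apply: C2|apply: Cb];
    by [apply: coinvB|apply: coinvD].
rewrite -tD_gcomb -(untwistK psi a); congr (omw _ _ a); apply/funext => e.
rewrite -/Y YK; apply: eq_bigr => g _.
by rewrite rotD addNr rot0.
Qed.

End Generation.

(** * Brackets of generic elements *)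

Definition lin (phi : A -> A) (phiL : linear phi) : {linear A -> A} :=
  HB.pack_for {linear A -> A} phi (GRing.isLinear.Build C A A *:%R phi phiL).

Inductive hom_sum : (A -> A) -> Prop :=
| HomSum r psi of linear psi & wt_map r psi & taut psi : hom_sum psi
| HomSumD psi phi of hom_sum psi & hom_sum phi : hom_sum (fun a => psi a + phi a).

Lemma hom_sum_linear psi : hom_sum psi -> linear psi.
Proof.
elim=> // {}psi phi _ psiL _ phiL k a b.
by rewrite psiL phiL scalerDr addrACA.
Qed.

(** A linear map may have infinitely many weight components, so finiteness comes from generation:
    psi is a sum of ten terms f D(K), and each coefficient f is a finite sum of homogeneous
    coinvariants. *)
Lemma taut_hom_sum psi : taut psi -> hom_sum psi.
Proof.
move=> psi_taut; have [[psiL _] _ _] := psi_taut.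
have [|f [Cf psiE]] := @taut_gens (lin psiL); first exact: psi_taut.
have -> : psi = tcomb f gens by apply/funext => a; rewrite -psiE.
have tcomb0 (e : gen -> A) : tcomb e [::] = fun _ => 0.
  by apply/funext => a; rewrite /tcomb big_nil.
elim: gens => [|g r IH].
  have t0 : taut (tcomb f [::]) by exact: taut_tcomb.
  apply: (@HomSum 0) => //; rewrite tcomb0; first by move=> k a b; rewrite scaler0 addr0.
  have [H1B _ _] := H1_deriv; have [H2B _ _] := H2_deriv.
  by move=> a /=; rewrite !scaler0 !subr0 (zmod_morphism0 H1B) (zmod_morphism0 H2B).
have -> : tcomb f (g :: r) = fun a => tmod (f g) (tgen g) a + tcomb f r a.
  by apply/funext => a; rewrite /tcomb big_cons.
apply: HomSumD => //.
move: (f g) (Cf g) => {IH} h Ch; elim/coinv_ind: h / Ch => [s h sh Ch|h h1 Eh Eh1].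
  apply: (@HomSum (s + gw g)).
  - exact: tmod_linear.
  - exact: tmod_wt_map sh (tgen_wt_map g).
  have -> : tmod h (tgen g) = tcomb (fun _ => h) [:: g].
    by apply/funext => a; rewrite /tcomb big_seq1.
  exact: taut_tcomb.
have -> : tmod (h + h1) (tgen g) = fun a => tmod h (tgen g) a + tmod h1 (tgen g) a.
  by apply/funext => a; rewrite /tmod tmulDl.
exact: HomSumD.
Qed.

(** Additivity in psi, lam, f and f', in this order, reduces everything to [tmod_br_hom]. *)
Lemma tbr_tmod psi lam f f' : taut psi -> taut lam -> coinv f -> coinv f' ->
  tbr (tmod f psi) (tmod f' lam) =1 tmod_br f f' psi lam.
Proof.
move=> /taut_hom_sum Hpsi /taut_hom_sum Hlam Cf Cf' c.
pose Bf g (phi : {linear A -> A}) := lin (tmod_linear g phi).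
elim: Hpsi => {psi} [r psi psiL rpsi Tpsi|psi1 psi2 H1' E1 H2' E2]; last first.
  have L1 := hom_sum_linear H1'; have L2 := hom_sum_linear H2'.
  have L := hom_sum_linear (HomSumD H1' H2').
  rewrite (@tmod_br_Dl f f' (lin L1) (lin L2) (lin L) (lin (hom_sum_linear Hlam))) //.
  rewrite -[tmod_br _ _ (lin L1) _ _]E1 -[tmod_br _ _ (lin L2) _ _]E2.
  apply: (@tbrDl (Bf f (lin L1)) (Bf f (lin L2)) (Bf f (lin L)) (Bf f' (lin (hom_sum_linear Hlam)))) => b.
  exact: tmulDr.
elim: Hlam => {lam} [t lam lamL tlam Tlam|lam1 lam2 H1' E1 H2' E2]; last first.
  have L1 := hom_sum_linear H1'; have L2 := hom_sum_linear H2'.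
  have L := hom_sum_linear (HomSumD H1' H2').
  rewrite (@tmod_br_Dr f f' (lin psiL) (lin L1) (lin L2) (lin L)) //.
  rewrite -[tmod_br _ _ _ (lin L1) _]E1 -[tmod_br _ _ _ (lin L2) _]E2.
  apply: (@tbrDr (Bf f (lin psiL)) (Bf f' (lin L1)) (Bf f' (lin L2)) (Bf f' (lin L))) => b.
  exact: tmulDr.
have [Bpsi _ psi0] := Tpsi; have [Blam _ lam0] := Tlam.
elim/coinv_ind: f / Cf => [m f mf Cf|f1 f2 E1 E2]; last first.
  rewrite tmod_br_Df -E1 -E2.
  apply: (@tbrDl (Bf f1 (lin psiL)) (Bf f2 (lin psiL)) (Bf (f1 + f2) (lin psiL)) (Bf f' (lin lamL))) => b.
  exact: tmulDl.
elim/coinv_ind: f' / Cf' => [n f' nf' Cf'|f1 f2 E1 E2]; last first.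
  rewrite (tmod_br_Df' f f1 f2 (lin psiL) (lin lamL)) -[tmod_br f f1 _ _ _]E1 -[tmod_br f f2 _ _ _]E2.
  apply: (@tbrDr (Bf f (lin psiL)) (Bf f1 (lin lamL)) (Bf f2 (lin lamL)) (Bf (f1 + f2) (lin lamL))) => b.
  exact: tmulDl.
apply: (@tmod_br_hom (lin psiL) (lin lamL) m n r t) => //; [exact: psi0|exact: lam0].
Qed.

(** * The involution on the generators *)

Hypothesis stM : forall a b, st (a * b) = st a * st b.
(** Conjugation sends a pair to its partner with entries exchanged, up to signs: the quaternionic
    structure of the doublet representation. In [eps] the index k starts at 0. *)
Definition bar (k : 'I_4) : 'I_4 :=
  match val k with 0 => i2 | 1 => i1 | 2 => i4 | _ => i3 end.
Definition eps (k : 'I_4) : A := (-1) ^+ k.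
Hypothesis st_p : forall k,
  st (p k).1 = eps k * (p (bar k)).2 /\ st (p k).2 = - (eps k * (p (bar k)).1).

Let stN a : st (- a) = - st a.
Proof. exact: (zmod_morphismN stB). Qed.
Let stD a b : st (a + b) = st a + st b. Proof. exact: zmod_morphismD. Qed.

Let st_eps k : st (eps k) = eps k.
Proof.
have st1 : st 1 = 1.
  have := stM 1 (st 1); rewrite mul1r stK mulr1 => E.
  by rewrite -E.
by elim/ord4P: k; rewrite /eps /= ?expr0 ?expr1 ?expr2 ?exprS ?expr0 ?mulr1 ?mulN1r ?opprK ?stN st1.
Qed.

Lemma st_det k l : st (det (p k) (p l)) = eps k * eps l * det (p (bar k)) (p (bar l)).
Proof.
rewrite /det stB !stM; have [-> ->] := st_p k; have [-> ->] := st_p l; ring.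
Qed.

(** Conjugating a derivation by the involution gives a derivation, so the comparison takes place on
    the pairs. There the signs of k and [bar k] multiply to -1, which absorbs the minus sign of the
    involution on second entries. *)
Lemma st_vfield i j a : st (vfield i j (st a)) = eps i * eps j * vfield (bar i) (bar j) a.
Proof.
have VD b c : vfield i j (b + c) = vfield i j b + vfield i j c by exact: raddfD.
have VN b : vfield i j (- b) = - vfield i j b by exact: raddfN.
have [VB VC VM] := vfield_derivation i j.
have Veps k b : vfield i j (eps k * b) = eps k * vfield i j b.
  by rewrite /eps -signr_odd; case: (odd k); rewrite ?expr0 ?mul1r // expr1 !mulN1r VN.
have epsbar k : eps k * eps (bar k) = -1.
  by elim/ord4P: k; rewrite /eps /=; ring.
have barK k : bar (bar k) = k by elim/ord4P: k.
have sgn k b : b = eps k * eps (bar k) * - b by rewrite epsbar mulN1r opprK.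
move: a; apply: (derivation_along_ext (e := id)) => [||k|k].
- split=> [a b|k|a b]; first by rewrite stB VB stB.
  + have st1 : st 1 = 1 by have := st_eps i1; rewrite /eps expr0.
    by rewrite stZ st1 VC zmod_morphism0.
  + by rewrite stM VM stD !stM !stK.
- exact: derivationM (vfield_derivation _ _).
all: have [e1 e2] := st_p k; have [V1 V2] := vfield_p i j (bar k).
all: have [V1' V2'] := vfield_p (bar i) (bar j) k.
all: have [pj1 pj2] := st_p j; have [pi1 pi2] := st_p i.
- rewrite V1' e1 Veps V2 stM stD st_eps !stM !st_det barK pi2 pj2.
  rewrite [RHS](sgn k); ring.
rewrite V2' e2 VN Veps V1 stN stM stD st_eps !stM !st_det barK pi1 pj1.
rewrite [RHS](sgn k); ring.
Qed.

(** Passing to [bar] negates both weights and thus yields the opposite generator; the minus sign is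
    the one in the definition of the star of a map. *)
Lemma st_gfield g a : st (gfield g (st a)) = - gfield (gen_opp g) a.
Proof.
have conj_s2 : conjc s2 = s2 by rewrite /conjc /= oppr0.
have stV k i j : conjc k = k ->
    st (k *: vfield i j (st a)) = k *: (eps i * eps j * vfield (bar i) (bar j) a).
  by move=> kR; rewrite stZ kR st_vfield.
have R1 : conjc (1 : C) = 1 by rewrite rmorph1.
have R2 : conjc (- s2) = - s2 by rewrite -[in RHS]conj_s2; apply: rmorphN.
have R3 : conjc (-1 : C) = -1 by rewrite rmorphN1.
rewrite /gfield /lincomb; case: g; rewrite /= !big_cons !big_nil !addr0 ?stD !stV //= /bar /=.
all: by rewrite ?(scaleNr, scale1r) ?algE /eps /vfield /=; ring.
Qed.

Lemma tstar_tgen g : tstar (tgen g) = tgen (gen_opp g).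
Proof.
have gwN : gw (gen_opp g) = - gw g.
  by case: g; apply: pairE; rewrite /= ?oppr0 ?opprK.
apply/funext; apply: wt_ext => [a b|a b|s a sa]; [exact: tstar_zmod|exact: raddfB|].
rewrite (tstar_vec (tgen_wt_map g) sa) /= !tgenE gwN.
rewrite (rot_vec _ (st_wt sa)) (rot_vec _ sa) !linZ stZ st_gfield phase_conj !scalerN opprK scalerA -phaseD.
by congr (ph _ *: _); rewrite /wedge /=; ring.
Qed.

Lemma tbr_tgen_star (g h : gen) :
  tbr (tstar (tgen h)) (tstar (tgen g)) = tstar (tbr (tgen g) (tgen h)).
Proof.
have gwN e : gw (gen_opp e) = - gw e.
  by case: e; apply: pairE; rewrite /= ?oppr0 ?opprK.
have XwN e : wt_map (- gw e) (tgen (gen_opp e)) by rewrite -gwN; apply: tgen_wt_map.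
apply/funext => a; rewrite !tstar_tgen.
by apply: (tbr_star (tgen_wt_map g) (tgen_wt_map h) (XwN g) (XwN h)) => b; rewrite tstar_tgen.
Qed.

(** * The bracket table and the abstract theorem *)

Ltac side_tac :=
  rewrite /=; repeat match goal with
  | |- [/\ _, _ & _] => split; [first [exact: al_wt|exact: be_wt|exact: als_wt|exact: bes_wt|exact: xx_wt]|phase_tac|]
  | |- True => exact: I
  end.

Ltac table_tac :=
  rewrite !(big_cons, big_nil) /= ?fctE /tmod /= ?(tmulBr, tmulDr) ?(scalerBr, scalerDr) ?scaleNr;
  rewrite ?algE; ring.

Theorem gauge_algebra :
  [/\ forall psi, taut psi <-> exists f : gen -> A,
        (forall g, coinv (f g)) /\ psi = \sum_(g <- gens) tmod (f g) (tgen g),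
  tbr (tgen K1) (tgen K2) = s2 *: (tmod als (tgen W10) - tmod al (tgen Wm10)) /\
  tbr (tgen K1) (tgen W01) = - (s2 *: (tmod be (tgen K2))) + 2 *: (tmod xx (tgen W01)) /\
  tbr (tgen K1) (tgen W1m1) =
    - (2 *: (tmod xx (tgen W1m1))) + (s2 * q) *: (tmod bes (tgen W10)) /\
  tbr (tgen K1) (tgen W10) =
    (s2 * q^-1) *: (tmod be (tgen W1m1)) - (s2 * q) *: (tmod bes (tgen W11)) /\
  tbr (tgen K1) (tgen W11) =
    2 *: (tmod xx (tgen W11)) - (s2 * q^-1) *: (tmod be (tgen W10)) /\
  tbr (tgen K2) (tgen W01) =
    (s2 * q^-1) *: (tmod als (tgen W11)) + (s2 * q) *: (tmod al (tgen Wm11)) /\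
  tbr (tgen K2) (tgen W1m1) =
    2 *: (tmod xx (tgen W1m1)) - (s2 * q^-1) *: (tmod al (tgen W0m1)) /\
  tbr (tgen K2) (tgen W10) = 2 *: (tmod xx (tgen W10)) - s2 *: (tmod al (tgen K1)) /\
  tbr (tgen K2) (tgen W11) = 2 *: (tmod xx (tgen W11)) + (s2 * q) *: (tmod al (tgen W01)) /\
  tbr (tgen W01) (tgen W1m1) =
    s2 *: (tmod be (tgen W1m1)) + (s2 * q) *: (tmod al (tgen K2 - tgen K1)) /\
  tbr (tgen W01) (tgen W10) =
    s2 *: (tmod be (tgen W10)) - (s2 * q ^+ 2) *: (tmod al (tgen W01)) /\
  tbr (tgen W01) (tgen W11) = s2 *: (tmod be (tgen W11)) /\
  tbr (tgen W1m1) (tgen W10) = (s2 * q ^- 2) *: (tmod al (tgen W1m1)) /\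
  tbr (tgen W1m1) (tgen W11) = - ((s2 * q ^- 2) *: (tmod al (tgen W10))) /\
  tbr (tgen W10) (tgen W11) = s2 *: (tmod al (tgen W11)) /\
  tbr (tgen Wm1m1) (tgen W01) =
    (s2 * q ^+ 2) *: (tmod be (tgen Wm1m1))
    - (s2 * q) *: (tmod als (tgen K1 + tgen K2)) /\
  tbr (tgen Wm1m1) (tgen W1m1) = (s2 * q ^- 2) *: (tmod bes (tgen W0m1)) /\
  tbr (tgen Wm1m1) (tgen W10) =
    (s2 * q ^- 2) *: (tmod al (tgen Wm1m1))
    + (s2 * q^-1) *: (tmod bes (tgen K1 + tgen K2)) /\
  tbr (tgen Wm1m1) (tgen W11) =
    - (2 *: (tmod xx (tgen K1 + tgen K2)))
    - s2 *: (tmod al (tgen Wm10)) - s2 *: (tmod be (tgen W0m1)) /\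
  tbr (tgen Wm10) (tgen W01) =
    (s2 * q ^+ 2) *: (tmod be (tgen Wm10)) + s2 *: (tmod als (tgen W01)) /\
  tbr (tgen Wm10) (tgen W1m1) =
    - (s2 *: (tmod als (tgen W1m1))) + (s2 * q^-1) *: (tmod bes (tgen K2 - tgen K1)) /\
  tbr (tgen W10) (tgen Wm10) = s2 *: (tmod bes (tgen W01) + tmod be (tgen W0m1)) /\
  tbr (tgen Wm11) (tgen W01) = (s2 * q ^+ 2) *: (tmod be (tgen Wm11)) /\
  tbr (tgen W0m1) (tgen W01) = - (s2 *: (tmod als (tgen W10) + tmod al (tgen Wm10))) /\
  tbr (tgen Wm11) (tgen W1m1) =
    2 *: (tmod xx (tgen K1 - tgen K2))
    - s2 *: (tmod bes (tgen W01)) + s2 *: (tmod al (tgen Wm10)),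
  (forall g h : gen, tbr (tgen g) (tgen h) =
     - (ph (- 2 * wedge (gw g) (gw h)) *: tbr (tgen h) (tgen g))) /\
  (forall g, tstar (tgen g) = tgen (gen_opp g)) /\
  (forall g h : gen, tbr (tstar (tgen h)) (tstar (tgen g)) = tstar (tbr (tgen g) (tgen h)))
  & forall psi lam (f f' : A), taut psi -> taut lam -> coinv f -> coinv f' ->
      tbr (tmod f psi) (tmod f' lam) = tmod_br f f' psi lam].
Proof.
split; last 2 first.
- split; [|split].
  + move=> g h; apply/funext => a.
    by rewrite (tbr_anti _ (tgen_wt_map g) (tgen_wt_map h)).
  + exact: tstar_tgen.
  + exact: tbr_tgen_star.
- by move=> psi lam f f' Tpsi Tlam Cf Cf'; apply/funext; apply: tbr_tmod.
- have tcombE f : tcomb f gens = \sum_(g <- gens) tmod (f g) (tgen g).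
    by apply/funext => a; rewrite fct_sumE.
  move=> psi; split=> [Tpsi|[f [Cf ->]]]; last by rewrite -tcombE; apply: taut_tcomb.
  have [[psiL _] _ _] := Tpsi.
  have [f [Cf psiE]] := @taut_gens (lin psiL) Tpsi.
  by exists f; split=> //; rewrite -tcombE; apply/funext.
(* For each bracket the list of terms records the classical commutator together with its twisted
   coefficients. The three goals are then the displayed form, the weights with the phases, and the
   classical identity. *)
do ?split; apply/funext => c.
- rewrite (tbr_gens (ts := [:: (s2, s2, (-1, 0), als, W10); (- s2, - s2, (1, 0), al, Wm10)])); [table_tac|side_tac|comm_tac].
- rewrite (tbr_gens (ts := [:: (- s2, - s2, (0, 1), be, K2); (2, 2, (0, 0), xx, W01)])); [table_tac|side_tac|comm_tac].
- rewrite (tbr_gens (ts := [:: (- 2, - 2, (0, 0), xx, W1m1); (s2, s2 * q, (0, -1), bes, W10)])); [table_tac|side_tac|comm_tac].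
- rewrite (tbr_gens (ts := [:: (s2, s2 * q^-1, (0, 1), be, W1m1); (- s2, - (s2 * q), (0, -1), bes, W11)])); [table_tac|side_tac|comm_tac].
- rewrite (tbr_gens (ts := [:: (2, 2, (0, 0), xx, W11); (- s2, - (s2 * q^-1), (0, 1), be, W10)])); [table_tac|side_tac|comm_tac].
- rewrite (tbr_gens (ts := [:: (s2, s2 * q^-1, (-1, 0), als, W11); (s2, s2 * q, (1, 0), al, Wm11)])); [table_tac|side_tac|comm_tac].
- rewrite (tbr_gens (ts := [:: (2, 2, (0, 0), xx, W1m1); (- s2, - (s2 * q^-1), (1, 0), al, W0m1)])); [table_tac|side_tac|comm_tac].
- rewrite (tbr_gens (ts := [:: (2, 2, (0, 0), xx, W10); (- s2, - s2, (1, 0), al, K1)])); [table_tac|side_tac|comm_tac].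
- rewrite (tbr_gens (ts := [:: (2, 2, (0, 0), xx, W11); (s2, s2 * q, (1, 0), al, W01)])); [table_tac|side_tac|comm_tac].
- rewrite (tbr_gens (ts := [:: (s2, s2, (0, 1), be, W1m1); (s2, s2 * q, (1, 0), al, K2); (- s2, - (s2 * q), (1, 0), al, K1)])); [table_tac|side_tac|comm_tac].
(* The exponent 2 at [al] W01 arises as (1, 0) /\ (0, 1) - (0, 1) /\ (1, 0) = 1 + 1. *)
- rewrite (tbr_gens (ts := [:: (s2, s2, (0, 1), be, W10); (- s2, - (s2 * q ^+ 2), (1, 0), al, W01)])); [table_tac|side_tac|comm_tac].
- rewrite (tbr_gens (ts := [:: (s2, s2, (0, 1), be, W11)])); [table_tac|side_tac|comm_tac].
- rewrite (tbr_gens (ts := [:: (s2, s2 * q ^- 2, (1, 0), al, W1m1)])); [table_tac|side_tac|comm_tac].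
- rewrite (tbr_gens (ts := [:: (- s2, - (s2 * q ^- 2), (1, 0), al, W10)])); [table_tac|side_tac|comm_tac].
- rewrite (tbr_gens (ts := [:: (s2, s2, (1, 0), al, W11)])); [table_tac|side_tac|comm_tac].
- rewrite (tbr_gens (ts := [:: (s2, s2 * q ^+ 2, (0, 1), be, Wm1m1); (- s2, - (s2 * q), (-1, 0), als, K1); (- s2, - (s2 * q), (-1, 0), als, K2)])); [table_tac|side_tac|comm_tac].
- rewrite (tbr_gens (ts := [:: (s2, s2 * q ^- 2, (0, -1), bes, W0m1)])); [table_tac|side_tac|comm_tac].
- rewrite (tbr_gens (ts := [:: (s2, s2 * q ^- 2, (1, 0), al, Wm1m1); (s2, s2 * q^-1, (0, -1), bes, K1); (s2, s2 * q^-1, (0, -1), bes, K2)])); [table_tac|side_tac|comm_tac].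
- rewrite (tbr_gens (ts := [:: (- 2, - 2, (0, 0), xx, K1); (- 2, - 2, (0, 0), xx, K2); (- s2, - s2, (1, 0), al, Wm10); (- s2, - s2, (0, 1), be, W0m1)])); [table_tac|side_tac|comm_tac].
- rewrite (tbr_gens (ts := [:: (s2, s2 * q ^+ 2, (0, 1), be, Wm10); (s2, s2, (-1, 0), als, W01)])); [table_tac|side_tac|comm_tac].
- rewrite (tbr_gens (ts := [:: (- s2, - s2, (-1, 0), als, W1m1); (s2, s2 * q^-1, (0, -1), bes, K2); (- s2, - (s2 * q^-1), (0, -1), bes, K1)])); [table_tac|side_tac|comm_tac].
- rewrite (tbr_gens (ts := [:: (s2, s2, (0, -1), bes, W01); (s2, s2, (0, 1), be, W0m1)])); [table_tac|side_tac|comm_tac].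
- rewrite (tbr_gens (ts := [:: (s2, s2 * q ^+ 2, (0, 1), be, Wm11)])); [table_tac|side_tac|comm_tac].
- rewrite (tbr_gens (ts := [:: (- s2, - s2, (-1, 0), als, W10); (- s2, - s2, (1, 0), al, Wm10)])); [table_tac|side_tac|comm_tac].
- rewrite (tbr_gens (ts := [:: (2, 2, (0, 0), xx, K1); (- 2, - 2, (0, 0), xx, K2); (- s2, - s2, (0, -1), bes, W01); (s2, s2, (1, 0), al, Wm10)])); [table_tac|side_tac|comm_tac].
Qed.

End Twist.

(** * Infinitesimal action of SU(2) *)

Section SU2Tangent.
Variables (S : comNzRingType) (x y y' : S).
Local Notation B := (sphere 1 S).

Definition su2_val (x1 x2 x1s x2s : S) (i : 'I_(2 + 2)) : S :=
  match fintype.split i with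
  | inl j => if val j == 0 then x1 else x2
  | inr j => if val j == 0 then x1s else x2s
  end.

Definition su2_one := su2_val 1 0 1 0.
(** A tangent vector at the unit: differentiating w1s w1 + w2s w2 = 1 there forces opposite values
    on w1 and w1s, while w2 and w2s stay free. This is the complexified Lie algebra of SU(2). *)
Definition su2_dir := su2_val x y (- x) y'.

Let e0 : 'I_2 := @Ordinal 2 0 isT.
Let e1 : 'I_2 := @Ordinal 2 1 isT.

Let valE a b c d :
  (su2_val a b c d (lshift 2 e0) = a) * (su2_val a b c d (lshift 2 e1) = b) *
  (su2_val a b c d (rshift 2 e0) = c) * (su2_val a b c d (rshift 2 e1) = d).
Proof. by rewrite /su2_val !(unsplitK (inl _)) !(unsplitK (inr _)). Qed.

Let big2 (F : 'I_2 -> S) : \sum_i F i = F e0 + F e1.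
Proof. by rewrite !big_ord_recl big_ord0 addr0; congr (F _ + F _); apply: val_inj. Qed.

Let h1 : \sum_(i < 2) su2_one (rshift _ i) * su2_one (lshift _ i) = 1.
Proof. by rewrite big2 /su2_one !valE mulr1 mulr0 addr0. Qed.

Let hc : \sum_(i < 2) (su2_dir (rshift _ i) * su2_one (lshift _ i)
  + su2_one (rshift _ i) * su2_dir (lshift _ i)) = 0.
Proof. by rewrite big2 /su2_one /su2_dir !valE !mulr1 !mul1r !mulr0 !mul0r addNr !addr0. Qed.

Definition su2_counit : B -> S := sphere_eval idfun su2_one.
Definition su2_tangent : B -> S := sphere_tangent idfun su2_one su2_dir.

Lemma su2_counit_zmod : zmod_morphism su2_counit.
Proof. exact: (sphere_eval_zmod _ h1). Qed.

Lemma su2_counitM t u : su2_counit (t * u) = su2_counit t * su2_counit u.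
Proof. by have [_ M] := sphere_eval_monoid idfun h1; apply: M. Qed.

Lemma su2_counitC k : su2_counit k%:A = k.
Proof. exact: (sphere_evalC idfun h1). Qed.

Lemma su2_counitZ k t : su2_counit (k *: t) = k * su2_counit t.
Proof. by rewrite -[k *: t]mulr_algl su2_counitM su2_counitC. Qed.

Let dT : derivation_along su2_counit su2_tangent := sphere_tangent_derivation idfun h1 hc.

Lemma su2_tangent_derivation : derivation_along su2_counit su2_tangent.
Proof. exact: dT. Qed.

Lemma su2_tangentZ k t : su2_tangent (k *: t) = k * su2_tangent t.
Proof.
by have [_ TC TM] := dT; rewrite -[k *: t]mulr_algl TM TC mul0r add0r su2_counitC.
Qed.

Lemma su2_valE :
  [/\ su2_counit (sphere_class 'X_(lshift 2 e0)) = 1,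
      su2_counit (sphere_class 'X_(lshift 2 e1)) = 0,
      su2_counit (sphere_class 'X_(rshift 2 e0)) = 1
    & su2_counit (sphere_class 'X_(rshift 2 e1)) = 0] /\
  [/\ su2_tangent (sphere_class 'X_(lshift 2 e0)) = x,
      su2_tangent (sphere_class 'X_(lshift 2 e1)) = y,
      su2_tangent (sphere_class 'X_(rshift 2 e0)) = - x
    & su2_tangent (sphere_class 'X_(rshift 2 e1)) = y'].
Proof.
have E i := sphere_eval_gen idfun h1 i; have T i := sphere_tangent_gen idfun h1 hc i.
by split; split; rewrite -[sphere_class _]/(sphere_gen S _) ?[su2_counit _]E ?[su2_tangent _]T /su2_one /su2_dir valE.
Qed.

End SU2Tangent.

(** * The derivations K_j and W_r as combinations of the V_ij *)

Section Frame.
Variables (R : realType) (A : comAlgType R[i]).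
Local Notation C := R[i].
Local Notation B := (sphere 1 A).
Implicit Types (a b f : A).
Variable p : 'I_4 -> A * A.
Hypothesis gen_ind : forall Q : A -> Prop, (forall k : C, Q k%:A) ->
  (forall i, Q (p i).1) -> (forall i, Q (p i).2) ->
  (forall a b, Q a -> Q b -> Q (a + b)) -> (forall a b, Q a -> Q b -> Q (a * b)) ->
  forall a, Q a.

Section Vertical.
Variable coact : A -> B.
Hypotheses (coactB : zmod_morphism coact) (coactM : monoid_morphism coact).
Hypothesis coactC : forall k : C, coact k%:A = (k%:A : A)%:A.
Local Notation W i := (sphere_class 'X_i : B).
Hypothesis p_doublet : forall k, doublet coact (W (lshift 2 (@Ordinal 2 0 isT)))
  (W (lshift 2 (@Ordinal 2 1 isT))) (W (rshift 2 (@Ordinal 2 0 isT)))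
  (W (rshift 2 (@Ordinal 2 1 isT))) (p k).

(** The counit axiom of the coaction; it turns the Leibniz rule along evaluation at the unit into
    the ordinary one in [vert_derivation]. *)
Lemma coact_counit a : su2_counit (coact a) = a.
Proof.
have [[e1 e2 e3 e4] _] := su2_valE (0 : A) 0 0.
have eB := su2_counit_zmod (S := A).
elim/gen_ind: a => [k|k|k|a b Ea Eb|a b Ea Eb].
- by rewrite coactC su2_counitC.
- have [-> _] := p_doublet k.
  by rewrite eB !su2_counitZ e1 e2 mulr1 mulr0 subr0.
- have [_ ->] := p_doublet k.
  by rewrite (zmod_morphismD eB) !su2_counitZ e3 e4 mulr1 mulr0 add0r.
- by rewrite (zmod_morphismD coactB) (zmod_morphismD eB) Ea Eb.
- by have [_ ->] := coactM; rewrite su2_counitM Ea Eb.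
Qed.

(* The infinitesimal action of the Lie algebra of SU(2): the coaction followed *)
(* by the tangent vector at the unit with coordinates x, y, y'.              *)
Definition vert (x y y' : A) a : A := su2_tangent x y y' (coact a).

Lemma vert_derivation x y y' : derivation (vert x y y').
Proof.
have [TB TC TM] := su2_tangent_derivation x y y'.
split=> [a b|k|a b].
- by rewrite /vert coactB TB.
- by rewrite /vert coactC TC.
- by have [_ cM] := coactM; rewrite /vert cM TM !coact_counit.
Qed.

Lemma vert_p x y y' k : vert x y y' (p k).1 = x * (p k).1 - y * (p k).2
  /\ vert x y y' (p k).2 = y' * (p k).1 - x * (p k).2.
Proof.
have [_ [e1 e2 e3 e4]] := su2_valE x y y'.
have [TB _ _] := su2_tangent_derivation x y y'.
have [E1 E2] := p_doublet k; split; rewrite /vert ?E1 ?E2.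
  by rewrite TB !su2_tangentZ e1 e2 [x * _]mulrC [y * _]mulrC.
by rewrite (zmod_morphismD TB) !su2_tangentZ e3 e4 mulrN [y' * _]mulrC [x * _]mulrC.
Qed.

Lemma vert_h_p k : vert 1 0 0 (p k).1 = (p k).1 /\ vert 1 0 0 (p k).2 = - (p k).2.
Proof. by have [-> ->] := vert_p 1 0 0 k; rewrite !mul0r !mul1r subr0 sub0r. Qed.

Lemma vert_e_p k : vert 0 2 0 (p k).1 = - (p k).2 *+ 2 /\ vert 0 2 0 (p k).2 = 0.
Proof.
by have [-> ->] := vert_p 0 2 0 k; rewrite !mul0r subrr sub0r mulr_natl mulNrn.
Qed.

Lemma vert_f_p k : vert 0 0 2 (p k).1 = 0 /\ vert 0 0 2 (p k).2 = (p k).1 *+ 2.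
Proof. by have [-> ->] := vert_p 0 0 2 k; rewrite !mul0r subrr subr0 mulr_natl. Qed.

Lemma vert_coinv x y y' f : coinv coact f -> vert x y y' f = 0.
Proof. by have [_ TC _] := su2_tangent_derivation x y y' => Cf; rewrite /vert Cf TC. Qed.

End Vertical.

(** The involution exchanges partners, whose weights are real and opposite, so a derivation that is
    diagonal on the pairs anticommutes with it. *)
Lemma real_weights_star (st D : A -> A) (r : 'I_4 -> R) :
    zmod_morphism st -> (forall k a, st (k *: a) = conjc k *: st a) -> involutive st ->
    (forall a b, st (a * b) = st a * st b) ->
    (forall k, st (p k).1 = eps A k * (p (bar k)).2 /\ st (p k).2 = - (eps A k * (p (bar k)).1)) ->
    derivation D -> (forall k, D (p k).1 = (r k)%:C *: (p k).1 /\ D (p k).2 = (r k)%:C *: (p k).2) ->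
    (forall k, r (bar k) = - r k) ->
  forall a, D (st a) = - st (D a).
Proof.
move=> stB stZ stK stM stp dD Dp rbar.
have [DB DC DM] := dD.
have stD := zmod_morphismD stB.
have stN := zmod_morphismN stB.
have DN := zmod_morphismN DB.
have conjR (e : R) : conjc e%:C = e%:C by rewrite /conjc /= oppr0.
have Deps k b : D (eps A k * b) = eps A k * D b.
  by rewrite /eps -signr_odd; case: (odd k); rewrite ?expr0 ?mul1r // expr1 !mulN1r DN.
have st1 : st 1 = 1.
  by have := stM 1 (st 1); rewrite mul1r stK mulr1 => E; rewrite -E.
elim/gen_ind => [k|k|k|a b Ea Eb|a b Ea Eb].
- by rewrite stZ st1 !DC (zmod_morphism0 stB) oppr0.
- have [e1 _] := stp k; have [_ D2] := Dp (bar k); have [D1 _] := Dp k.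
  by rewrite e1 Deps D2 D1 stZ conjR e1 rbar rmorphN scaleNr mulrN scalerAr.
- have [_ e2] := stp k; have [D1 _] := Dp (bar k); have [_ D2] := Dp k.
  by rewrite e2 DN Deps D1 D2 stZ conjR e2 rbar rmorphN scaleNr mulrN scalerN scalerAr.
- by rewrite stD !(zmod_morphismD DB) stD Ea Eb opprD.
- by rewrite stM !DM Ea Eb stD !stM mulNr mulrN opprD.
Qed.

Section GenDer.
Variables T1 T2 T3 : A -> A.
Hypotheses (dT1 : derivation T1) (dT2 : derivation T2) (dT3 : derivation T3).
Hypothesis T1p : forall k, T1 (p k).1 = (p k).1 /\ T1 (p k).2 = - (p k).2.
Hypothesis T2p : forall k, T2 (p k).1 = - (p k).2 *+ 2 /\ T2 (p k).2 = 0.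
Hypothesis T3p : forall k, T3 (p k).1 = 0 /\ T3 (p k).2 = (p k).1 *+ 2.

Definition acts (D : A -> A) (u : 'I_4 -> A * A) :=
  derivation D /\ forall k, D (p k).1 = (u k).1 /\ D (p k).2 = (u k).2.

Definition tab4 (T : Type) (u1 u2 u3 u4 : T) (k : 'I_4) : T :=
  match val k with 0 => u1 | 1 => u2 | 2 => u3 | _ => u4 end.

Local Notation s2 := (sqrt2 R).
Local Notation h := (2^-1 : C).

Variables H1 H2 E10 Em10 E01 E0m1 E11 Em1m1 E1m1 Em11 : A -> A.
Hypothesis aH1 : acts H1 (tab4 (h *: p i1) (- (h *: p i2)) (- (h *: p i3)) (h *: p i4)).
Hypothesis aH2 : acts H2 (tab4 (- (h *: p i1)) (h *: p i2) (- (h *: p i3)) (h *: p i4)).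
Hypothesis aE10 : acts E10 (tab4 0 (- (s2^-1 *: p i4)) (s2^-1 *: p i1) 0).
Hypothesis aEm10 : acts Em10 (tab4 (s2^-1 *: p i3) 0 0 (- (s2^-1 *: p i2))).
Hypothesis aE01 : acts E01 (tab4 (- (s2^-1 *: p i4)) 0 (- (s2^-1 *: p i2)) 0).
Hypothesis aE0m1 : acts E0m1 (tab4 0 (- (s2^-1 *: p i3)) 0 (- (s2^-1 *: p i1))).
Hypothesis aE11 : acts E11 (tab4 0 0 (p i4) 0).
Hypothesis aEm1m1 : acts Em1m1 (tab4 0 0 0 (p i3)).
Hypothesis aE1m1 : acts E1m1 (tab4 0 (p i1) 0 0).
Hypothesis aEm11 : acts Em11 (tab4 (p i2) 0 0 0).

Definition gder (g : gen) a : A :=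
  match g with
  | K1 => 2 *: (xx p * H2 a) + s2 *: (bes p * E01 a) + s2 *: (be p * E0m1 a)
  | K2 => 2 *: (xx p * H1 a) + s2 *: (als p * E10 a) + s2 *: (al p * Em10 a)
  | W01 => s2 *: (be p * H1 a + als p * E11 a + al p * Em11 a)
  | W0m1 => s2 *: (bes p * H1 a + als p * E1m1 a + al p * Em1m1 a)
  | W10 => s2 *: (al p * H2 a - bes p * E11 a + be p * E1m1 a)
  | Wm10 => s2 *: (als p * H2 a + bes p * Em11 a - be p * Em1m1 a)
  | W11 => 2 *: (xx p * E11 a) + s2 *: (al p * E01 a) - s2 *: (be p * E10 a)
  | Wm1m1 => 2 *: (xx p * Em1m1 a) + s2 *: (als p * E0m1 a) - s2 *: (bes p * Em10 a)
  | W1m1 => - (2 *: (xx p * E1m1 a)) + s2 *: (bes p * E10 a) + s2 *: (al p * E0m1 a)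
  | Wm11 => - (2 *: (xx p * Em11 a)) + s2 *: (be p * Em10 a) + s2 *: (als p * E01 a)
  end.

Lemma gder_derivation g : derivation (gder g).
Proof.
have [dH1 _] := aH1; have [dH2 _] := aH2; have [dE10 _] := aE10.
have [dEm10 _] := aEm10; have [dE01 _] := aE01; have [dE0m1 _] := aE0m1.
have [dE11 _] := aE11; have [dEm1m1 _] := aEm1m1; have [dE1m1 _] := aE1m1.
have [dEm11 _] := aEm11.
case: g; rewrite /gder /=; repeat first
  [apply: derivationD|apply: derivationN|apply: derivationZ|apply: derivationM|assumption].
Qed.

Let s2_neq0 : s2 != 0.
Proof. by rewrite /sqrt2 fmorph_eq0 sqrtr_eq0 -ltNge ltr0n. Qed.

Let two_neq0 : (2 : C) != 0. Proof. by rewrite pnatr_eq0. Qed.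

Let cancelZ (k : C) a b : k != 0 -> k *: (a * (k^-1 *: b)) = a * b.
Proof. by move=> k0; rewrite -scalerAr scalerA divff // scale1r. Qed.

Let halfM a b : (a *+ 2) * (h *: b) = a * b.
Proof.
by rewrite -[a *+ 2]scaler_nat -scalerAl -scalerAr scalerA divff ?scale1r.
Qed.

(** Both sides are derivations, and on a pair they agree by the relation det (v, w) u + det (w, u) v
    + det (u, v) w = 0 between three vectors of a plane, which [ring] verifies in coordinates. *)
Lemma gderE g : gder g =1 gfield p T1 T2 T3 g.
Proof.
have [_ vH1] := aH1; have [_ vH2] := aH2; have [_ vE10] := aE10.
have [_ vEm10] := aEm10; have [_ vE01] := aE01; have [_ vE0m1] := aE0m1.
have [_ vE11] := aE11; have [_ vEm1m1] := aEm1m1; have [_ vE1m1] := aE1m1.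
have [_ vEm11] := aEm11.
have Vp := vfield_p T1p T2p T3p.
apply: (derivation_along_ext gen_ind (e := id)).
- exact: gder_derivation.
- exact: gfield_derivation.
all: move=> k.
all: case: g; rewrite /gder /gfield /lincomb !(big_cons, big_nil) /= addr0.
all: rewrite ?((proj1 (vH1 _)), (proj2 (vH1 _)), (proj1 (vH2 _)), (proj2 (vH2 _)), (proj1 (vE10 _)), (proj2 (vE10 _)), (proj1 (vEm10 _)), (proj2 (vEm10 _)), (proj1 (vE01 _)), (proj2 (vE01 _)), (proj1 (vE0m1 _)), (proj2 (vE0m1 _)), (proj1 (vE11 _)), (proj2 (vE11 _)), (proj1 (vEm1m1 _)), (proj2 (vEm1m1 _)), (proj1 (vE1m1 _)), (proj2 (vE1m1 _)), (proj1 (vEm11 _)), (proj2 (vEm11 _))).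
all: rewrite ?(proj1 (Vp _ _ _), proj2 (Vp _ _ _)).
all: elim/ord4P: k; rewrite /tab4 /=.
all: rewrite ?(scalerN, mulrN, mulr0, scaler0, scaleNr, scale1r) ?cancelZ ?mulNr.
all: rewrite // -?(scalerN s2) ?scaler_nat /xx /al /be /als /bes ?halfM.
all: first [congr (s2 *: _)|idtac]; rewrite /det.
all: move: (p i1) (p i2) (p i3) (p i4) => [x1 y1] [x2 y2] [x3 y3] [x4 y4] /=.
all: ring.
Qed.

End GenDer.
End Frame.

(** * The derivations of the sphere *)

Section Fields.
Variable R : realType.
Local Notation C := R[i].
Local Notation A := (OS7 R).
Local Notation poly := {mpoly C[4 + 4]}.
Local Notation cl := (@sphere_class 3 C).
Implicit Types (F : poly -> poly) (q : poly).

Section Descend.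
Variables (F : poly -> poly) (k : C) (u v : 'I_4 -> poly).
Hypothesis FE : forall q, F q = k *: \sum_j (u j * dz j q + v j * dzs j q).
Hypothesis F_rel : \sum_j (cl (v j) * z R j + zs R j * cl (u j)) = 0.

Let c (i : 'I_(4 + 4)) : A :=
  match fintype.split i with inl j => k *: cl (u j) | inr j => k *: cl (v j) end.

Let cl_l j : c (lshift 4 j) = k *: cl (u j). Proof. by rewrite /c (unsplitK (inl j)). Qed.
Let cl_r j : c (rshift 4 j) = k *: cl (v j). Proof. by rewrite /c (unsplitK (inr j)). Qed.

Let hc : \sum_(i < 4) (c (rshift _ i) * sphere_gen C (lshift _ i)
  + sphere_gen C (rshift _ i) * c (lshift _ i)) = 0.
Proof.
transitivity (k *: \sum_j (cl (v j) * z R j + zs R j * cl (u j))); last by rewrite F_rel scaler0.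
rewrite scaler_sumr; apply: eq_bigr => j _.
by rewrite cl_l cl_r scalerDr -scalerAl -scalerAr.
Qed.

Let h1 := sphere_rel_gen 3 C.

Let descendE a : descend F a = sphere_tangent (GRing.in_alg A) (@sphere_gen 3 C) c a.
Proof.
rewrite /descend FE sphere_classZ raddf_sum /= /sphere_tangent big_split_ord /= -big_split scaler_sumr /=.
apply: eq_bigr => j _; rewrite !mmap_sphere_gen cl_l cl_r rmorphD !rmorphM /=.
by rewrite scalerDr !scalerAl.
Qed.

(** The descended map is the tangent vector with components k u and k v at the tautological point,
    whose coordinates are the generators themselves; [F_rel] is its tangency to the sphere. *)
Lemma descend_derivation : derivation (descend F).
Proof.
have [DB DC DM] := sphere_tangent_derivation (GRing.in_alg A) h1 hc.
split=> [a b|k0|a b]; rewrite !descendE; [exact: DB|exact: DC|].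
by rewrite DM !sphere_eval_id.
Qed.

Lemma descend_z j : descend F (z R j) = k *: cl (u j).
Proof. by rewrite descendE (sphere_tangent_gen _ h1 hc (lshift 4 j)) cl_l. Qed.

Lemma descend_zs j : descend F (zs R j) = k *: cl (v j).
Proof. by rewrite descendE (sphere_tangent_gen _ h1 hc (rshift 4 j)) cl_r. Qed.

Lemma descend_acts (w : 'I_4 -> A * A) :
    w i1 = (k *: cl (u i1), k *: cl (v i2)) -> w i2 = (- (k *: cl (u i2)), k *: cl (v i1)) ->
    w i3 = (k *: cl (u i3), k *: cl (v i4)) -> w i4 = (- (k *: cl (u i4)), k *: cl (v i3)) ->
  acts (@zpair R) (descend F) w.
Proof.
move=> E1 E2 E3 E4; have dF := descend_derivation; split=> // j.
have FN : {morph descend F : a / - a} by have [FB _ _] := dF; apply: zmod_morphismN.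
case: j => -[|[|[|[|//]]]] lt_j; rewrite /zpair /=.
- have -> : w (Ordinal lt_j) = w i1 by congr w; apply: val_inj.
  by rewrite E1 descend_z descend_zs.
- have -> : w (Ordinal lt_j) = w i2 by congr w; apply: val_inj.
  by rewrite E2 FN descend_z descend_zs.
- have -> : w (Ordinal lt_j) = w i3 by congr w; apply: val_inj.
  by rewrite E3 descend_z descend_zs.
- have -> : w (Ordinal lt_j) = w i4 by congr w; apply: val_inj.
  by rewrite E4 FN descend_z descend_zs.
Qed.

End Descend.

Local Notation P := (@zpair R).
Local Notation h := (2^-1 : C).
Local Notation s2 := (sqrt2 R).

Let clZ i : cl (Defs.Zp R i) = z R i. Proof. by []. Qed.
Let clZs i : cl (Zps R i) = zs R i. Proof. by []. Qed.

Ltac rel_tac :=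
  rewrite big_ord4 /tab4 /= ?rmorphN ?rmorph0 /= ?clZ ?clZs;
  move: (z R i1) (z R i2) (z R i3) (z R i4) (zs R i1) (zs R i2) (zs R i3) (zs R i4) => *;
  ring.

Ltac poly_tac q :=
  rewrite big_ord4 /tab4 /= ?scale1r;
  move: (dz i1 q) (dz i2 q) (dz i3 q) (dz i4 q) (dzs i1 q) (dzs i2 q) (dzs i3 q) (dzs i4 q)
    (Defs.Zp R i1) (Defs.Zp R i2) (Defs.Zp R i3) (Defs.Zp R i4) (Zps R i1) (Zps R i2) (Zps R i3) (Zps R i4)
    => *; try congr (_ *: _); ring.

Let pairZ (k : C) (a b : A) : k *: (a, b) = (k *: a, k *: b). Proof. by []. Qed.
Let pairN (a b : A) : - (a, b) = (- a, - b). Proof. by []. Qed.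
Let pair0 : 0 = (0, 0) :> A * A. Proof. by []. Qed.

Ltac val_tac :=
  rewrite /tab4 /zpair /= ?rmorphN ?rmorph0 /= ?clZ ?clZs ?pair0 ?pairZ ?pairN
    ?(scalerN, opprK, scaler0, oppr0, scale1r) //.

Ltac acts_tac :=
  [> let q := fresh in move=> q; poly_tac q | rel_tac | val_tac ..].

Lemma H1_acts : acts P (@H1 R) (tab4 (h *: P i1) (- (h *: P i2)) (- (h *: P i3)) (h *: P i4)).
Proof.
rewrite /H1; apply: (@descend_acts _ h (tab4 (Defs.Zp R i1) (- Defs.Zp R i2) (- Defs.Zp R i3) (Defs.Zp R i4))
  (tab4 (- Zps R i1) (Zps R i2) (Zps R i3) (- Zps R i4))); acts_tac.
Qed.

Lemma H2_acts : acts P (@H2 R) (tab4 (- (h *: P i1)) (h *: P i2) (- (h *: P i3)) (h *: P i4)).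
Proof.
rewrite /H2; apply: (@descend_acts _ h (tab4 (- Defs.Zp R i1) (Defs.Zp R i2) (- Defs.Zp R i3) (Defs.Zp R i4))
  (tab4 (Zps R i1) (- Zps R i2) (Zps R i3) (- Zps R i4))); acts_tac.
Qed.

Lemma E10_acts : acts P (@E10 R) (tab4 0 (- (s2^-1 *: P i4)) (s2^-1 *: P i1) 0).
Proof.
rewrite /E10; apply: (@descend_acts _ (s2^-1) (tab4 0 (- Defs.Zp R i4) (Defs.Zp R i1) 0)
  (tab4 (- Zps R i3) 0 0 (Zps R i2))); acts_tac.
Qed.

Lemma Em10_acts : acts P (@Em10 R) (tab4 (s2^-1 *: P i3) 0 0 (- (s2^-1 *: P i2))).
Proof.
rewrite /Em10; apply: (@descend_acts _ (s2^-1) (tab4 (Defs.Zp R i3) 0 0 (- Defs.Zp R i2))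
  (tab4 0 (Zps R i4) (- Zps R i1) 0)); acts_tac.
Qed.

Lemma E01_acts : acts P (@E01 R) (tab4 (- (s2^-1 *: P i4)) 0 (- (s2^-1 *: P i2)) 0).
Proof.
rewrite /E01; apply: (@descend_acts _ (s2^-1) (tab4 (Defs.Zp R i4) 0 (Defs.Zp R i2) 0)
  (tab4 0 (- Zps R i3) 0 (- Zps R i1))); acts_tac.
Qed.

Lemma E0m1_acts : acts P (@E0m1 R) (tab4 0 (- (s2^-1 *: P i3)) 0 (- (s2^-1 *: P i1))).
Proof.
rewrite /E0m1; apply: (@descend_acts _ (s2^-1) (tab4 0 (Defs.Zp R i3) 0 (Defs.Zp R i1))
  (tab4 (- Zps R i4) 0 (- Zps R i2) 0)); acts_tac.
Qed.

Lemma E11_acts : acts P (@E11 R) (tab4 0 0 (P i4) 0).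
Proof.
rewrite /E11; apply: (@descend_acts _ 1 (tab4 0 0 (- Defs.Zp R i4) 0)
  (tab4 0 0 0 (Zps R i3))); acts_tac.
Qed.

Lemma Em1m1_acts : acts P (@Em1m1 R) (tab4 0 0 0 (P i3)).
Proof.
rewrite /Em1m1; apply: (@descend_acts _ 1 (tab4 0 0 0 (- Defs.Zp R i3))
  (tab4 0 0 (Zps R i4) 0)); acts_tac.
Qed.

Lemma E1m1_acts : acts P (@E1m1 R) (tab4 0 (P i1) 0 0).
Proof.
rewrite /E1m1; apply: (@descend_acts _ 1 (tab4 0 (- Defs.Zp R i1) 0 0)
  (tab4 (Zps R i2) 0 0 0)); acts_tac.
Qed.

Lemma Em11_acts : acts P (@Em11 R) (tab4 (P i2) 0 0 0).
Proof.
rewrite /Em11; apply: (@descend_acts _ 1 (tab4 (- Defs.Zp R i2) 0 0 0)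
  (tab4 0 (Zps R i1) 0 0)); acts_tac.
Qed.

End Fields.

(** * The bundle over S^4 as an instance of the abstract setting *)

Section Instance.
Variable R : realType.
Local Notation C := R[i].
Local Notation A := (OS7 R).
Local Notation P := (@zpair R).
Local Notation h := (2^-1 : C).

Let half_C : (2^-1 : R)%:C = h.
Proof. by rewrite fmorphV rmorph_nat. Qed.

Definition zpair_weight : 'I_4 -> R * R :=
  tab4 (2^-1, - 2^-1) (- 2^-1, 2^-1) (- 2^-1, - 2^-1) (2^-1, 2^-1).

Lemma H1_p k : H1 (P k).1 = (zpair_weight k).1%:C *: (P k).1 /\ H1 (P k).2 = (zpair_weight k).1%:C *: (P k).2.
Proof.
have [_ E] := H1_acts R; have [-> ->] := E k.
by elim/ord4P: k {E}; rewrite /zpair_weight /tab4 /= ?rmorphN /= ?half_C ?scaleNr.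
Qed.

Lemma H2_p k : H2 (P k).1 = (zpair_weight k).2%:C *: (P k).1 /\ H2 (P k).2 = (zpair_weight k).2%:C *: (P k).2.
Proof.
have [_ E] := H2_acts R; have [-> ->] := E k.
by elim/ord4P: k {E}; rewrite /zpair_weight /tab4 /= ?rmorphN /= ?half_C ?scaleNr.
Qed.

Let dH1 : derivation (@H1 R) := proj1 (H1_acts R).
Let dH2 : derivation (@H2 R) := proj1 (H2_acts R).

Lemma p_wt k : wt_vec (@H1 R) (@H2 R) (zpair_weight k) (P k).1 /\ wt_vec (@H1 R) (@H2 R) (zpair_weight k) (P k).2.
Proof. by have [a1 a2] := H1_p k; have [b1 b2] := H2_p k. Qed.

Lemma wt_ind (Q : A -> Prop) : (forall s a, wt_vec (@H1 R) (@H2 R) s a -> Q a) ->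
  (forall a b, Q a -> Q b -> Q (a + b)) -> forall a, Q a.
Proof.
apply: (graded_ind (@zpair_ind R)) => [k|s t a b|k].
- exact: wt_vecC.
- exact: wt_vecM.
- by exists (zpair_weight k); apply: p_wt.
Qed.

Let zM := zmod_morphismD (@star_zmod R).

Lemma star_p k : star (P k).1 = eps A k * (P (bar k)).2
  /\ star (P k).2 = - (eps A k * (P (bar k)).1).
Proof.
have starN := zmod_morphismN (@star_zmod R).
elim/ord4P: k; rewrite /eps -signr_odd /= ?expr0 ?expr1 ?mul1r ?mulN1r /zpair /bar /=
  ?starN ?star_z ?star_zs ?opprK //.
Qed.

Let star_mul (a b : A) : star (a * b) = star a * star b.
Proof. by have [_ ->] := @star_monoid R. Qed.

Let dw_bar k : zpair_weight (bar k) = - zpair_weight k.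
Proof. by elim/ord4P: k; rewrite /zpair_weight /tab4 /bar /= ?opprK //; congr (_, _); rewrite ?opprK. Qed.

Lemma star_H1 (a : A) : H1 (star a) = - star (H1 a).
Proof.
apply: (real_weights_star (@zpair_ind R) (@star_zmod R) (@starZ R) (@starK R) star_mul star_p dH1 H1_p).
by move=> k; rewrite dw_bar.
Qed.

Lemma star_H2 (a : A) : H2 (star a) = - star (H2 a).
Proof.
apply: (real_weights_star (@zpair_ind R) (@star_zmod R) (@starZ R) (@starK R) star_mul star_p dH2 H2_p).
by move=> k; rewrite dw_bar.
Qed.

Lemma p_doublet k : doublet (@coaction R) (w1 R) (w2 R) (w1s R) (w2s R) (P k).
Proof.
have pos := doublet_pair (coact := @coaction R) (w1 := w1 R) (w2 := w2 R) (w1s := w1s R) (w2s := w2s R).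
have neg := doublet_oppair (w1 := w1 R) (w2 := w2 R) (w1s := w1s R) (w2s := w2s R) (@coaction_zmod R).
elim/ord4P: k.
- by apply: (pos (z R i1) (zs R i2)); rewrite ?coaction_zE ?coaction_zsE.
- by apply: (neg (z R i2) (zs R i1)); rewrite ?coaction_zE ?coaction_zsE.
- by apply: (pos (z R i3) (zs R i4)); rewrite ?coaction_zE ?coaction_zsE.
- by apply: (neg (z R i4) (zs R i3)); rewrite ?coaction_zE ?coaction_zsE.
Qed.

Lemma p_norm : det (P i1) (P i2) + det (P i3) (P i4) = 1.
Proof.
rewrite -(sphere7_rel R) /det /zpair /=.
by move: (z R i1) (z R i2) (z R i3) (z R i4) (zs R i1) (zs R i2) (zs R i3) (zs R i4) => *; ring.
Qed.

Let cM := @coaction_monoid R.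
Let cC := @coactionC R.
Definition S7_vert_h := vert (@coaction R) 1 0 0.
Definition S7_vert_e := vert (@coaction R) 0 2 0.
Definition S7_vert_f := vert (@coaction R) 0 0 2.

Let T1_p := vert_h_p p_doublet.
Let T2_p := vert_e_p p_doublet.
Let T3_p := vert_f_p p_doublet.

Lemma T_coinv f : coinv (@coaction R) f -> [/\ S7_vert_h f = 0, S7_vert_e f = 0 & S7_vert_f f = 0].
Proof. by move=> Cf; split; apply: vert_coinv. Qed.

Lemma T_derivation x y y' : derivation (vert (@coaction R) x y y').
Proof. exact: (vert_derivation (@zpair_ind R) (@coaction_zmod R) cM cC p_doublet). Qed.

Ltac ring_z :=
  move: (z R i1) (z R i2) (z R i3) (z R i4) (zs R i1) (zs R i2) (zs R i3) (zs R i4) => *; ring.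

Lemma alphaE : alpha R = al P.
Proof. by rewrite /alpha /al /det /zpair /= scaler_nat; ring_z. Qed.

Lemma betaE : beta R = be P.
Proof. by rewrite /beta /be /det /zpair /= scaler_nat; ring_z. Qed.

Let conj2 : conjc (2 : C) = 2. Proof. exact: rmorph_nat. Qed.

Lemma alphasE : alphas R = als P.
Proof.
rewrite /alphas /alpha starZ conj2 zM !star_mul !star_z !star_zs scaler_nat.
by rewrite /als /det /zpair /=; ring_z.
Qed.

Lemma betasE : betas R = bes P.
Proof.
rewrite /betas /beta starZ conj2 star_zmod !star_mul !star_z !star_zs scaler_nat.
by rewrite /bes /det /zpair /=; ring_z.
Qed.

Lemma xS4E : xS4 R = xx P.
Proof. by rewrite /xS4 /xx /det /zpair /=; ring_z. Qed.

Lemma gen_derE g : @gen_der R g = gfield P S7_vert_h S7_vert_e S7_vert_f g.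
Proof.
apply/funext => a.
have E := gderE (@zpair_ind R) (T_derivation 1 0 0) (T_derivation 0 2 0) (T_derivation 0 0 2)
  T1_p T2_p T3_p (H1_acts R) (H2_acts R) (E10_acts R) (Em10_acts R) (E01_acts R) (E0m1_acts R)
  (E11_acts R) (Em1m1_acts R) (E1m1_acts R) (Em11_acts R) g a.
rewrite -[RHS]E {E} /gen_der alphaE betaE alphasE betasE xS4E.
by case: g.
Qed.

Let ow_vec F s (a : A) : add_fam F -> wt_vec (@H1 R) (@H2 R) s a -> over_weights F a = F s a.
Proof. exact: over_weights_vector. Qed.

Let ow_zmod (F : R * R -> A -> A) : add_fam F -> zmod_morphism (over_weights F).
Proof. exact: over_weights_is_additive. Qed.

Let mon_w (i : 'I_(2 + 2)) : sphere_mon (sphere_class 'X_i : OS7_SU2 R).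
Proof. by exists U_(i)%MM. Qed.

Definition gauge_algebra_S4 (theta : R) :=
  gauge_algebra (ow := @over_weights R) (st := @star R) (p := P) (coact := @coaction R)
    (tid := @tensor_id R) (Mon := @sphere_mon 1 A) (T1 := S7_vert_h) (T2 := S7_vert_e) (T3 := S7_vert_f)
    dH1 dH2 ow_vec ow_zmod wt_ind theta (@star_zmod R) (@starZ R) (@starK R)
    star_H1 star_H2 (@zpair_ind R) p_wt (@coaction_zmod R) cM cC (sphere_mon1 _ _) (@sphere_monM _ _)
    (@tensor_id_zmod R) (@tensor_idE R) (@sphere_mon_ind _ _)
    (mon_w _) (mon_w _) (mon_w _) (mon_w _) (SU2_rel R) p_doublet
    (T_derivation 1 0 0) (T_derivation 0 2 0) (T_derivation 0 0 2) T1_p T2_p T3_p T_coinv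
    (erefl _) (erefl _) (erefl _) (erefl _) p_norm star_mul star_p.

End Instance.

(** * Twisted and untwisted coordinates of S^4 *)

Section Hats.
Variables (R : realType) (theta : R).
Local Notation C := R[i].
Local Notation A := (OS7 R).
Local Notation P := (@zpair R).

Let dH1 : derivation (@H1 R) := proj1 (H1_acts R).
Let dH2 : derivation (@H2 R) := proj1 (H2_acts R).

Let wt_opp s t (a : A) : t = s -> wt_vec (@H1 R) (@H2 R) t (- a) -> weight_vector s a.
Proof. by move=> -> /(wt_vecN dH1 dH2); rewrite opprK. Qed.

Let z1_wt : weight_vector (2^-1, - 2^-1) (z R i1) := proj1 (p_wt R i1).
Let zs2_wt : weight_vector (2^-1, - 2^-1) (zs R i2) := proj2 (p_wt R i1).
Let z2_wt : weight_vector (- 2^-1, 2^-1) (z R i2) := wt_opp erefl (proj1 (p_wt R i2)).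
Let zs1_wt : weight_vector (- 2^-1, 2^-1) (zs R i1) := proj2 (p_wt R i2).
Let z4_wt : weight_vector (2^-1, 2^-1) (z R i4) := wt_opp erefl (proj1 (p_wt R i4)).
Let zs3_wt : weight_vector (2^-1, 2^-1) (zs R i3) := proj2 (p_wt R i4).

Let wedge_half : - wedge (2^-1, - 2^-1) (2^-1, 2^-1) = - 2^-1 :> R.
Proof. by rewrite /wedge /=; field. Qed.

Let wedge_halfN : - wedge (- 2^-1, 2^-1) (2^-1, 2^-1) = 2^-1 :> R.
Proof. by rewrite /wedge /=; field. Qed.

(** z_1 and the conjugate of z_2 have the same weight, as do z_4 and the conjugate of z_3, so both
    products acquire the same phase. *)
Let alphahatE : alphahat theta = phase theta (- 2^-1) *: alpha R.
Proof.
rewrite /alphahat /alpha (bmul_vector theta z1_wt zs3_wt) (bmul_vector theta zs2_wt z4_wt).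
by rewrite wedge_half -scalerDr !scalerA [_ * 2]mulrC.
Qed.

Let betahatE : betahat theta = phase theta 2^-1 *: beta R.
Proof.
rewrite /betahat /beta (bmul_vector theta z2_wt zs3_wt) (bmul_vector theta zs1_wt z4_wt).
by rewrite wedge_halfN -scalerBr !scalerA [_ * 2]mulrC.
Qed.

Let phase_cancel u : phase theta u * phase theta (- u) = 1.
Proof. by rewrite -phaseD subrr phase0. Qed.

Lemma al_hat : phase theta 2^-1 *: alphahat theta = al P.
Proof. by rewrite alphahatE scalerA phase_cancel scale1r alphaE. Qed.

Lemma be_hat : phase theta (- 2^-1) *: betahat theta = be P.
Proof. by rewrite betahatE scalerA mulrC phase_cancel scale1r betaE. Qed.

Lemma als_hat : phase theta (- 2^-1) *: star (alphahat theta) = als P.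
Proof. by rewrite alphahatE starZ phase_conj opprK scalerA mulrC phase_cancel scale1r -alphasE. Qed.

Lemma bes_hat : phase theta 2^-1 *: star (betahat theta) = bes P.
Proof. by rewrite betahatE starZ phase_conj scalerA phase_cancel scale1r -betasE. Qed.
End Hats.

Theorem proposition4p9 (R : realType) (theta : R) :
  let X (g : gen) : OS7 R -> OS7 R := Dtwist theta (@gen_der R g) in
  let br := bracket theta in
  let s2 : R[i] := sqrt2 R in
  let q : R[i] := phase theta 1 in
  let a : OS7 R := phase theta 2^-1 *: alphahat theta in
  let b : OS7 R := phase theta (- 2^-1) *: betahat theta in
  let a' : OS7 R := phase theta (- 2^-1) *: star (alphahat theta) in
  let b' : OS7 R := phase theta 2^-1 *: star (betahat theta) in
  let x : OS7 R := xS4 R in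
  [/\
  (* generation as a module *)
  forall psi : OS7 R -> OS7 R,
    aut theta psi <->
    exists f : gen -> OS7 R,
      (forall g, OS4 (f g)) /\ psi = \sum_(g <- gens) f g *[theta] X g,
  (* brackets of generators *)
  br (X K1) (X K2) = s2 *: (a' *[theta] X W10 - a *[theta] X Wm10) /\
  br (X K1) (X W01) = - (s2 *: (b *[theta] X K2)) + 2 *: (x *[theta] X W01) /\
  br (X K1) (X W1m1) =
    - (2 *: (x *[theta] X W1m1)) + (s2 * q) *: (b' *[theta] X W10) /\
  br (X K1) (X W10) =
    (s2 * q^-1) *: (b *[theta] X W1m1) - (s2 * q) *: (b' *[theta] X W11) /\
  br (X K1) (X W11) =
    2 *: (x *[theta] X W11) - (s2 * q^-1) *: (b *[theta] X W10) /\
  br (X K2) (X W01) =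
    (s2 * q^-1) *: (a' *[theta] X W11) + (s2 * q) *: (a *[theta] X Wm11) /\
  br (X K2) (X W1m1) =
    2 *: (x *[theta] X W1m1) - (s2 * q^-1) *: (a *[theta] X W0m1) /\
  br (X K2) (X W10) = 2 *: (x *[theta] X W10) - s2 *: (a *[theta] X K1) /\
  br (X K2) (X W11) = 2 *: (x *[theta] X W11) + (s2 * q) *: (a *[theta] X W01) /\
  br (X W01) (X W1m1) =
    s2 *: (b *[theta] X W1m1) + (s2 * q) *: (a *[theta] (X K2 - X K1)) /\
  br (X W01) (X W10) =
    s2 *: (b *[theta] X W10) - (s2 * q ^+ 2) *: (a *[theta] X W01) /\
  br (X W01) (X W11) = s2 *: (b *[theta] X W11) /\
  br (X W1m1) (X W10) = (s2 * q ^- 2) *: (a *[theta] X W1m1) /\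
  br (X W1m1) (X W11) = - ((s2 * q ^- 2) *: (a *[theta] X W10)) /\
  br (X W10) (X W11) = s2 *: (a *[theta] X W11) /\
  br (X Wm1m1) (X W01) =
    (s2 * q ^+ 2) *: (b *[theta] X Wm1m1)
    - (s2 * q) *: (a' *[theta] (X K1 + X K2)) /\
  br (X Wm1m1) (X W1m1) = (s2 * q ^- 2) *: (b' *[theta] X W0m1) /\
  br (X Wm1m1) (X W10) =
    (s2 * q ^- 2) *: (a *[theta] X Wm1m1)
    + (s2 * q^-1) *: (b' *[theta] (X K1 + X K2)) /\
  br (X Wm1m1) (X W11) =
    - (2 *: (x *[theta] (X K1 + X K2)))
    - s2 *: (a *[theta] X Wm10) - s2 *: (b *[theta] X W0m1) /\
  br (X Wm10) (X W01) =
    (s2 * q ^+ 2) *: (b *[theta] X Wm10) + s2 *: (a' *[theta] X W01) /\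
  br (X Wm10) (X W1m1) =
    - (s2 *: (a' *[theta] X W1m1)) + (s2 * q^-1) *: (b' *[theta] (X K2 - X K1)) /\
  br (X W10) (X Wm10) = s2 *: (b' *[theta] X W01 + b *[theta] X W0m1) /\
  br (X Wm11) (X W01) = (s2 * q ^+ 2) *: (b *[theta] X Wm11) /\
  br (X W0m1) (X W01) = - (s2 *: (a' *[theta] X W10 + a *[theta] X Wm10)) /\
  br (X Wm11) (X W1m1) =
    2 *: (x *[theta] (X K1 - X K2))
    - s2 *: (b' *[theta] X W01) + s2 *: (a *[theta] X Wm10),
  (* the identities giving the remaining brackets of generators *)
  (forall g h : gen,
     br (X g) (X h) =
     - (phase theta (- 2 * wedge (gen_weight R g) (gen_weight R h))
        *: br (X h) (X g))) /\
  (forall g : gen, map_star theta (X g) = X (gen_opp g)) /\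
  (forall g h : gen,
     br (map_star theta (X h)) (map_star theta (X g)) =
     map_star theta (br (X g) (X h)))
  (* brackets of generic elements *)
  & forall (psi lambda : OS7 R -> OS7 R) (f f' : OS7 R),
      aut theta psi -> aut theta lambda -> OS4 f -> OS4 f' ->
      br (f *[theta] psi) (f' *[theta] lambda) =
      f *[theta] (fun c => over_weights
        (fun s f'_s => (f'_s *[theta] br (R_act theta s psi) lambda) c) f')].

Proof.
move=> X br s2 q a b a' b' x.
have E : X = tgen (@over_weights R) theta (@zpair R) (@S7_vert_h R) (@S7_vert_e R) (@S7_vert_f R).
  by apply/funext => g; rewrite /X /tgen gen_derE.
have aE : a = al (@zpair R) := al_hat theta.
have bE : b = be (@zpair R) := be_hat theta.
have a'E : a' = als (@zpair R) := als_hat theta.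
have b'E : b' = bes (@zpair R) := bes_hat theta.
have xE : x = xx (@zpair R) := xS4E R.
(* The abstract operations repeat the concrete definitions with [over_weights] for [ow], so these
   equalities hold by conversion. *)
have brE : br = tbr (@over_weights R) theta by [].
have modE : module_act theta = tmod (@over_weights R) theta by [].
have starE : map_star theta = tstar (@over_weights R) theta (@star R) by [].
have autE : aut theta = taut (@over_weights R) theta (@coaction R) (@tensor_id R) by [].
have OS4E : @OS4 R = coinv (@coaction R) by [].
(* Forgetting the bodies of the local definitions lets the equations replace them throughout the
   goal. *)
move: X br a b a' b' x E brE aE bE a'E b'E xE => X br a b a' b' x -> -> -> -> -> -> ->.
have [G Tab Anti Gen] := gauge_algebra_S4 theta.
split.
- by rewrite autE OS4E modE.
- rewrite modE /s2 /q. exact: Tab.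
- rewrite starE. exact: Anti.
- rewrite autE OS4E modE. exact: Gen.
Qed.
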